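(* Consider the fully discrete IMEX-RK Fourier-Galerkin scheme described in the context, applied to $\bm U_t+\bm A\bm U_x=\frac1\varepsilon \bm Q\bm U$ with periodic boundary conditions. Assume that the IMEX-RK time discretization is of type CK and ISA, and that there exists a matrix $\bm M\in\mathbb R^{s\times s}$ satisfying (M1) and (M2). In addition assume: - The scheme satisfies the standard first-, second- and third-order conditions (listed in the context). - $c_i=\tilde c_i$ for $i=1,\dots,s$. - The last component of $\bm v$ is zero, where $\bm v$ is a generator of the one-dimensional null space of $\bm H$. - The stage order conditions $\frac12c_i^2=\sum_{j=1}^{i-1}\tilde h_{ij}c_j=\sum_{j=1}^{i}h_{ij}c_j$ for $i=3,\dots,s$. - The vanishing coefficient condition: $\tilde b_2=0$ and $h_{i,2}=0$ for $i=3,\dots,s$. - The initial data is consistent up to order $8$ (defined in the context). Let $C_{CFL}>0$ be any fixed number. Then for any $T>0$ there exist positive constants $c_0$ and $C$, independent of $\varepsilon$, $N$ and $\Delta t$, such that for all integers $n$ with $n\Delta t\le T$, whenever $\Delta t\le\min(C_{CFL}/N^2,c_0)$, $$\|\bm U_e^n\|^2\le C\Big(\Delta t^6+\frac1{N^{12}}\Big).$$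
   Context: **System.** $\bm U=\bm U(x,t)\in\mathbb R^m$, $x\in[-\pi,\pi]$ with periodic boundary conditions, $\varepsilon>0$ is a (small) relaxation parameter, and $$\bm U_t+\bm A\bm U_x=\frac1\varepsilon\bm Q\bm U,\qquad \bm Q=\begin{pmatrix}0&0\\0&\hat{\bm S}\end{pmatrix},$$ where $\bm A,\bm Q\in\mathbb R^{m\times m}$ are constant, $0<r\le m$, and $\hat{\bm S}\in\mathbb R^{r\times r}$ is invertible. Structural stability condition (standing): there is a symmetric positive-definite (SPD) matrix $\bm A_0$ with $\bm A_0\bm A=\bm A^T\bm A_0$ and $\bm A_0\bm Q+\bm Q^T\bm A_0\le-\begin{pmatrix}0&0\\0&\bm I_r\end{pmatrix}$. Moreover $\bm A_0=\mathrm{diag}(\bm A_{01},\bm A_{02})$ is block diagonal with the same partition as $\bm Q$, and $\bm A_{02}\hat{\bm S}$ is assumed symmetric (negative definite). $\|\cdot\|$ is the $L^2$ norm on $[-\pi,\pi]$. **Scheme.** An $s$-stage IMEX-RK method is given by $\tilde{\bm H}=(\tilde h_{ij})\in\mathbb R^{s\times s}$ strictly lower triangular, $\bm H=(h_{ij})\in\mathbb R^{s\times s}$ lower triangular with $h_{ii}\ge0$ for all $i$, and $\tilde{\bm b},\bm b\in\mathbb R^s$; put $\tilde c_i=\sum_{j=1}^{i-1}\tilde h_{ij}$, $c_i=\sum_{j=1}^{i}h_{ij}$. With time step $\Delta t>0$ and $P_N=\mathrm{span}\{e^{ikx}:-N\le k\le N\}$, the unknowns have components in $P_N$ and satisfy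 $$(\bm U^{(i)})_N=(\bm U^n)_N-\Delta t\sum_{j=1}^{i-1}\tilde h_{ij}\bm A\partial_x(\bm U^{(j)})_N+\frac{\Delta t}{\varepsilon}\sum_{j=1}^{i}h_{ij}\bm Q(\bm U^{(j)})_N,\quad i=1,\dots,s,$$ $$(\bm U^{n+1})_N=(\bm U^n)_N-\Delta t\sum_{j=1}^{s}\tilde b_j\bm A\partial_x(\bm U^{(j)})_N+\frac{\Delta t}{\varepsilon}\sum_{j=1}^{s}b_j\bm Q(\bm U^{(j)})_N.$$ **Type CK:** $\bm H=\begin{pmatrix}0&0\\ \bm h&\hat{\bm H}\end{pmatrix}$ with $\bm h\in\mathbb R^{s-1}$ and $\hat{\bm H}\in\mathbb R^{(s-1)\times(s-1)}$ invertible. **ISA** (implicitly stiffly accurate): $h_{si}=b_i$ for $i=1,\dots,s$. **Order conditions** (all sums over $1,\dots,s$). First: $\sum_i\tilde b_i=\sum_i b_i=1$. Second: $\sum_i\tilde b_i\tilde c_i=\sum_i b_ic_i=\sum_i\tilde b_ic_i=\sum_i b_i\tilde c_i=\frac12$. Third: $$\sum_{i,j}\tilde b_i\tilde h_{ij}\tilde c_j=\sum_{i,j}b_ih_{ij}c_j=\tfrac16,\quad \sum_i\tilde b_i\tilde c_i\tilde c_i=\sum_ib_ic_ic_i=\tfrac13,$$ $$\sum_{i,j}\tilde b_i\tilde h_{ij}c_j=\sum_{i,j}\tilde b_ih_{ij}\tilde c_j=\sum_{i,j}\tilde b_ih_{ij}c_j=\tfrac16,\quad \sum_{i,j}b_i\tilde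 h_{ij}c_j=\sum_{i,j}b_ih_{ij}\tilde c_j=\sum_{i,j}b_i\tilde h_{ij}\tilde c_j=\tfrac16,$$ $$\sum_i\tilde b_ic_ic_i=\sum_i\tilde b_i\tilde c_ic_i=\sum_ib_i\tilde c_i\tilde c_i=\sum_ib_i\tilde c_ic_i=\tfrac13.$$ **Conditions on $\bm M$.** For $\bm M\in\mathbb R^{s\times s}$ put $\bm M_\star=\bm M\bm B+\mathrm{diag}(1,0,\dots,0,-1)$, where $\bm B\in\mathbb R^{s\times s}$ has zero first row and, for $i\ge2$, its $i$-th row has $-1$ in column $1$, $1$ in column $i$, and zeros elsewhere. (M1) $\bm M\bm H+(\bm M\bm H)^T$ is positive semi-definite and has rank $s-1$. (M2) $\bm M_\star+\bm M_\star^T$ is positive semi-definite and has rank $s-1$. **Consistency of the initial data.** Let $\bm U$ be the exact solution with $\bm U(\cdot,0)=\bm U_{in}$. The initial data is consistent up to order $q$ if $\|\bm U_{in}\|_{H^q}^2$ is bounded by a constant independent of $\varepsilon$, and the scheme is applied after an initial layer of length $T_0\ge0$ with $T_0\ge2\delta_0^{-1}q\,\varepsilon\log(1/\varepsilon)$; that is, the scheme is started at time $T_0$, $t_n=T_0+n\Delta t$, and $(\bm U^0)_N$ is the componentwise $L^2$-orthogonal projection of $\bm U(\cdot,T_0)$ onto $P_N$. Here $\delta_0>0$ is a constant determined by $\bm A_{02}$ and $\bm A_{02}\hat{\bm S}$ for which the following known regularity result holds: writing $\bm U=(\bm V,\bm W)$ with $\bm V\in\mathbb R^{m-r}$, $\bm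 W\in\mathbb R^r$, for every integer $\sigma\ge0$ there is $C$ independent of $\varepsilon$ such that $\|\bm U(\cdot,t)\|_{H^\sigma}^2\le C\|\bm U(\cdot,0)\|_{H^\sigma}^2$ for $t\ge0$ and, for $t\ge2\delta_0^{-1}\sigma\varepsilon\log(1/\varepsilon)$, $\|\partial_t^{r_1}\partial_x^{r_2}\bm U(\cdot,t)\|^2\le C\|\bm U(\cdot,0)\|_{H^\sigma}^2$ for $r_1+r_2\le\sigma$ and $\|\partial_t^{r_1}\partial_x^{r_2}\bm W(\cdot,t)\|^2\le C\varepsilon^2\|\bm U(\cdot,0)\|_{H^\sigma}^2$ for $r_1+r_2\le\sigma-1$. **Error.** $\bm U_e^n=(\bm U^n)_N-\bm U(\cdot,t_n)$. *)

(* Defs.v *)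
From HB Require Import structures.
From mathcomp Require Import all_boot all_order all_algebra.
From mathcomp Require Import all_classical all_reals all_analysis.
From mathcomp Require Import complex.

Set Implicit Arguments.
Unset Strict Implicit.
Unset Printing Implicit Defensive.

Import Order.TTheory GRing.Theory Num.Theory.
Import numFieldNormedType.Exports.

Local Open Scope classical_set_scope.
Local Open Scope ring_scope.

Section Matrices.
Variable R : realType.

Definition psdmx n (M : 'M[R]_n) : Prop :=
  M^T = M /\ forall v : 'cV[R]_n, 0 <= (v^T *m M *m v) 0 0.

Definition spdmx n (M : 'M[R]_n) : Prop :=
  M^T = M /\ forall v : 'cV[R]_n, v != 0 -> 0 < (v^T *m M *m v) 0 0.

Definition loewner_le n (M N : 'M[R]_n) : Prop := psdmx (N - M).

End Matrices.

(* The system size is m = p + r; the last r components are the relaxed ones. *)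
Section System.
Variables (R : realType) (p r : nat).

Definition relaxmx (S : 'M[R]_r) : 'M[R]_(p + r) := block_mx 0 0 0 S.

Record structurally_stable (A : 'M[R]_(p + r)) (S : 'M[R]_r)
    (A01 : 'M[R]_p) (A02 : 'M[R]_r) : Prop := StructurallyStable {
  stable_unit : S \in unitmx;
  stable_spd : spdmx (block_mx A01 0 0 A02);
  stable_sym : block_mx A01 0 0 A02 *m A = A^T *m block_mx A01 0 0 A02;
  stable_diss : loewner_le
    (block_mx A01 0 0 A02 *m relaxmx S + (relaxmx S)^T *m block_mx A01 0 0 A02)
    (- block_mx 0 0 0 1%:M);
  stable_negdef : spdmx (- (A02 *m S)) }.

End System.

Section FunctionSpaces.
Variable R : realType.
Local Notation mu := (@lebesgue_measure R).

Definition period_itv : set R := `[- pi, pi].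

Definition component m (u : R -> 'cV[R]_m) (i : 'I_m) : R -> R :=
  fun x => u x i 0.

(* Squared L^2 norm on [-pi, pi]; an extended real, so that an upper bound by
   a finite number is never vacuous. *)
Definition L2sq m (u : R -> 'cV[R]_m) : \bar R :=
  (\int[mu]_(x in period_itv) (\sum_(i < m) component u i x ^+ 2)%:E)%E.

Definition square_integrable m (u : R -> 'cV[R]_m) : Prop :=
  (forall i, measurable_fun period_itv (component u i)) /\ (L2sq u < +oo)%E.

Definition smooth (f : R -> R) : Prop :=
  forall n x, derivable (derive1n n f) x 1.

(* Weak derivative on the torus: the test functions are periodic, so jumps
   between -pi and pi are seen by the derivative. *)
Definition weak_derivative m (u v : R -> 'cV[R]_m) : Prop :=
  forall phi : R -> R, smooth phi -> periodic phi (pi *+ 2) ->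
  forall i : 'I_m,
    \int[mu]_(x in period_itv) (component u i x * derive1 phi x) =
    - \int[mu]_(x in period_itv) (component v i x * phi x).

(* Squared norm of the periodic Sobolev space H^q.  Weak derivatives being
   unique almost everywhere, the infimum runs over at most one value; it is
   +oo exactly when u is not in H^q. *)
Definition Hnormsq q m (u : R -> 'cV[R]_m) : \bar R :=
  ereal_inf [set a | exists w : nat -> R -> 'cV[R]_m,
    [/\ w 0%N = u,
        forall j, (j <= q)%N -> square_integrable (w j),
        forall j, (j < q)%N -> weak_derivative (w j) (w j.+1) &
        a = (\sum_(j < q.+1) L2sq (w j))%E]].

Definition expi (y : R) : R[i] := Complex (cos y) (sin y).

(* Real-valued elements of P_N = span_C {e^{ikx} : -N <= k <= N}; the index
   j : 'I_(2N+1) stands for the frequency k = j - N. *)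
Definition trig_poly (N : nat) (f : R -> R) : Prop :=
  exists c : 'I_N.*2.+1 -> R[i], forall x,
    real_complex R (f x) = \sum_j c j * expi ((j%:R - N%:R) * x).

Definition in_PN (N : nat) m (u : R -> 'cV[R]_m) : Prop :=
  forall i, trig_poly N (component u i).

(* v is the componentwise L^2-orthogonal projection of u onto P_N.  As u and v
   are real, orthogonality to the real elements of P_N is orthogonality to
   the whole complex span. *)
Definition PN_projection (N : nat) m (u v : R -> 'cV[R]_m) : Prop :=
  in_PN N v /\
  forall (i : 'I_m) (phi : R -> R), trig_poly N phi ->
    \int[mu]_(x in period_itv) ((component u i x - component v i x) * phi x) = 0.

Definition vderiv (k : nat) m (u : R -> 'cV[R]_m) (x : R) : 'cV[R]_m :=
  \col_i derive1n k (component u i) x.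

End FunctionSpaces.

(* Space-time functions are curried time first: U t is the profile U(.,t). *)
Section ExactSolution.
Variables (R : realType) (p r : nat).

(* r1 counts the time derivatives, r2 the space derivatives. *)
Definition partial m (r1 r2 : nat) (U : R -> R -> 'cV[R]_m) (t x : R) :
    'cV[R]_m :=
  vderiv r1 (fun tau => vderiv r2 (U tau) x) t.

(* Classical solution of U_t + A U_x = eps^-1 Q U with U(.,0) = Uin: continuous
   for t >= 0, continuously differentiable for t > 0. *)
Record exact_solution (A : 'M[R]_(p + r)) (S : 'M[R]_r) (eps : R)
    (Uin : R -> 'cV[R]_(p + r)) (U : R -> R -> 'cV[R]_(p + r)) : Prop :=
  ExactSolution {
  sol_periodic : forall t, 0 <= t -> periodic (U t) (pi *+ 2);
  sol_init : U 0 = Uin;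
  sol_cont : {within [set z : R * R | 0 <= z.1],
    continuous (fun z : R * R => U z.1 z.2)};
  sol_derivable : forall t x i, 0 < t ->
    derivable (fun tau => component (U tau) i x) t 1 /\ derivable (component (U t) i) x 1;
  sol_C1 : forall t x, 0 < t ->
    {for (t, x), continuous (fun z : R * R => partial 1 0 U z.1 z.2)} /\
    {for (t, x), continuous (fun z : R * R => partial 0 1 U z.1 z.2)};
  sol_pde : forall t x, 0 < t ->
    partial 1 0 U t x + A *m partial 0 1 U t x =
    eps^-1 *: (relaxmx p S *m U t x) }.

(* delta0 is a constant for which the regularity estimates hold, uniformly in
   eps.  They are required for smooth initial data only, where all the
   derivatives exist in the classical sense; since the system is linear, the
   estimates for data in H^sigma follow by density.  The lower block of U is W.
   At t = 0 there is no two-sided time derivative, whence 0 < t. *)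
Definition regularity_constant (A : 'M[R]_(p + r)) (S : 'M[R]_r) (delta0 : R) :
    Prop :=
  0 < delta0 /\
  forall sigma : nat, exists2 C : R, 0 < C &
  forall (eps : R) (Uin : R -> 'cV[R]_(p + r)) (U : R -> R -> 'cV[R]_(p + r)),
    0 < eps ->
    (forall i, smooth (component Uin i)) -> periodic Uin (pi *+ 2) ->
    exact_solution A S eps Uin U ->
    (forall t, 0 <= t ->
       (Hnormsq sigma (U t) <= C%:E * Hnormsq sigma Uin)%E) /\
    (forall t, 0 < t ->
       2%:R * delta0^-1 * sigma%:R * eps * ln (1 / eps) <= t ->
       (forall r1 r2, (r1 + r2 <= sigma)%N ->
          (L2sq (partial r1 r2 U t) <= C%:E * Hnormsq sigma Uin)%E) /\
       (forall r1 r2, (r1 + r2 < sigma)%N ->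
          (L2sq (fun x => dsubmx (partial r1 r2 U t x))
             <= (C * eps ^+ 2)%:E * Hnormsq sigma Uin)%E)).

(* The initial data and the length T0 of the initial layer may depend on eps. *)
Definition consistent_data (q : nat) (delta0 : R)
    (Uin : R -> R -> 'cV[R]_(p + r)) (T0 : R -> R) : Prop :=
  (exists K : R, forall eps, 0 < eps -> (Hnormsq q (Uin eps) <= K%:E)%E) /\
  (forall eps, 0 < eps ->
     0 <= T0 eps /\
     2%:R * delta0^-1 * q%:R * eps * ln (1 / eps) <= T0 eps).

End ExactSolution.

(* Stages are indexed from 0: the i-th stage has index i - 1 in 'I_s. *)
Record imex_tableau (R : realType) (s : nat) := ImexTableau {
  Hex : 'M[R]_s;
  Him : 'M[R]_s;
  bex : 'I_s -> R;
  bim : 'I_s -> R;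
  Hex_trig : forall i j : 'I_s, (i <= j)%N -> Hex i j = 0;
  Him_trig : forall i j : 'I_s, (i < j)%N -> Him i j = 0;
  Him_diag : forall i, 0 <= Him i i }.

Section Tableau.
Variable R : realType.

Definition cex s (rk : imex_tableau R s) (i : 'I_s) : R :=
  \sum_(j < s | (j < i)%N) Hex rk i j.

Definition cim s (rk : imex_tableau R s) (i : 'I_s) : R :=
  \sum_(j < s | (j <= i)%N) Him rk i j.

Definition type_CK n (rk : imex_tableau R n.+1) : Prop :=
  exists (h : 'cV[R]_n) (Hhat : 'M[R]_n),
    Hhat \in unitmx /\ Him rk = block_mx (0 : 'M[R]_(1, 1)) 0 h Hhat.

Definition ISA n (rk : imex_tableau R n.+1) : Prop :=
  forall i, Him rk ord_max i = bim rk i.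

Definition osum1 s (b c : 'I_s -> R) : R := \sum_i b i * c i.
Definition osum2 s (b c d : 'I_s -> R) : R := \sum_i b i * c i * d i.
Definition osumH s (b : 'I_s -> R) (H : 'M[R]_s) (c : 'I_s -> R) : R :=
  \sum_i \sum_j b i * H i j * c j.

Record order1 s (rk : imex_tableau R s) : Prop := Order1 {
  order1_ex : \sum_i bex rk i = 1;
  order1_im : \sum_i bim rk i = 1 }.

Record order2 s (rk : imex_tableau R s) : Prop := Order2 {
  order2_ee : osum1 (bex rk) (cex rk) = 2%:R^-1;
  order2_ii : osum1 (bim rk) (cim rk) = 2%:R^-1;
  order2_ei : osum1 (bex rk) (cim rk) = 2%:R^-1;
  order2_ie : osum1 (bim rk) (cex rk) = 2%:R^-1 }.

Record order3 s (rk : imex_tableau R s) : Prop := Order3 {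
  order3H_eee : osumH (bex rk) (Hex rk) (cex rk) = 6%:R^-1;
  order3H_iii : osumH (bim rk) (Him rk) (cim rk) = 6%:R^-1;
  order3H_eei : osumH (bex rk) (Hex rk) (cim rk) = 6%:R^-1;
  order3H_eie : osumH (bex rk) (Him rk) (cex rk) = 6%:R^-1;
  order3H_eii : osumH (bex rk) (Him rk) (cim rk) = 6%:R^-1;
  order3H_iei : osumH (bim rk) (Hex rk) (cim rk) = 6%:R^-1;
  order3H_iie : osumH (bim rk) (Him rk) (cex rk) = 6%:R^-1;
  order3H_iee : osumH (bim rk) (Hex rk) (cex rk) = 6%:R^-1;
  order3_eee : osum2 (bex rk) (cex rk) (cex rk) = 3%:R^-1;
  order3_iii : osum2 (bim rk) (cim rk) (cim rk) = 3%:R^-1;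
  order3_eii : osum2 (bex rk) (cim rk) (cim rk) = 3%:R^-1;
  order3_eei : osum2 (bex rk) (cex rk) (cim rk) = 3%:R^-1;
  order3_iee : osum2 (bim rk) (cex rk) (cex rk) = 3%:R^-1;
  order3_iei : osum2 (bim rk) (cex rk) (cim rk) = 3%:R^-1 }.

Definition stage_order s (rk : imex_tableau R s) : Prop :=
  forall i : 'I_s, (2 <= i)%N ->
    cim rk i ^+ 2 / 2%:R = \sum_(j < s | (j < i)%N) Hex rk i j * cim rk j /\
    cim rk i ^+ 2 / 2%:R = \sum_(j < s | (j <= i)%N) Him rk i j * cim rk j.

Definition vanishing_coefficients s (rk : imex_tableau R s) : Prop :=
  (forall j : 'I_s, nat_of_ord j = 1%N -> bex rk j = 0) /\
  (forall i j : 'I_s, (2 <= i)%N -> nat_of_ord j = 1%N -> Him rk i j = 0).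

Definition null_generator n (H : 'M[R]_n) (v : 'cV[R]_n) : Prop :=
  [/\ v != 0, H *m v = 0 & forall w : 'cV[R]_n, H *m w = 0 ->
    exists a : R, w = a *: v].

Definition Bmx n : 'M[R]_n.+1 :=
  \matrix_(i, j) (if i == ord0 then 0 else (j == i)%:R - (j == ord0)%:R).

(* diag (1, 0, ..., 0, -1) *)
Definition Dmx n : 'M[R]_n.+1 :=
  \matrix_(i, j) ((i == j)%:R * ((i == ord0)%:R - (i == ord_max)%:R)).

Definition Mstar n (M : 'M[R]_n.+1) : 'M[R]_n.+1 := M *m Bmx n + Dmx n.

Definition cond_M1 n (rk : imex_tableau R n.+1) (M : 'M[R]_n.+1) : Prop :=
  psdmx (M *m Him rk + (M *m Him rk)^T) /\
  \rank (M *m Him rk + (M *m Him rk)^T)%R = n.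

Definition cond_M2 n (M : 'M[R]_n.+1) : Prop :=
  psdmx (Mstar M + (Mstar M)^T) /\ \rank (Mstar M + (Mstar M)^T)%R = n.

End Tableau.

(* Un n is (U^n)_N and Us n i is the stage (U^(i))_N of the step from n to n+1. *)
Record imex_scheme (R : realType) m (A Q : 'M[R]_m) s (rk : imex_tableau R s)
    (eps dt : R) (N : nat) (Un : nat -> R -> 'cV[R]_m)
    (Us : nat -> 'I_s -> R -> 'cV[R]_m) : Prop := ImexScheme {
  scheme_Un_PN : forall n, in_PN N (Un n);
  scheme_Us_PN : forall n i, in_PN N (Us n i);
  scheme_stage : forall n i x,
    Us n i x = Un n x
      - dt *: \sum_(j < s | (j < i)%N) Hex rk i j *: (A *m vderiv 1 (Us n j) x)
      + (dt / eps) *: \sum_(j < s | (j <= i)%N) Him rk i j *: (Q *m Us n j x);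
  scheme_update : forall n x,
    Un n.+1 x = Un n x
      - dt *: \sum_(j < s) bex rk j *: (A *m vderiv 1 (Us n j) x)
      + (dt / eps) *: \sum_(j < s) bim rk j *: (Q *m Us n j x) }.

(* Main.v *)
From HB Require Import structures.
Require Import Defs.
From mathcomp Require Import all_boot all_order all_algebra.
From mathcomp Require Import all_classical all_reals all_analysis.
From mathcomp Require Import complex measurable_realfun.
From mathcomp Require Import ring lra.

Set Implicit Arguments.
Unset Strict Implicit.
Unset Printing Implicit Defensive.

Import Order.TTheory GRing.Theory Num.Theory.
Import numFieldNormedType.Exports.

Local Open Scope classical_set_scope.
Local Open Scope ring_scope.

(** Everything decouples into Fourier modes.  The error is estimated for one
    frequency k at a time, with the growth of the constants in k under control,
    and the modes are then summed.

    _Modes._  The coefficients of cos (k x) and sin (k x) of a field with m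
    components form an m x 2 matrix y.  For the exact solution it satisfies
    y' = k K y + eps^-1 Q y, where K y = - A y J and J is a quarter turn
    ([mode_ode]), and the scheme becomes the same IMEX method applied to this
    ordinary differential equation ([mode_stage], [mode_update]).  In the inner
    product f given by A_0 the operator K is skew, by the symmetry of A_0 A, and
    - f x (Q y) is a symmetric form which is coercive on the relaxed components.
    The scheme is therefore analysed on an abstract inner product space with
    such operators K and Q.

    _Stability._  Testing the stages y_i with M gives an energy identity between
    the first and the last stage ([energy_identity]).  By (M2) its quadratic form
    vanishes only on constant stages, hence controls the increments y_i - y_0; by
    (M1) the relaxation enters it with a good sign, whatever the size of dt / eps.
    The skew transport only contributes products with increments, of size dt k,
    which are absorbed when (dt k)^2 <= C dt: this is where dt <= C / N^2 is used.
    One step thus multiplies the energy by at most 1 + C dt, and a perturbation of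
    size rho of the stages costs C rho^2 / dt ([stability_step]).

    _Consistency, uniformly in eps._  The Taylor polynomials of the solution at the
    times t_n + c_i dt nearly satisfy the stage equations.  The stage order
    conditions remove the defects of order dt^2 except in the second stage; there
    the defect is removed by solving that stage exactly, which does no harm to the
    other stages since the vanishing coefficients hide the second stage from them,
    up to an explicit term of order dt^3.  The remaining defects, of order dt^3,
    are still one power of dt too large for the stability estimate.  They are
    compensated by a corrector eta of the same size, added to all stages
    ([corrector]): it solves the stage equations without transport, and is bounded
    by the defects uniformly in dt / eps.  That bound rests on (M1), (M2) and the
    last component of v being zero, which together say that the kernels of the two
    quadratic forms, spanned by v and by the constant vector, meet only in 0
    ([joint_coercive]).  As eta is linear in the derivatives of the solution at
    t_n, its change during one step is of order dt^4; the third order conditions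
    make the update exact up to dt^4 as well.  The discrete Gronwall inequality
    then bounds the error of the mode by dt^3 k^4 times the size F for which the
    j-th time derivative is at most F k^j ([mode_error]).

    _Regularity._  A single harmonic of the exact solution is an exact solution
    with smooth data.  The regularity estimates of orders 0 to 4 applied to it
    bound the j-th time derivative of its coefficients by (1 + k)^j times their
    initial size ([mode_regular]), and the H^8 bound on the data makes this initial
    size at most C (1 + k)^-8 ([Hnormsq_decay]).  Hence the error of mode k is at
    most C dt^3 (1 + k)^-4, which is summable over k, and the part of the solution
    beyond frequency N is at most C N^-6, uniformly in x ([solution_tail]).  The
    latter uses that Fourier series converge at points of differentiability
    ([fourier_pointwise]).  Adding both bounds, squaring, and integrating over the
    period gives the theorem. *)

(** * Positive semidefinite forms *)
Section Forms.
Variables (R : rcfType) (V : lmodType R).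

Record psd_form (f : V -> V -> R) : Prop := PsdForm {
  formC : forall x y, f x y = f y x;
  form_lin : forall a x y z, f (a *: x + y) z = a * f x z + f y z;
  form_ge0 : forall x, 0 <= f x x }.

Variables (f : V -> V -> R) (psdf : psd_form f).

Lemma formDl x y z : f (x + y) z = f x z + f y z.
Proof. by rewrite -{1}[x]scale1r (form_lin psdf) mul1r. Qed.
Lemma form0l x : f 0 x = 0.
Proof. by apply: (addrI (f 0 x)); rewrite -formDl !addr0. Qed.
Lemma formZl a x z : f (a *: x) z = a * f x z.
Proof. by rewrite -[a *: x]addr0 (form_lin psdf) form0l addr0. Qed.
Lemma formNl x z : f (- x) z = - f x z.
Proof. by rewrite -scaleN1r formZl mulN1r. Qed.
Lemma formDr x y z : f x (y + z) = f x y + f x z.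
Proof. by rewrite !(formC psdf x) formDl. Qed.
Lemma formZr a x z : f x (a *: z) = a * f x z.
Proof. by rewrite !(formC psdf x) formZl. Qed.
Lemma formNr x z : f x (- z) = - f x z.
Proof. by rewrite !(formC psdf x) formNl. Qed.
Lemma form_suml I (s : seq I) P (y : I -> V) z :
  f (\sum_(i <- s | P i) y i) z = \sum_(i <- s | P i) f (y i) z.
Proof. by apply: (big_morph (f^~ z)) => [u w|]; rewrite ?formDl ?form0l. Qed.
Lemma form_sumr I (s : seq I) P (y : I -> V) z :
  f z (\sum_(i <- s | P i) y i) = \sum_(i <- s | P i) f z (y i).
Proof. by rewrite (formC psdf) form_suml; apply: eq_bigr => i _; apply: formC. Qed.

(** The form need not be definite: when both arguments are degenerate the
    quadratic polynomial a, b |-> f (a x + b y) (a x + b y) is linear in each of a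
    and b, and its positivity still forces f x y = 0. *)
Lemma form_cauchy x y : f x y ^+ 2 <= f x x * f y y.
Proof.
have key a b : 0 <= a ^+ 2 * f x x + a * b * f x y *+ 2 + b ^+ 2 * f y y.
  have := form_ge0 psdf (a *: x + b *: y).
  rewrite formDl !formDr !formZl !formZr (formC psdf y x).
  by congr (0 <= _); ring.
have := form_ge0 psdf x; have := form_ge0 psdf y.
set p := f x x in key *; set q := f y y in key *; set c := f x y in key *.
move=> q0 p0.
have [q_eq0|q_neq0] := eqVneq q 0.
  have [p_eq0|p_neq0] := eqVneq p 0.
    have := key 1 (- c); rewrite q_eq0 p_eq0 !mulr0 !mul1r => h; nra.
  have := key (- c) p; rewrite q_eq0 => h.
  have pp : 0 < p by rewrite lt_def p_neq0.
  nra.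
have qp : 0 < q by rewrite lt_def q_neq0.
have := key q (- c) => h.
have : 0 <= q * (p * q - c ^+ 2) by move: h; congr (0 <= _); ring.
by rewrite pmulr_rge0 // subr_ge0.
Qed.

Definition nrm x := Num.sqrt (f x x).

Lemma nrm_ge0 x : 0 <= nrm x. Proof. exact: sqrtr_ge0. Qed.
Lemma nrm_sqr x : nrm x ^+ 2 = f x x.
Proof. by rewrite sqr_sqrtr ?(form_ge0 psdf). Qed.
Lemma nrm0 : nrm 0 = 0. Proof. by rewrite /nrm form0l sqrtr0. Qed.
Lemma nrmZ a x : nrm (a *: x) = `|a| * nrm x.
Proof.
by rewrite /nrm formZl formZr mulrA -expr2 sqrtrM ?sqr_ge0 // sqrtr_sqr.
Qed.
Lemma nrmN x : nrm (- x) = nrm x.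
Proof. by rewrite -scaleN1r nrmZ normrN1 mul1r. Qed.
Lemma form_le_nrm x y : `|f x y| <= nrm x * nrm y.
Proof.
rewrite -sqrtrM ?(form_ge0 psdf) // -sqrtr_sqr ler_wsqrtr //.
exact: form_cauchy.
Qed.
Lemma nrmD x y : nrm (x + y) <= nrm x + nrm y.
Proof.
rewrite -(@ler_pXn2r _ 2) ?nnegrE ?addr_ge0 ?nrm_ge0 //.
rewrite nrm_sqr formDl !formDr sqrrD !nrm_sqr (formC psdf y x).
have := le_trans (ler_norm _) (form_le_nrm x y); lra.
Qed.
Lemma nrmB x y : nrm (x - y) <= nrm x + nrm y.
Proof. by rewrite -[X in _ <= _ + X]nrmN nrmD. Qed.
Lemma nrm_sum I (s : seq I) P (y : I -> V) :
  nrm (\sum_(i <- s | P i) y i) <= \sum_(i <- s | P i) nrm (y i).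
Proof.
apply: (big_ind2 (fun x c => nrm x <= c)) => //; first by rewrite nrm0.
by move=> x c y' d h1 h2; apply: le_trans (nrmD _ _) (lerD h1 h2).
Qed.
Lemma nrm_comb (I : finType) (a : I -> R) (y : I -> V) :
  nrm (\sum_i a i *: y i) <= (\sum_i `|a i|) * \sum_i nrm (y i).
Proof.
apply: le_trans (nrm_sum _ _ _) _; rewrite mulr_suml; apply: ler_sum => i _.
rewrite nrmZ ler_wpM2l //.
by rewrite (bigD1 i) //= lerDl sumr_ge0 // => j _; apply: nrm_ge0.
Qed.
End Forms.

Section Psd.
Variable R : rcfType.

(** A Cholesky factor, by induction on the size.  It is needed for singular
    matrices too: if the pivot is zero then so are its row and its column. *)
Lemma psd_factor n (G : 'M[R]_n) : G^T = G ->
  (forall v : 'cV[R]_n, 0 <= (v^T *m G *m v) 0 0) ->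
  exists L : 'M[R]_n, G = L^T *m L.
Proof.
elim: n G => [|n IH] G symG psdG; first by exists 0; apply/matrixP => -[].
rewrite -[n.+1]/(1 + n)%N in G symG psdG *.
pose a := G 0 0; pose b := ursubmx G : 'rV_n; pose D := drsubmx G.
have Eul : ulsubmx G = a%:M.
  by rewrite [LHS]mx11_scalar !mxE; congr (G _ _)%:M; apply/val_inj.
have Edl : dlsubmx G = b^T by rewrite /b trmx_ursub symG.
have EG : G = block_mx a%:M b b^T D by rewrite -Eul -Edl submxK.
have symD : D^T = D by rewrite /D trmx_drsub symG.
have quad (x : R) (w : 'cV[R]_n) :
    0 <= a * x ^+ 2 + x * (b *m w) 0 0 *+ 2 + (w^T *m D *m w) 0 0.
  have := psdG (col_mx (x%:M) w); rewrite EG tr_col_mx.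
  rewrite mul_row_block mul_row_col !mulmxDl !tr_scalar_mx.
  have -> : w^T *m b^T *m x%:M = x *: (b *m w) :> 'M[R]_1.
    rewrite mul_mx_scalar -trmx_mul [(b *m w)]mx11_scalar tr_scalar_mx.
    by [].
  rewrite mul_scalar_mx mul_mx_scalar mul_scalar_mx -scalemxAl.
  set B := b *m w; set W := w^T *m D *m w.
  rewrite !mxE mulr1n; congr (0 <= _); ring.
have a_ge0 : 0 <= a.
  have := quad 1 0; rewrite mulmx0 trmx0 !mul0mx !mxE.
  by rewrite mulr0 mul0rn !addr0 expr1n mulr1.
have [a0|a_neq0] := eqVneq a 0.
  have b0 : b = 0.
    apply/rowP => j; rewrite [RHS]mxE.
    set w : 'cV[R]_n := delta_mx j 0.
    have Ew : (b *m w) 0 0 = b 0 j by rewrite -colE mxE.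
    set q := (w^T *m D *m w) 0 0.
    have h1 x : 0 <= x * b 0 j *+ 2 + q.
      by have := quad x w; rewrite Ew a0 mul0r add0r.
    have := h1 0; rewrite mul0r mul0rn add0r => q0.
    apply/eqP; case: (eqVneq (b 0 j) 0) => // nz.
    have := h1 (- (q + 1) / b 0 j); rewrite divfK //; lra.
  have [w|L EL] := IH D symD.
    by have := quad 0 w; rewrite expr0n mulr0 mul0r mul0rn !add0r.
  exists (block_mx 0 0 0 L).
  rewrite tr_block_mx mulmx_block !trmx0 !mulmx0 !mul0mx !addr0 add0r -EL.
  by rewrite EG a0 b0 trmx0 -scalemx1 scale0r.
have a_gt0 : 0 < a by rewrite lt_def a_neq0.
pose c := Num.sqrt a.
have c2 : c * c = a by rewrite -expr2 sqr_sqrtr.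
have c0 : c != 0 by rewrite sqrtr_eq0 -ltNge.
have [|w|L EL] := IH (D - a^-1 *: (b^T *m b)).
- by rewrite linearB linearZ /= trmx_mul trmxK symD.
- have := quad (- (b *m w) 0 0 / a) w.
  rewrite mulmxBr mulmxBl -scalemxAr -scalemxAl.
  have -> : w^T *m (b^T *m b) *m w = (b *m w) 0 0 ^+ 2 *: 1%:M :> 'M[R]_1.
    rewrite !mulmxA -trmx_mul -mulmxA {1 2}[b *m w]mx11_scalar tr_scalar_mx.
    by rewrite mul_scalar_mx scale_scalar_mx scalemx1 expr2.
  set B := (b *m w) 0 0; set W := w^T *m D *m w.
  rewrite !mxE eqxx mulr1n; set q := \sum_j _.
  by congr (0 <= _); rewrite mulr2n; field.
exists (block_mx c%:M (c^-1 *: b) 0 L).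
rewrite tr_block_mx mulmx_block !trmx0 !mul0mx !tr_scalar_mx -EL !addr0 EG.
rewrite -scalar_mxM c2 mul_scalar_mx mul_mx_scalar scalerA mulfV // scale1r.
rewrite linearZ /= scalerA mulfV // scale1r -scalemxAl -scalemxAr scalerA.
by rewrite -invfM c2 [a^-1 *: _ + _]addrC subrK mulmx0 addr0.
Qed.

Lemma left_inverse m n (L : 'M[R]_(m, n)) :
  (forall w : 'cV[R]_n, L *m w = 0 -> w = 0) -> exists X : 'M[R]_(n, m), X *m L = 1%:M.
Proof.
move=> inj; exists (pinvmx L); apply: mulVpmx.
rewrite /row_full -mxrank_tr; apply/inj_row_free => w /(congr1 trmx).
rewrite trmx_mul trmxK trmx0 => /inj /(congr1 trmx).
by rewrite trmxK trmx0.
Qed.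
End Psd.

(** * Stages weighted by matrices *)
(** The stages of a method form a vector y of elements of V, on which the tableau
    acts as the Kronecker product of L and the identity of V. *)
Definition mxcomb (R : rcfType) (V : lmodType R) m n (L : 'M[R]_(m, n))
  (y : 'I_n -> V) (i : 'I_m) : V := \sum_j L i j *: y j.

(** The Kronecker product of G and f, as a form on vectors of stages. *)
Definition mxform (R : rcfType) (V : lmodType R) (f : V -> V -> R) n (G : 'M[R]_n)
  (y w : 'I_n -> V) : R := \sum_i \sum_j G i j * f (y i) (w j).

Section StageForms.
Variables (R : rcfType) (V : lmodType R).
Implicit Types (f : V -> V -> R).

Lemma mxcomb_mul m n p (X : 'M[R]_(m, n)) (L : 'M[R]_(n, p)) (y : 'I_p -> V) i :
  mxcomb X (mxcomb L y) i = mxcomb (X *m L) y i.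
Proof.
rewrite /mxcomb; under eq_bigr => j _ do rewrite scaler_sumr.
rewrite exchange_big; apply: eq_bigr => k _; rewrite mxE scaler_suml.
by apply: eq_bigr => j _; rewrite scalerA.
Qed.

Lemma mxcomb1 n (y : 'I_n -> V) i : mxcomb 1%:M y i = y i.
Proof.
rewrite /mxcomb (bigD1 i) //= mxE eqxx scale1r big1 ?addr0 // => j ji.
by rewrite mxE eq_sym (negbTE ji) scale0r.
Qed.

Lemma mxcombB m n (L : 'M[R]_(m, n)) (y w : 'I_n -> V) i :
  mxcomb L (fun j => y j - w j) i = mxcomb L y i - mxcomb L w i.
Proof.
by rewrite /mxcomb -sumrB; apply: eq_bigr => j _; rewrite scalerBr.
Qed.

Lemma mxform_gram f n m (L : 'M[R]_(m, n)) (y : 'I_n -> V) : psd_form f ->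
  mxform f (L^T *m L) y y = \sum_l f (mxcomb L y l) (mxcomb L y l).
Proof.
move=> psdf; rewrite /mxform /mxcomb.
under [RHS]eq_bigr => l _.
  rewrite form_suml //.
  under eq_bigr => i _ do rewrite form_sumr //.
  over.
rewrite [RHS]exchange_big; apply: eq_bigr => i _ /=.
rewrite [RHS]exchange_big; apply: eq_bigr => j _ /=.
rewrite mxE mulr_suml; apply: eq_bigr => l _ /=.
by rewrite (formZl psdf) (formZr psdf) !mxE mulrA.
Qed.

Lemma mxform_comb f n (M H : 'M[R]_n) (y w : 'I_n -> V) : psd_form f ->
  mxform f M y (mxcomb H w) = mxform f (M *m H) y w.
Proof.
move=> psdf; apply: eq_bigr => i _; rewrite /mxcomb.
under eq_bigr => j _ do rewrite (form_sumr psdf) mulr_sumr.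
rewrite exchange_big; apply: eq_bigr => k _; rewrite mxE mulr_suml.
by apply: eq_bigr => j _; rewrite (formZr psdf) mulrA.
Qed.

Lemma mxform_sym f n (G : 'M[R]_n) (y : 'I_n -> V) : psd_form f ->
  mxform f G y y = mxform f (G + G^T) y y / 2.
Proof.
move=> psdf.
have -> : mxform f (G + G^T) y y = mxform f G y y + mxform f G^T y y.
  rewrite -big_split; apply: eq_bigr => i _; rewrite -big_split /=.
  by apply: eq_bigr => j _; rewrite mxE mulrDl.
have -> : mxform f G^T y y = mxform f G y y.
  rewrite /mxform exchange_big; apply: eq_bigr => i _; apply: eq_bigr => j _.
  by rewrite mxE (formC psdf).
by field.
Qed.

Lemma mxformDr f n (G : 'M[R]_n) (y w w' : 'I_n -> V) : psd_form f ->
  mxform f G y (fun i => w i + w' i) = mxform f G y w + mxform f G y w'.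
Proof.
move=> psdf; rewrite -big_split; apply: eq_bigr => i _; rewrite -big_split /=.
by apply: eq_bigr => j _; rewrite (formDr psdf) mulrDr.
Qed.

Lemma mxformZr f n (G : 'M[R]_n) (y w : 'I_n -> V) a : psd_form f ->
  mxform f G y (fun i => a *: w i) = a * mxform f G y w.
Proof.
move=> psdf; rewrite mulr_sumr; apply: eq_bigr => i _; rewrite mulr_sumr.
by apply: eq_bigr => j _; rewrite (formZr psdf) mulrCA.
Qed.

Definition mxsize m n (G : 'M[R]_(m, n)) : R := \sum_i \sum_j `|G i j|.

Lemma mxsize_ge0 m n (G : 'M[R]_(m, n)) : 0 <= mxsize G.
Proof. by apply: sumr_ge0 => i _; apply: sumr_ge0 => j _. Qed.

Lemma mxform_bound (h : V -> V -> R) n (G : 'M[R]_n) (y w : 'I_n -> V) b :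
  (forall i j, `|h (y i) (w j)| <= b) -> `|mxform h G y w| <= mxsize G * b.
Proof.
move=> hb; rewrite mulr_suml; apply: le_trans (ler_norm_sum _ _ _) _.
apply: ler_sum => i _; rewrite mulr_suml.
apply: le_trans (ler_norm_sum _ _ _) _; apply: ler_sum => j _.
by rewrite normrM ler_wpM2l.
Qed.

Lemma nrm_mxcomb f m n (L : 'M[R]_(m, n)) (y : 'I_n -> V) i : psd_form f ->
  nrm f (mxcomb L y i) <= mxsize L * \sum_j nrm f (y j).
Proof.
move=> psdf; apply: le_trans (nrm_comb psdf _ _) _.
rewrite ler_wpM2r ?sumr_ge0 // => [j _|]; first exact: nrm_ge0.
rewrite /mxsize (bigD1 i) //= lerDl sumr_ge0 // => k _.
by rewrite sumr_ge0.
Qed.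

End StageForms.

(** * Coercivity of the two quadratic forms *)
Section Coercivity.
Variable R : realType.

Lemma gram_ker m n (L : 'M[R]_(m, n)) (w : 'cV[R]_n) :
  (w^T *m (L^T *m L) *m w) 0 0 = 0 -> L *m w = 0.
Proof.
rewrite !mulmxA -mulmxA -trmx_mul !mxE => h.
apply/colP => i; rewrite [RHS]mxE; apply/eqP.
have pos j : true -> 0 <= (L *m w)^T 0 j * (L *m w) j 0.
  by rewrite mxE -expr2 sqr_ge0.
by have := psumr_eq0P pos h (i := i) isT; rewrite mxE -expr2 => /eqP;
  rewrite sqrf_eq0.
Qed.

Lemma psdmx_quad n (G : 'M[R]_n) (w : 'cV[R]_n) :
  psdmx G -> (w^T *m G *m w) 0 0 = 0 -> G *m w = 0.
Proof.
move=> [symG posG]; have [L EL] := psd_factor symG posG.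
by rewrite EL => /gram_ker Lw; rewrite -mulmxA Lw mulmx0.
Qed.

Lemma psdmxD n (G F : 'M[R]_n) : psdmx G -> psdmx F -> psdmx (G + F).
Proof.
move=> [sG pG] [sF pF]; split; first by rewrite linearD /= sG sF.
by move=> w; rewrite mulmxDr mulmxDl mxE addr_ge0.
Qed.

Lemma psdmxD_ker n (G F : 'M[R]_n) (w : 'cV[R]_n) : psdmx G -> psdmx F ->
  (G + F) *m w = 0 -> G *m w = 0 /\ F *m w = 0.
Proof.
move=> pG pF /(congr1 (mulmx w^T)); rewrite mulmx0 mulmxA mulmxDr mulmxDl.
move=> /(congr1 (fun X : 'M[R]_1 => X 0 0)); rewrite !mxE => h.
have := proj2 pG w; have := proj2 pF w; rewrite !mxE => h1 h2.
by split; apply: psdmx_quad => //; rewrite mxE; lra.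
Qed.

Lemma rank_ker n (G : 'M[R]_n.+1) (u w : 'cV[R]_n.+1) :
  G^T = G -> \rank G = n -> u != 0 -> G *m u = 0 -> G *m w = 0 ->
  exists a, w = a *: u.
Proof.
move=> sG rG u0 Gu Gw.
have ker (x : 'cV[R]_n.+1) : G *m x = 0 -> (x^T <= kermx G)%MS.
  by move=> Gx; apply/sub_kermxP; rewrite -{1}sG -trmx_mul Gx trmx0.
have := (mxrank_leqif_sup (ker _ Gu)).2.
rewrite mxrank_ker rG subSnn mxrank_tr.
have -> : \rank u = 1%N.
  apply/eqP; rewrite eqn_leq rank_leq_col /= lt0n mxrank_eq0 //.
rewrite eqxx => /esym/(submx_trans (ker _ Gw))/sub_rVP[a Ea].
by exists a; apply: trmx_inj; rewrite Ea linearZ.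
Qed.

(** A Cholesky factor of G has a left inverse, which expresses each stage by the
    combinations whose squared norms add up to the form. *)
Lemma mxform_coercive (V : lmodType R) (f : V -> V -> R) n (G : 'M[R]_n) :
  psd_form f -> psdmx G -> (forall w : 'cV[R]_n, G *m w = 0 -> w = 0) ->
  exists2 c, 0 < c & forall y,
    c * (\sum_i nrm f (y i)) ^+ 2 <= mxform f G y y.
Proof.
move=> psdf [sG pG] inj; have [L EL] := psd_factor sG pG.
have [w Lw|X XL] := @left_inverse _ _ _ L.
  by apply: inj; rewrite EL -mulmxA Lw mulmx0.
pose K := n%:R * (mxsize X * n%:R).
have C0 : 0 < K ^+ 2 + 1 by rewrite ltr_wpDl ?sqr_ge0.
exists (K ^+ 2 + 1)^-1 => [|y]; first by rewrite invr_gt0.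
rewrite mulrC ler_pdivrMr // EL mxform_gram //.
set q := \sum_l f _ _.
have q0 : 0 <= q by apply: sumr_ge0 => l _; apply: (form_ge0 psdf).
have hl l : nrm f (mxcomb L y l) <= Num.sqrt q.
  rewrite ler_wsqrtr // /q (bigD1 l) //= lerDl sumr_ge0 // => k _.
  exact: (form_ge0 psdf).
have hy : \sum_i nrm f (y i) <= K * Num.sqrt q.
  have hi i : nrm f (y i) <= mxsize X * n%:R * Num.sqrt q.
    rewrite -[y i]mxcomb1 -XL -mxcomb_mul.
    apply: le_trans (nrm_mxcomb _ _ _ psdf) _.
    rewrite -mulrA ler_wpM2l ?mxsize_ge0 //.
    apply: le_trans (ler_sum _ (fun l _ => hl l)) _.
    by rewrite sumr_const card_ord mulr_natl.
  apply: le_trans (ler_sum _ (fun i _ => hi i)) _.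
  by rewrite sumr_const card_ord -[leLHS]mulr_natl /K !mulrA.
have s0 : 0 <= \sum_i nrm f (y i) by apply: sumr_ge0 => i _; apply: nrm_ge0.
have := ler_pM s0 s0 hy hy; rewrite -!expr2 exprMn sqr_sqrtr // => h.
by apply: le_trans h _; rewrite mulrDr mulr1 mulrC lerDl.
Qed.

End Coercivity.

Section Energy.
Variables (R : realType) (V : lmodType R) (f : V -> V -> R) (psdf : psd_form f).
Variable n : nat.
Implicit Types (M H : 'M[R]_n.+1) (y : 'I_n.+1 -> V).

Lemma mxcomb_Bmx y i : mxcomb (Bmx R n) y i = y i - y ord0.
Proof.
rewrite /mxcomb; have [->|i0] := eqVneq i ord0.
  by rewrite subrr big1 // => j _; rewrite mxE eqxx scale0r.
rewrite (bigD1 i) //= (bigD1 ord0) 1?eq_sym //= big1 => [|j /andP[ji j0]].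
  rewrite !mxE (negbTE i0) !eqxx (eq_sym ord0 i) (negbTE i0) subr0 sub0r.
  by rewrite addr0 scale1r scaleN1r.
by rewrite mxE (negbTE i0) (negbTE ji) (negbTE j0) subrr scale0r.
Qed.

Lemma mxform_Dmx y :
  mxform f (Dmx R n) y y = f (y ord0) (y ord0) - f (y ord_max) (y ord_max).
Proof.
rewrite /mxform.
have E i : \sum_j Dmx R n i j * f (y i) (y j) =
    (i == ord0)%:R * f (y i) (y i) - (i == ord_max)%:R * f (y i) (y i).
  rewrite (bigD1 i) //= big1 => [|j ji].
    by rewrite mxE eqxx mul1r addr0 mulrBl.
  by rewrite mxE eq_sym (negbTE ji) !mul0r.
under eq_bigr => i _ do rewrite E.
rewrite sumrB; congr (_ - _).
  rewrite (bigD1 ord0) //= big1 => [|j j0]; first by rewrite ?eqxx mul1r addr0.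
  by rewrite (negbTE j0) mul0r.
rewrite (bigD1 ord_max) //= big1 => [|j j0]; first by rewrite ?eqxx mul1r addr0.
by rewrite (negbTE j0) mul0r.
Qed.

Lemma mxformDl (G F : 'M[R]_n.+1) y (w : 'I_n.+1 -> V) :
  mxform f (G + F) y w = mxform f G y w + mxform f F y w.
Proof.
rewrite -big_split; apply: eq_bigr => i _; rewrite -big_split /=.
by apply: eq_bigr => j _; rewrite mxE mulrDl.
Qed.

(** As the rows of B compute the increments, M B pairs the stages with their
    increments, while diag (1, 0, ..., 0, -1) contributes the energies of the first
    and of the last stage. *)
Lemma energy_identity M y :
  f (y ord_max) (y ord_max) + mxform f (Mstar M + (Mstar M)^T) y y / 2 =
  f (y ord0) (y ord0) + mxform f M y (fun i => y i - y ord0).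
Proof.
rewrite -mxform_sym // mxformDl mxform_Dmx -mxform_comb //.
have -> : mxform f M y (mxcomb (Bmx R n) y) = mxform f M y (fun i => y i - y ord0).
  by apply: eq_bigr => i _; apply: eq_bigr => j _; rewrite mxcomb_Bmx.
ring.
Qed.

(** Constant stages have zero increments and equal first and last energies, so
    both parts of the quadratic form vanish on them; a zero of a positive
    semidefinite form lies in its kernel. *)
Lemma Mstar_ker_const M : cond_M2 M ->
  (Mstar M + (Mstar M)^T) *m (const_mx 1 : 'cV_n.+1) = 0.
Proof.
move=> [pG _]; apply: psdmx_quad => //; set o := const_mx 1 : 'cV_n.+1.
have Bo : Bmx R n *m o = 0.
  apply/colP => i; rewrite !mxE.
  have [->|i0] := eqVneq i ord0.
    by rewrite big1 // => j _; rewrite !mxE eqxx mul0r.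
  under eq_bigr => j _ do rewrite !mxE (negbTE i0) mulr1.
  rewrite sumrB (bigD1 i) //= eqxx big1 => [|j ji]; last by rewrite (negbTE ji).
  rewrite (bigD1 ord0) //= big1 => [|j ji]; last by rewrite (negbTE ji).
  by rewrite !addr0 subrr.
have Q0 : o^T *m Mstar M *m o = 0.
  rewrite /Mstar mulmxDr mulmxDl mulmxA -mulmxA Bo mulmx0 add0r.
  have Do : Dmx R n *m o = \col_i ((i == ord0)%:R - (i == ord_max)%:R).
    apply/colP => i; rewrite !mxE (bigD1 i) //= big1 => [|k ki].
      by rewrite !mxE eqxx mul1r mulr1 addr0.
    by rewrite !mxE eq_sym (negbTE ki) !mul0r.
  rewrite -mulmxA Do; apply/matrixP => i j; rewrite !ord1 !mxE.
  under eq_bigr => k _ do rewrite !mxE mul1r.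
  rewrite sumrB (bigD1 ord0) //= big1 => [|k k0]; last by rewrite (negbTE k0).
  rewrite (bigD1 ord_max) //= big1 => [|k k0]; last by rewrite (negbTE k0).
  by rewrite ?eqxx !addr0 subrr.
have -> : o^T *m (Mstar M + (Mstar M)^T) *m o = o^T *m Mstar M *m o +
   (o^T *m Mstar M *m o)^T.
  by rewrite mulmxDr mulmxDl !trmx_mul trmxK mulmxA.
by rewrite Q0 trmx0 addr0 mxE.
Qed.

Lemma const_neq0 : (const_mx 1 : 'cV[R]_n.+1) != 0.
Proof. by apply/eqP => /colP/(_ ord0)/eqP; rewrite !mxE oner_eq0. Qed.

Lemma mxform_shift M y : cond_M2 M ->
  mxform f (Mstar M + (Mstar M)^T) y y =
  mxform f (Mstar M + (Mstar M)^T) (fun i => y i - y ord0) (fun i => y i - y ord0).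
Proof.
move=> cM; have [[sG pG] _] := cM; have [L EL] := psd_factor sG pG.
have L1 : L *m (const_mx 1 : 'cV_n.+1) = 0.
  by apply: gram_ker; rewrite -EL -mulmxA Mstar_ker_const // mulmx0 mxE.
rewrite EL !mxform_gram //; apply: eq_bigr => l _.
rewrite mxcombB (_ : mxcomb L (fun=> y ord0) l = 0) ?subr0 //.
rewrite /mxcomb -scaler_suml (_ : \sum_i L l i = 0) ?scale0r //.
have /colP/(_ l) := L1; rewrite [LHS]mxE [RHS]mxE => L1l.
by rewrite -[RHS]L1l; apply: eq_bigr => j _; rewrite mxE mulr1.
Qed.

(** The kernel consists of the constants by the rank condition, so adding the
    square of the first entry makes the form definite; on increments this
    additional term is zero. *)
Lemma increments_coercive M : cond_M2 M ->
  exists2 c, 0 < c & forall y,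
    c * (\sum_i nrm f (y i - y ord0)) ^+ 2 <= mxform f (Mstar M + (Mstar M)^T) y y.
Proof.
move=> cM; have [pG rG] := cM.
pose E : 'M[R]_n.+1 := delta_mx ord0 ord0.
have quadE (w : 'cV[R]_n.+1) : (w^T *m E *m w) 0 0 = w ord0 0 ^+ 2.
  have -> : E = delta_mx ord0 (0 : 'I_1) *m delta_mx 0 ord0.
    by rewrite mul_delta_mx.
  rewrite mulmxA -colE -mulmxA -rowE mxE big_ord1 !mxE expr2 //.
have pE : psdmx E.
  by split=> [|w]; rewrite ?trmx_delta // quadE sqr_ge0.
have inj (w : 'cV[R]_n.+1) : (Mstar M + (Mstar M)^T + E) *m w = 0 -> w = 0.
  move=> /(psdmxD_ker pG pE)[Gw Ew].
  have [a Ea] := rank_ker (proj1 pG) rG const_neq0 (Mstar_ker_const cM) Gw.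
  have : w ord0 0 ^+ 2 = 0 by rewrite -quadE -mulmxA Ew mulmx0 mxE.
  move=> /eqP; rewrite sqrf_eq0 Ea !mxE mulr1 => /eqP ->.
  by rewrite scale0r.
have [c c0 hc] := mxform_coercive psdf (psdmxD pG pE) inj.
exists c => // y; apply: le_trans (hc (fun i => y i - y ord0)) _.
rewrite mxformDl -mxform_shift // gerDl.
rewrite /mxform (bigD1 ord0) //= [X in _ + X]big1 => [|i i0]; last first.
  by rewrite big1 // => j _; rewrite mxE (negbTE i0) mul0r.
rewrite (bigD1 ord0) //= big1 => [|i i0]; last first.
  by rewrite mxE (negbTE i0) andbF mul0r.
by rewrite subrr form0l // mulr0 !addr0.
Qed.

(** The two kernels are spanned by the constant vector and by v.  A common
    element has all entries equal to the last entry of a multiple of v, that is,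
    to zero. *)
Lemma joint_coercive M H (v : 'cV[R]_n.+1) :
  psdmx (M *m H + (M *m H)^T) -> \rank (M *m H + (M *m H)^T)%R = n -> cond_M2 M ->
  v != 0 -> H *m v = 0 -> v ord_max 0 = 0 ->
  exists2 c, 0 < c & forall y,
    c * (\sum_i nrm f (y i)) ^+ 2 <=
    mxform f (Mstar M + (Mstar M)^T) y y + mxform f (M *m H + (M *m H)^T) y y.
Proof.
move=> pH rH cM v0 Hv vl; have [pG rG] := cM.
have HHv : (M *m H + (M *m H)^T) *m v = 0.
  apply: psdmx_quad => //; rewrite mulmxDr mulmxDl trmx_mul.
  have -> : v^T *m (M *m H) *m v = 0 by rewrite -!mulmxA Hv !mulmx0.
  by rewrite mulmxA -trmx_mul Hv trmx0 !mul0mx addr0 mxE.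
have inj (w : 'cV[R]_n.+1) :
    (Mstar M + (Mstar M)^T + (M *m H + (M *m H)^T)) *m w = 0 -> w = 0.
  move=> /(psdmxD_ker pG pH)[Gw Hw].
  have [a Ea] := rank_ker (proj1 pG) rG const_neq0 (Mstar_ker_const cM) Gw.
  have [b Eb] := rank_ker (proj1 pH) rH v0 HHv Hw.
  have /colP/(_ ord_max) := Ea; rewrite Eb !mxE vl mulr0 mulr1 => a0.
  by rewrite -Eb Ea -a0 scale0r.
have [c c0 hc] := mxform_coercive psdf (psdmxD pG pH) inj.
by exists c => // y; rewrite -mxformDl; apply: hc.
Qed.

End Energy.

(** * Stability of one step *)
Section RealLemmas.
Variable R : realType.

(** Here a is the size of the first stage, m that of the increments, tau the size
    of dt * k, and rho that of a perturbation.  The dissipation c m^2 absorbs every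
    term with a factor m; the term tau a m then leaves tau^2 a^2 <= Cc dt a^2, and
    a rho leaves dt a^2 + rho^2 / dt. *)
Lemma young_step (c Cm Cc : R) : 0 < c -> 0 <= Cm -> 0 <= Cc ->
  exists c0 C : R, [/\ 0 < c0, 0 <= C & forall a m tau rho dt X : R,
    0 <= a -> 0 <= m -> 0 <= tau -> 0 <= rho -> 0 < dt -> dt <= c0 ->
    tau ^+ 2 <= Cc * dt ->
    X <= a ^+ 2 - c * m ^+ 2 + Cm * (tau * (a * m + m ^+ 2) + (a + m) * rho
       + tau ^+ 2 * m ^+ 2 + rho ^+ 2) ->
    X <= (1 + C * dt) * a ^+ 2 + C * rho ^+ 2 / dt].
Proof.
move=> c_gt0 Cm0 Cc0.
pose t0 : R := Num.min 1 (c / (4 * (Cm + 1))).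
have D0 : 0 < 4 * (Cm + 1) by rewrite mulr_gt0 // ltr_wpDl.
have t0_gt0 : 0 < t0 by rewrite lt_min ltr01 divr_gt0.
have Cc1 : 0 < Cc + 1 by rewrite ltr_wpDl.
have [C2 C2E] : exists C2 : R, C2 = 2 * Cm ^+ 2 / c by eexists.
have C20 : 0 <= C2 by rewrite C2E divr_ge0 ?mulr_ge0 ?sqr_ge0 // ltW.
exists (Num.min 1 (t0 ^+ 2 / (Cc + 1))), (C2 * Cc + 1 + C2 + Cm + Cm ^+ 2).
split.
- by rewrite lt_min ltr01 divr_gt0 // exprn_gt0.
- by rewrite !addr_ge0 ?mulr_ge0 ?sqr_ge0.
move=> a m tau rho dt X a0 m0 tau0 rho0 dt0.
rewrite le_min => /andP[dt1 dtc] tauc /le_trans; apply.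
have tau_le : tau <= t0.
  rewrite -(@ler_pXn2r _ 2) ?nnegrE // ?(ltW t0_gt0) //.
  apply: le_trans tauc _; move: dtc; rewrite ler_pdivlMr // => h.
  apply: le_trans h; rewrite mulrC ler_wpM2l ?(ltW dt0) // lerDl //.
have tau1 : tau <= 1 by apply: le_trans tau_le _; rewrite ge_min lexx.
have tauCm : Cm * tau <= c / 4.
  have : tau <= c / (4 * (Cm + 1)).
    by apply: le_trans tau_le _; rewrite ge_min lexx orbT.
  rewrite ler_pdivlMr // => h; nra.
have h1 : Cm * tau * m ^+ 2 <= c / 4 * m ^+ 2 by rewrite ler_wpM2r ?sqr_ge0.
have h2 : Cm * tau ^+ 2 * m ^+ 2 <= c / 4 * m ^+ 2.
  rewrite ler_wpM2r ?sqr_ge0 //; apply: le_trans tauCm.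
  by rewrite ler_wpM2l // expr2 ler_piMl.
have sq (x y : R) : Cm * x * y <= c / 8 * y ^+ 2 + C2 * x ^+ 2.
  have : 0 <= c / 8 * (y - 4 * Cm * x / c) ^+ 2.
    by rewrite mulr_ge0 ?sqr_ge0 // divr_ge0 // ltW.
  have -> : c / 8 * (y - 4 * Cm * x / c) ^+ 2 =
     c / 8 * y ^+ 2 + C2 * x ^+ 2 - Cm * x * y.
    by rewrite C2E; field; rewrite gt_eqF.
  by rewrite subr_ge0.
have h3 := sq (tau * a) m.
have h4 := sq rho m.
have h5 : Cm * a * rho <= dt * a ^+ 2 + Cm ^+ 2 * (rho ^+ 2 / dt).
  have : 0 <= dt * (a - Cm * rho / (2 * dt)) ^+ 2.
    by rewrite mulr_ge0 ?sqr_ge0 // ltW.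
  have -> : dt * (a - Cm * rho / (2 * dt)) ^+ 2 =
     dt * a ^+ 2 - Cm * a * rho + Cm ^+ 2 * (rho ^+ 2 / dt) / 4.
    by field; rewrite gt_eqF.
  have : 0 <= Cm ^+ 2 * (rho ^+ 2 / dt).
    by rewrite mulr_ge0 ?divr_ge0 ?sqr_ge0 // ltW.
  lra.
have h6 : rho ^+ 2 <= rho ^+ 2 / dt.
  by rewrite ler_pdivlMr // ler_piMr ?sqr_ge0.
have h7 : C2 * (tau * a) ^+ 2 <= C2 * Cc * dt * a ^+ 2.
  by rewrite exprMn mulrA ler_wpM2r ?sqr_ge0 // -mulrA ler_wpM2l.
have h8 : (C2 + Cm) * rho ^+ 2 <= (C2 + Cm) * (rho ^+ 2 / dt).
  by rewrite ler_wpM2l // addr_ge0.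
have h9 : 0 <= (C2 + Cm + Cm ^+ 2) * dt * a ^+ 2.
  by rewrite !mulr_ge0 ?sqr_ge0 ?addr_ge0 ?sqr_ge0 // ltW.
have h10 : 0 <= (C2 * Cc + 1) * (rho ^+ 2 / dt).
  by rewrite !mulr_ge0 ?divr_ge0 ?addr_ge0 ?mulr_ge0 ?sqr_ge0 ?invr_ge0 ?(ltW dt0).
have h11 : 0 <= c * m ^+ 2 by rewrite mulr_ge0 ?sqr_ge0 // ltW.
rewrite -[_ * rho ^+ 2 / dt]mulrA.
set q := rho ^+ 2 / dt in h5 h6 h8 h10 *.
set u := a ^+ 2 in h5 h7 h9 *; set w := m ^+ 2 in h1 h2 h3 h4 h11 *.
move: h1 h2 h3 h4 h5 h6 h7 h8 h9 h10 h11; clear sq.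
lra.
Qed.

Lemma discrete_gronwall (x : nat -> R) (C B dt : R) :
  0 <= C -> 0 <= B -> 0 <= dt -> (forall n, 0 <= x n) ->
  (forall n, x n.+1 <= (1 + C * dt) * x n + B * dt) ->
  forall n, x n <= expR (C * (n%:R * dt)) * (x 0%N + B * (n%:R * dt)).
Proof.
move=> C0 B0 dt0 x0 hx; elim=> [|n IH].
  by rewrite mul0r !mulr0 expR0 mul1r addr0.
apply: le_trans (hx n) _.
have Cdt : 0 <= C * dt by rewrite mulr_ge0.
have e1 : 1 + C * dt <= expR (C * dt) by apply: expR_ge1Dx.
have -> : C * (n.+1%:R * dt) = C * dt + C * (n%:R * dt).
  by rewrite -natr1; ring.
rewrite expRD -mulrA.
have h1 : (1 + C * dt) * x n <=
    expR (C * dt) * (expR (C * (n%:R * dt)) * (x 0%N + B * (n%:R * dt))).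
  by rewrite ler_pM // addr_ge0.
have h2 : 1 <= expR (C * dt) * expR (C * (n%:R * dt)).
  by rewrite -expRD -expR0 ler_expR addr_ge0 // !mulr_ge0.
have h3 : B * dt <= expR (C * dt) * expR (C * (n%:R * dt)) * (B * dt).
  by rewrite ler_peMl // mulr_ge0.
apply: le_trans (lerD h1 h3) _.
by rewrite le_eqVlt; apply/orP; left; apply/eqP; rewrite -natr1; ring.
Qed.

End RealLemmas.

Section Stability.
Variables (R : realType) (V : lmodType R) (f g : V -> V -> R).
Hypotheses (psdf : psd_form f) (psdg : psd_form g).
Variables (K Q : {linear V -> V}) (CK : R).
Hypotheses (CK0 : 0 <= CK) (skewK : forall x, f x (K x) = 0)
  (boundK : forall x, nrm f (K x) <= CK * nrm f x)
  (dissQ : forall x y, f x (Q y) = - g x y).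
Variable n : nat.
Implicit Types (M H : 'M[R]_n.+1) (y : 'I_n.+1 -> V).

Lemma linear_mxcomb (L : {linear V -> V}) m k (H : 'M[R]_(m, k)) (y : 'I_k -> V) i :
  L (mxcomb H y i) = mxcomb H (L \o y) i.
Proof. by rewrite /mxcomb linear_sum; apply: eq_bigr => j _; rewrite linearZ. Qed.

Lemma mxform_ge0 h (G : 'M[R]_n.+1) y : psd_form h -> psdmx G -> 0 <= mxform h G y y.
Proof.
move=> psdh [sG pG]; have [L ->] := psd_factor sG pG.
by rewrite mxform_gram // sumr_ge0 // => l _; apply: (form_ge0 psdh).
Qed.

Lemma relaxation_dissipates M H y :
  mxform f M y (fun i => Q (mxcomb H y i)) =
  - (mxform g (M *m H + (M *m H)^T) y y / 2).
Proof.
have -> : mxform f M y (fun i => Q (mxcomb H y i)) = mxform f (M *m H) y (Q \o y).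
  rewrite -mxform_comb //; apply: eq_bigr => i _; apply: eq_bigr => j _.
  by rewrite linear_mxcomb.
rewrite -mxform_sym // -mulN1r mulr_sumr; apply: eq_bigr => i _.
rewrite mulr_sumr; apply: eq_bigr => j _; rewrite /= dissQ mulN1r mulrN //.
Qed.

(** Skewness removes the term with the first stage twice, so every remaining term
    contains an increment. *)
Lemma transport_bound M H y a m :
  a = nrm f (y ord0) -> m = \sum_i nrm f (y i - y ord0) ->
  `|mxform f M y (fun i => K (mxcomb H y i))| <=
  mxsize (M *m H) * (CK * (2 * a * m + m ^+ 2)).
Proof.
move=> Ea Em.
have -> : mxform f M y (fun i => K (mxcomb H y i)) =
    mxform (fun u v => f u (K v)) (M *m H) y y.
  have -> : mxform (fun u v => f u (K v)) (M *m H) y y = mxform f (M *m H) y (K \o y).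
    by [].
  rewrite -mxform_comb //; apply: eq_bigr => i _; apply: eq_bigr => j _.
  by rewrite linear_mxcomb.
apply: mxform_bound => i j.
have a0 : 0 <= a by rewrite Ea; apply: nrm_ge0.
have mi k : nrm f (y k - y ord0) <= m.
  rewrite Em (bigD1 k) //= lerDl sumr_ge0 // => l _; exact: nrm_ge0.
have m0 : 0 <= m := le_trans (nrm_ge0 _ _) (mi ord0).
have Ey k : y k = y ord0 + (y k - y ord0) by rewrite addrC subrK.
have -> : f (y i) (K (y j)) = f (y ord0) (K (y j - y ord0)) +
   (f (y i - y ord0) (K (y ord0)) + f (y i - y ord0) (K (y j - y ord0))).
  have e : K (y j) = K (y ord0) + K (y j - y ord0) by rewrite -linearD -Ey.
  rewrite {1}(Ey i) (formDl psdf); congr (_ + _).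
    by rewrite e (formDr psdf) skewK add0r.
  by rewrite e (formDr psdf).
have b u v : `|f u (K v)| <= CK * (nrm f u * nrm f v).
  apply: le_trans (form_le_nrm psdf _ _) _; rewrite mulrCA ler_wpM2l ?nrm_ge0 //.
have h1 : CK * (nrm f (y ord0) * nrm f (y j - y ord0)) <= CK * (a * m).
  by rewrite -Ea ler_wpM2l // ler_wpM2l.
have h2 : CK * (nrm f (y i - y ord0) * nrm f (y ord0)) <= CK * (m * a).
  by rewrite -Ea ler_wpM2l // ler_wpM2r.
have h3 : CK * (nrm f (y i - y ord0) * nrm f (y j - y ord0)) <= CK * (m * m).
  by rewrite ler_wpM2l // ler_pM ?nrm_ge0.
have n1 := le_trans (b _ _) h1; have n2 := le_trans (b _ _) h2.
have n3 := le_trans (b _ _) h3.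
apply: le_trans (ler_normD _ _) _; apply: le_trans (lerD n1 (ler_normD _ _)) _.
apply: le_trans (lerD (lexx _) (lerD n2 n3)) _.
by rewrite le_eqVlt; apply/orP; left; apply/eqP; ring.
Qed.

Variables (M Hex Him : 'M[R]_n.+1) (gam : 'I_n.+1 -> R) (Cc : R).
Hypotheses (pH : psdmx (M *m Him + (M *m Him)^T)) (cM : cond_M2 M)
  (gam0 : \sum_j gam j = 0) (Cc0 : 0 <= Cc).

(** In the application gam is the difference of the explicit weights and of the last
    explicit row.  Stiff accuracy makes the implicit part of the update that of the last
    stage, so the update is the last stage plus an explicit correction.  No constant
    depends on z, which stands for dt / eps. *)
Lemma stability_step : exists c0 C : R, [/\ 0 < c0, 0 <= C &
  forall (tau dt z rho : R) y (e : 'I_n.+1 -> V) (yn x : V),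
    0 <= tau -> 0 < dt -> dt <= c0 -> tau ^+ 2 <= Cc * dt -> 0 <= z ->
    (forall i, nrm f (e i) <= rho) -> nrm f x <= rho ->
    (forall i, y i = y ord0 + tau *: K (mxcomb Hex y i)
                     + z *: Q (mxcomb Him y i) + e i) ->
    yn = y ord_max + tau *: K (\sum_j gam j *: y j) + x ->
    f yn yn <= (1 + C * dt) * f (y ord0) (y ord0) + C * rho ^+ 2 / dt].
Proof.
have [c c_gt0 hc] := increments_coercive psdf cM.
pose G := \sum_j `|gam j|.
have G0 : 0 <= G by apply: sumr_ge0.
pose Cm := 2 * (mxsize (M *m Hex) * CK) + n.+1%:R * mxsize M + 2 + 4 * (CK * G)
           + 2 * (CK * G) ^+ 2.
have sM := mxsize_ge0 M; have sMH := mxsize_ge0 (M *m Hex).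
have CG0 : 0 <= CK * G by rewrite mulr_ge0.
have SC0 : 0 <= mxsize (M *m Hex) * CK by rewrite mulr_ge0.
have nM0 : 0 <= n.+1%:R * mxsize M by rewrite mulr_ge0.
have CG2 := sqr_ge0 (CK * G).
have Cm0 : 0 <= Cm by rewrite /Cm; lra.
have c2 : 0 < c / 2 by rewrite divr_gt0.
have [c0 [C [c0_gt0 C0 hC]]] := young_step c2 Cm0 Cc0.
exists c0, C; split=> // tau dt z rho y e yn x tau0 dt0 dtc tauc z0 he hx hy hyn.
pose a := nrm f (y ord0); pose m := \sum_i nrm f (y i - y ord0).
have a0 : 0 <= a by apply: nrm_ge0.
have mi k : nrm f (y k - y ord0) <= m.
  rewrite /m (bigD1 k) //= lerDl sumr_ge0 // => l _; exact: nrm_ge0.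
have m0 : 0 <= m := le_trans (nrm_ge0 _ _) (mi ord0).
have rho0 : 0 <= rho := le_trans (nrm_ge0 _ _) hx.
have yi k : nrm f (y k) <= a + m.
  have -> : y k = y ord0 + (y k - y ord0) by rewrite addrC subrK.
  by apply: le_trans (nrmD psdf _ _) _; rewrite lerD.
rewrite -(nrm_sqr psdf yn) -(nrm_sqr psdf (y ord0)) -/a.
apply: (hC a m tau) => //.
have E1 := energy_identity psdf M y.
have E2 : mxform f M y (fun i => y i - y ord0) =
   tau * mxform f M y (fun i => K (mxcomb Hex y i)) -
   z * (mxform g (M *m Him + (M *m Him)^T) y y / 2) + mxform f M y e.
  rewrite -mulrN -relaxation_dissipates -!mxformZr // -!mxformDr //.
  apply: eq_bigr => i _; apply: eq_bigr => j _; congr (_ * f _ _).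
  by apply/eqP; rewrite subr_eq {1}hy [eqbRHS]addrC !addrA.
have d0 : 0 <= z * (mxform g (M *m Him + (M *m Him)^T) y y / 2).
  by rewrite mulr_ge0 // divr_ge0 // mxform_ge0.
have tb := le_trans (ler_norm _) (transport_bound M Hex (erefl a) (erefl m)).
have {}tb := ler_wpM2l tau0 tb.
have eb : mxform f M y e <= n.+1%:R * mxsize M * ((a + m) * rho).
  apply: le_trans (ler_norm _) _.
  apply: (@le_trans _ _ (mxsize M * ((a + m) * rho))).
    apply: mxform_bound => i j; apply: le_trans (form_le_nrm psdf _ _) _.
    by rewrite ler_pM ?nrm_ge0.
  rewrite -mulrA ler_peMl ?ler1n // mulr_ge0 ?mxsize_ge0 // mulr_ge0 //.
  by rewrite addr_ge0.
have hcm := hc y; rewrite -/m in hcm.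
have ys_sq : nrm f (y ord_max) ^+ 2 <= a ^+ 2 - c / 2 * m ^+ 2
   + tau * (mxsize (M *m Hex) * (CK * (2 * a * m + m ^+ 2)))
   + n.+1%:R * mxsize M * ((a + m) * rho).
  rewrite nrm_sqr //; rewrite -(nrm_sqr psdf (y ord0)) -/a in E1; lra.
(* As the weights gam add up to zero, only the increments y j - y ord0 enter
   this sum: the correction is of size tau * m. *)
pose w := tau *: K (\sum_j gam j *: y j) + x.
have gy : \sum_j gam j *: y j = \sum_j gam j *: (y j - y ord0).
  under [RHS]eq_bigr => j _ do rewrite scalerBr.
  by rewrite sumrB -scaler_suml gam0 scale0r subr0.
have wb : nrm f w <= tau * (CK * G * m) + rho.
  apply: le_trans (nrmD psdf _ _) _; rewrite lerD // nrmZ // ger0_norm //.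
  rewrite ler_wpM2l // -mulrA; apply: le_trans (boundK _) _; rewrite ler_wpM2l //.
  rewrite gy; exact: nrm_comb.
have ynE : yn = y ord_max + w by rewrite hyn addrA.
have yn_sq : nrm f yn ^+ 2 <= nrm f (y ord_max) ^+ 2
    + 2 * ((a + m) * (tau * (CK * G * m) + rho)) + (tau * (CK * G * m) + rho) ^+ 2.
  have w0 : 0 <= nrm f w by apply: nrm_ge0.
  have s0 : 0 <= nrm f (y ord_max) by apply: nrm_ge0.
  have t1 : nrm f yn <= nrm f (y ord_max) + nrm f w by rewrite ynE nrmD.
  have yn0 : 0 <= nrm f yn by apply: nrm_ge0.
  have t2 : nrm f (y ord_max) * nrm f w <= (a + m) * (tau * (CK * G * m) + rho).
    by rewrite ler_pM.
  have t3 : nrm f w ^+ 2 <= (tau * (CK * G * m) + rho) ^+ 2 by rewrite !expr2 ler_pM.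
  apply: (@le_trans _ _ ((nrm f (y ord_max) + nrm f w) ^+ 2)).
    by rewrite !expr2 ler_pM.
  by rewrite sqrrD; lra.
apply: le_trans yn_sq _.
have am0 : 0 <= a * m by rewrite mulr_ge0.
have m20 : 0 <= m ^+ 2 by rewrite sqr_ge0.
have tam : 0 <= tau * (a * m) by rewrite mulr_ge0.
have tm2 : 0 <= tau * m ^+ 2 by rewrite mulr_ge0.
have amr : 0 <= (a + m) * rho by rewrite mulr_ge0 // addr_ge0.
have t2m : 0 <= tau ^+ 2 * m ^+ 2 by rewrite mulr_ge0 ?sqr_ge0.
have r2 := sqr_ge0 rho.
set P1 := mxsize (M *m Hex) * CK in SC0 *.
set P2 := CK * G in CG0 CG2 *.
set P3 := n.+1%:R * mxsize M in nM0 ys_sq *.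
have sq2 : (tau * (P2 * m) + rho) ^+ 2 <= 2 * P2 ^+ 2 * (tau ^+ 2 * m ^+ 2) + 2 * rho ^+ 2.
  have := sqr_ge0 (tau * (P2 * m) - rho); rewrite !sqrrD sqrrN.
  rewrite mulrN mulNrn; have -> : (tau * (P2 * m)) ^+ 2 = P2 ^+ 2 * (tau ^+ 2 * m ^+ 2) by ring.
  lra.
pose X := tau * (a * m + m ^+ 2); pose Y := (a + m) * rho.
pose Z := tau ^+ 2 * m ^+ 2.
have XE : X = tau * (a * m) + tau * m ^+ 2 by rewrite /X mulrDr.
have X0 : 0 <= X by rewrite XE addr_ge0.
have k1 : tau * (mxsize (M *m Hex) * (CK * (2 * a * m + m ^+ 2))) <= 2 * P1 * X.
  have -> : tau * (mxsize (M *m Hex) * (CK * (2 * a * m + m ^+ 2))) =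
     2 * P1 * X - P1 * (tau * m ^+ 2) by rewrite /P1 /X; ring.
  by rewrite gerBl mulr_ge0.
have k2 : 2 * ((a + m) * (tau * (P2 * m) + rho)) = 2 * P2 * X + 2 * Y.
  by rewrite /X /Y; ring.
have hP : 2 * P1 * X + P3 * Y + 2 * P2 * X + 2 * Y + 2 * P2 ^+ 2 * Z + 2 * rho ^+ 2
    <= Cm * (X + Y + Z + rho ^+ 2).
  have -> : Cm = 2 * P1 + P3 + 2 + 4 * P2 + 2 * P2 ^+ 2 by [].
  have q (u v : R) : 0 <= u -> 0 <= v -> 0 <= u * v by apply: mulr_ge0.
  have := (q _ _ SC0 amr, q _ _ SC0 t2m, q _ _ SC0 r2).
  have := (q _ _ nM0 X0, q _ _ nM0 t2m, q _ _ nM0 r2).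
  have := (q _ _ CG0 X0, q _ _ CG0 amr, q _ _ CG0 t2m, q _ _ CG0 r2).
  have := (q _ _ CG2 X0, q _ _ CG2 amr, q _ _ CG2 r2).
  rewrite -/Y -/Z; move=> [[x1 x2] x3] [[[x4 x5] x6] x7] [[x8 x9] x10] [[x11 x12] x13].
  by rewrite -/Y in amr; rewrite -/Z in t2m; lra.
rewrite -/X -/Y -/Z in hP *; rewrite k2; rewrite -/Z in sq2; rewrite -/Y in ys_sq.
apply: (@le_trans _ _ (a ^+ 2 - c / 2 * m ^+ 2 + 2 * P1 * X + P3 * Y
   + (2 * P2 * X + 2 * Y) + (2 * P2 ^+ 2 * Z + 2 * rho ^+ 2))).
  apply: lerD sq2; rewrite lerD2r; apply: le_trans ys_sq _.
  by rewrite lerD2r lerD2l.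
move: hP; clear; lra.
Qed.

End Stability.

(** * The stiff corrector *)
Lemma linear_inverse (R : realType) (W : vectType R) (F : {linear W -> W}) :
  (forall x, F x = 0 -> x = 0) -> exists G : {linear W -> W}, forall x, F (G x) = x.
Proof.
move=> inj; have kF : lker (linfun F) == 0%VS.
  apply/lker0P => x y; rewrite !lfunE => Exy.
  by apply/eqP; rewrite -subr_eq0; apply/eqP/inj; rewrite linearB /= Exy subrr.
exists ((linfun F)^-1)%VF => x.
by have := lker0_lfunVK kF x; rewrite lfunE.
Qed.

Section Corrector.
Variables (R : realType) (V : vectType R) (f g : V -> V -> R).
Hypotheses (psdf : psd_form f) (psdg : psd_form g)
  (deff : forall x, f x x = 0 -> x = 0).
Variables (Q Pi : {linear V -> V}) (lam CQ : R).
Hypotheses (lam0 : 0 < lam) (CQ0 : 0 <= CQ)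
  (PiPi : forall x, Pi (Pi x) = Pi x) (QPi : forall x, Q (Pi x) = Q x)
  (PiQ : forall x, Pi (Q x) = Q x) (nrmPi : forall x, nrm f (Pi x) <= nrm f x)
  (boundQ : forall x, nrm f (Q x) <= CQ * nrm f x)
  (dissQ : forall x y, f x (Q y) = - g x y)
  (gPi : forall x, lam * f (Pi x) (Pi x) <= g x x).
Variable n : nat.
Variables (M Him : 'M[R]_n.+1) (v : 'cV[R]_n.+1) (b : 'I_n.+1 -> R).
Hypotheses (pH : psdmx (M *m Him + (M *m Him)^T))
  (rH : \rank (M *m Him + (M *m Him)^T)%R = n) (cM : cond_M2 M)
  (v0 : v != 0) (Hv : Him *m v = 0) (vl : v ord_max 0 = 0)
  (Hb : forall j, Him ord_max j = b j) (b1 : \sum_j b j = 1)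
  (H0 : forall j, Him ord0 j = 0).

(** Since the last row of the implicit matrix is b, the condition on the weighted
    sum makes the last stage differ from the first by a residual only.  Their
    energies then almost cancel in the energy identity, which bounds both
    dissipative terms by the product of the stages and the residuals. *)
Lemma stiff_energy z (x r : 'I_n.+1 -> V) : 0 < z ->
  (forall i, x i - x ord0 = z *: Q (mxcomb Him x i) + r i) ->
  \sum_j b j *: x j = 0 ->
  mxform f (Mstar M + (Mstar M)^T) x x + z * mxform g (M *m Him + (M *m Him)^T) x x
  <= 2 * (2 + mxsize M) * ((\sum_i nrm f (x i)) * (\sum_i nrm f (r i))).
Proof.
move=> z0 hx bx; set a := \sum_i nrm f (x i); set rho := \sum_i nrm f (r i).
have xi k : nrm f (x k) <= a.
  rewrite /a (bigD1 k) //= lerDl sumr_ge0 // => l _; exact: nrm_ge0.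
have ri k : nrm f (r k) <= rho.
  rewrite /rho (bigD1 k) //= lerDl sumr_ge0 // => l _; exact: nrm_ge0.
have E1 := energy_identity psdf M x.
have E2 : mxform f M x (fun i => x i - x ord0) =
   - (z * (mxform g (M *m Him + (M *m Him)^T) x x / 2)) + mxform f M x r.
  rewrite -mulrN -(relaxation_dissipates psdf psdg dissQ) -mxformZr // -mxformDr //.
  by apply: eq_bigr => i _; apply: eq_bigr => j _; rewrite hx.
have E3 : mxform f M x r <= mxsize M * (a * rho).
  apply: le_trans (ler_norm _) _; apply: mxform_bound => i j.
  by apply: le_trans (form_le_nrm psdf _ _) _; rewrite ler_pM ?nrm_ge0.
(* The last implicit row is b, and the weighted sum of the stages is zero. *)
have E4 : x ord_max = x ord0 + r ord_max.
  have := hx ord_max; rewrite /mxcomb.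
  under eq_bigr => j _ do rewrite Hb.
  by rewrite bx linear0 scaler0 add0r => <-; rewrite addrC subrK.
have E5 : f (x ord_max) (x ord_max) =
    f (x ord0) (x ord0) + 2 * f (x ord0) (r ord_max) + f (r ord_max) (r ord_max).
  by rewrite E4 !(formDl psdf) !(formDr psdf) (formC psdf (r ord_max) (x ord0)); ring.
have E6 : - f (x ord0) (r ord_max) <= a * rho.
  apply: le_trans (ler_norm _) _; rewrite normrN.
  by apply: le_trans (form_le_nrm psdf _ _) _; rewrite ler_pM ?nrm_ge0.
have E7 := form_ge0 psdf (r ord_max).
lra.
Qed.

(** For z bounded below, the form of g dominates that of f on the relaxed components
    and [joint_coercive] applies.  For small z the stages are nearly equal, and their
    weighted sum, which is zero, determines the first one because the weights add up
    to 1.  The second argument needs z D <= 1 / 2, which defines the threshold. *)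
Lemma corrector_bound : exists2 C, 0 <= C &
  forall z (x r : 'I_n.+1 -> V), 0 < z -> (forall i, Pi (x i) = x i) ->
  (forall i, x i - x ord0 = z *: Q (mxcomb Him x i) + r i) ->
  \sum_j b j *: x j = 0 ->
  \sum_i nrm f (x i) <= C * \sum_i nrm f (r i).
Proof.
have [c c_gt0 hc] := joint_coercive psdf pH rH cM v0 Hv vl.
pose B := \sum_j `|b j|; pose N : R := n.+1%:R.
have B0 : 0 <= B by apply: sumr_ge0.
have sH := mxsize_ge0 Him; have sM := mxsize_ge0 M.
(* Below the threshold z1 the relaxation term is at most half of the stages:
   it is treated as a perturbation. *)
pose D := (N * (B + 1)) * (CQ * mxsize Him) * N.
have N0 : 0 <= N by rewrite ler0n.
have D0 : 0 <= D by rewrite /D !mulr_ge0 // addr_ge0.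
have [z1 z1E] : exists z1 : R, z1 = (2 * (D + 1))^-1 by eexists.
have z1_gt0 : 0 < z1 by rewrite z1E invr_gt0 mulr_gt0 // ltr_wpDl.
have [k kE] : exists k : R, k = 1 + (lam * z1)^-1 by eexists.
have lz : 0 < lam * z1 by rewrite mulr_gt0.
have k0 : 0 <= k by rewrite kE addr_ge0 // invr_ge0 ltW.
have sM2 : 0 <= 2 + mxsize M by rewrite addr_ge0.
have BN0 : 0 <= N * (B + 1) * N by rewrite !mulr_ge0 // addr_ge0.
have kc0 : 0 <= k * (2 * (2 + mxsize M)) / c.
  by rewrite divr_ge0 ?(ltW c_gt0) // mulr_ge0 // mulr_ge0.
exists (k * (2 * (2 + mxsize M)) / c + 2 * (N * (B + 1) * N)).
  by rewrite addr_ge0 // mulr_ge0.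
move=> z x r z0 Pix hx bx.
have E := stiff_energy z0 hx bx.
set a := \sum_i nrm f (x i) in E *; set rho := \sum_i nrm f (r i) in E *.
have xi i : nrm f (x i) <= a.
  rewrite /a (bigD1 i) //= lerDl sumr_ge0 // => l _; exact: nrm_ge0.
have ri i : nrm f (r i) <= rho.
  rewrite /rho (bigD1 i) //= lerDl sumr_ge0 // => l _; exact: nrm_ge0.
have a0 : 0 <= a := le_trans (nrm_ge0 _ _) (xi ord0).
have rho0 : 0 <= rho := le_trans (nrm_ge0 _ _) (ri ord0).
rewrite mulrDl; have [zz|zz] := lerP z1 z.
  have fg : lam * mxform f (M *m Him + (M *m Him)^T) x x <=
            mxform g (M *m Him + (M *m Him)^T) x x.
    have [sG pG] := pH; have [L EL] := psd_factor sG pG.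
    rewrite EL !mxform_gram // mulr_sumr; apply: ler_sum => l _.
    have {1 2}-> : mxcomb L x l = Pi (mxcomb L x l); last exact: gPi.
    rewrite linear_mxcomb; apply: eq_bigr => j _ /=; by rewrite Pix.
  have f2 : 0 <= mxform f (Mstar M + (Mstar M)^T) x x.
    by apply: mxform_ge0 => //; case: cM.
  have g1 : 0 <= mxform g (M *m Him + (M *m Him)^T) x x by apply: mxform_ge0.
  have hca := hc x; rewrite -/a in hca.
  have zg : lam * z1 * mxform f (M *m Him + (M *m Him)^T) x x <=
       z * mxform g (M *m Him + (M *m Him)^T) x x.
    rewrite [lam * _]mulrC -mulrA; apply: (@le_trans _ _ (z1 * mxform g (M *m Him + (M *m Him)^T) x x)).
      by rewrite ler_wpM2l // ltW.
    by rewrite ler_wpM2r.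
  have : c * a ^+ 2 <= k * (2 * (2 + mxsize M) * (a * rho)).
    apply: le_trans hca _; apply: (@le_trans _ _ (k * (mxform f (Mstar M + (Mstar M)^T) x x + z * mxform g (M *m Him + (M *m Him)^T) x x))); last by rewrite ler_wpM2l.
    have -> : mxform f (M *m Him + (M *m Him)^T) x x =
       (lam * z1)^-1 * (lam * z1 * mxform f (M *m Him + (M *m Him)^T) x x).
      by rewrite mulKf // gt_eqF.
    rewrite kE; set q := (lam * z1)^-1.
    have q0 : 0 <= q by rewrite invr_ge0 ltW.
    have := ler_wpM2l q0 zg; have := mulr_ge0 q0 f2.
    have := mulr_ge0 (ltW z0) g1.
    lra.
  have [->|an0] := eqVneq a 0.
    by move=> _; rewrite addr_ge0 // mulr_ge0 // mulr_ge0.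
  have ap : 0 < a by rewrite lt_def an0.
  move=> h; have {}h : a * c <= k * (2 * (2 + mxsize M)) * rho.
    rewrite -(ler_pM2l ap); apply: le_trans (_ : _ <= c * a ^+ 2) _.
      by rewrite le_eqVlt; apply/orP; left; apply/eqP; ring.
    by apply: le_trans h _; rewrite le_eqVlt; apply/orP; left; apply/eqP; ring.
  rewrite -ler_pdivlMr // in h; rewrite mulrAC in h.
  by apply: le_trans h _; rewrite lerDl mulr_ge0 // mulr_ge0.
have dj j : nrm f (x j - x ord0) <= z * (CQ * mxsize Him * a) + rho.
  rewrite hx; apply: le_trans (nrmD psdf _ _) _; rewrite lerD // nrmZ //.
  rewrite gtr0_norm // ler_wpM2l ?(ltW z0) // -mulrA.
  apply: le_trans (boundQ _) _; rewrite ler_wpM2l //; exact: nrm_mxcomb.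
set d := z * _ + rho in dj.
have d0 : 0 <= d := le_trans (nrm_ge0 _ _) (dj ord0).
have x0b : nrm f (x ord0) <= B * (N * d).
  have -> : x ord0 = - \sum_j b j *: (x j - x ord0).
    under eq_bigr => j _ do rewrite scalerBr.
    by rewrite sumrB bx -scaler_suml b1 scale1r sub0r opprK.
  rewrite nrmN //; apply: le_trans (nrm_comb psdf _ _) _; rewrite ler_wpM2l //.
  apply: le_trans (ler_sum _ (fun j _ => dj j)) _.
  by rewrite sumr_const card_ord /N mulr_natl.
have ab : a <= N * (B + 1) * N * d.
  have h i : nrm f (x i) <= (B + 1) * N * d.
    have -> : x i = x ord0 + (x i - x ord0) by rewrite addrC subrK.
    apply: le_trans (nrmD psdf _ _) _; apply: le_trans (lerD x0b (dj i)) _.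
    have : d <= N * d by rewrite ler_peMl // /N ler1n.
    lra.
  apply: le_trans (ler_sum _ (fun j _ => h j)) _.
  by rewrite sumr_const card_ord -[leLHS]mulr_natl -/N !mulrA.
have ab2 : a <= z * D * a + N * (B + 1) * N * rho.
  by apply: le_trans ab _; rewrite /d /D le_eqVlt; apply/orP; left; apply/eqP; ring.
have zD : z * D <= 2^-1.
  have : z * (2 * (D + 1)) <= 1.
    apply: (@le_trans _ _ (z1 * (2 * (D + 1)))).
      by rewrite ler_wpM2r ?(ltW zz) // mulr_ge0 // addr_ge0.
    by rewrite z1E mulVf // gt_eqF // mulr_gt0 // ltr_wpDl.
  have := ltW z0; lra.
have zDa : z * D * a <= 2^-1 * a by rewrite ler_wpM2r.
have : 0 <= k * (2 * (2 + mxsize M)) / c * rho.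
  by rewrite mulr_ge0.
lra.
Qed.

(** Its first component encodes two conditions at once, by the splitting of V by Pi:
    the weighted sum of the relaxed parts vanishes, and so does the unrelaxed part of
    the first stage.  The system is then square, so that injectivity gives an
    inverse. *)
Definition corrector_op z (h : {ffun 'I_n.+1 -> V}) : {ffun 'I_n.+1 -> V} :=
  [ffun i => if i == ord0 then \sum_j b j *: Pi (h j) + (h ord0 - Pi (h ord0))
             else h i - h ord0 - z *: Q (mxcomb Him h i)].

Lemma corrector_op_linear z : linear (corrector_op z).
Proof.
move=> a h h'; apply/ffunP => i; rewrite !ffunE; case: ifP => _.
  under eq_bigr => j _ do rewrite !ffunE linearP scalerDr scalerA (mulrC (b j)) -scalerA.
  rewrite big_split /= -scaler_sumr linearP opprD.
  by rewrite (addrACA (a *: h ord0)) -scalerBr [LHS]addrACA -scalerDr.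
have -> : mxcomb Him (a *: h + h') i = a *: mxcomb Him h i + mxcomb Him h' i.
  rewrite /mxcomb scaler_sumr -big_split; apply: eq_bigr => j _.
  by rewrite !ffunE scalerDr !scalerA mulrC.
rewrite (linearP Q) scalerDr scalerA (mulrC z) -scalerA !opprD.
by rewrite (addrACA (a *: h i)) -scalerBr [LHS]addrACA -scalerBr.
Qed.
HB.instance Definition _ z := GRing.isLinear.Build R _ _ _ _ (corrector_op_linear z).

(** The first stage is free, since the first row of the implicit matrix is zero.  It
    is chosen such that the implicit weighted sum of the corrector vanishes: the
    corrector is then invisible to the implicit part of the update. *)
Lemma corrector : exists2 C, 0 <= C & forall z, 0 < z ->
  exists S : {linear {ffun 'I_n.+1 -> V} -> {ffun 'I_n.+1 -> V}},
  forall r : {ffun 'I_n.+1 -> V}, r ord0 = 0 ->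
  [/\ forall i, S r i = S r ord0 + z *: Q (mxcomb Him (S r) i) + r i,
      \sum_j b j *: Q (S r j) = 0 &
      forall i, nrm f (S r i) <= C * \sum_i nrm f (r i)].
Proof.
have [C C0 hC] := corrector_bound.
exists (C + 2) => [|z z0]; first by rewrite addr_ge0.
have key (h r : {ffun 'I_n.+1 -> V}) : corrector_op z h = r -> r ord0 = 0 ->
  [/\ forall i, h i = h ord0 + z *: Q (mxcomb Him h i) + r i,
      \sum_j b j *: Q (h j) = 0 &
      forall i, nrm f (h i) <= (C + 2) * \sum_i nrm f (r i)].
  move=> hr r0.
  have e0 : \sum_j b j *: Pi (h j) + (h ord0 - Pi (h ord0)) = 0.
    by have := ffunE (fun i => if i == ord0 then \sum_j b j *: Pi (h j) + (h ord0 - Pi (h ord0))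
             else h i - h ord0 - z *: Q (mxcomb Him h i)) ord0; rewrite -/(corrector_op z h) hr r0 eqxx.
  have bPi : \sum_j b j *: Pi (h j) = 0.
    have := congr1 Pi e0; rewrite linearD linearB /= PiPi subrr addr0 linear0 => bPi.
    by rewrite -[RHS]bPi linear_sum; apply: eq_bigr => j _; rewrite linearZ /= PiPi.
  have h0 : Pi (h ord0) = h ord0.
    by move: e0; rewrite bPi add0r => /eqP; rewrite subr_eq0 => /eqP.
  have hi i : h i = h ord0 + z *: Q (mxcomb Him h i) + r i.
    have [->|i0] := eqVneq i ord0.
      rewrite r0 addr0 /mxcomb big1 ?linear0 ?scaler0 ?addr0 // => j _.
      by rewrite H0 scale0r.
    have := ffunE (fun i => if i == ord0 then \sum_j b j *: Pi (h j) + (h ord0 - Pi (h ord0))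
             else h i - h ord0 - z *: Q (mxcomb Him h i)) i.
    rewrite -/(corrector_op z h) hr (negbTE i0) => ->.
    by rewrite [RHS]addrC -(addrA (h i)) -opprD subrK.
  have QPih i : Q (mxcomb Him (Pi \o h) i) = Q (mxcomb Him h i).
    by rewrite -linear_mxcomb QPi.
  have hx i : Pi (h i) - Pi (h ord0) = z *: Q (mxcomb Him (Pi \o h) i) + Pi (r i).
    apply/eqP; rewrite subr_eq {1}hi !linearD /= linearZ /= PiQ QPih.
    by rewrite [eqbRHS]addrC addrA.
  have hb := hC z (Pi \o h) (Pi \o r) z0 (fun i => PiPi (h i)) hx bPi.
  have sr i : nrm f (r i) <= \sum_i nrm f (r i).
    rewrite [leRHS](bigD1 i) //= lerDl sumr_ge0 // => l _; exact: nrm_ge0.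
  split=> [//||i].
    transitivity (Q (\sum_j b j *: Pi (h j))); last by rewrite bPi linear0.
    by rewrite linear_sum; apply: eq_bigr => j _; rewrite linearZ /= QPi.
  have -> : h i = Pi (h i) + (r i - Pi (r i)).
    have /eqP := hx i; rewrite subr_eq QPih h0 => /eqP ->.
    rewrite {1}hi [X in _ = X + _]addrC (addrA (h ord0)) -[RHS]addrA; congr (_ + _).
    by rewrite addrC subrK.
  apply: le_trans (nrmD psdf _ _) _; rewrite mulrDl; apply: lerD.
    apply: (@le_trans _ _ (\sum_i nrm f ((Pi \o h) i))).
      rewrite (bigD1 i) //= lerDl sumr_ge0 // => l _; exact: nrm_ge0.
    apply: le_trans hb _; rewrite ler_wpM2l //; apply: ler_sum => j _; exact: nrmPi.
  apply: le_trans (nrmB psdf _ _) _; rewrite mulrDl mul1r lerD //.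
  exact: le_trans (nrmPi _) (sr i).
have [h hh|S hS] := @linear_inverse _ _ (corrector_op z).
  have z00 : (0 : {ffun 'I_n.+1 -> V}) ord0 = 0 by rewrite ffunE.
  have [_ _ hb] := key h 0 hh z00.
  apply/ffunP => i; rewrite ffunE; apply: deff.
  have : nrm f (h i) <= 0.
    apply: le_trans (hb i) _; rewrite big1 ?mulr0 // => j _.
    by rewrite ffunE nrm0.
  by move=> h1; rewrite -(nrm_sqr psdf); apply/eqP; rewrite sqrf_eq0 eq_le h1 nrm_ge0.
by exists S => r r0; apply: (key (S r) r (hS r) r0).
Qed.

End Corrector.

(** * Consequences of the conditions on the tableau *)
Section Tableau.
Variables (R : realType) (n : nat) (rk : imex_tableau R n.+1).
Hypotheses (CK : type_CK rk) (isa : ISA rk) (ord1 : order1 rk) (ord2 : order2 rk)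
  (ord3 : order3 rk) (c_eq : forall i, cim rk i = cex rk i)
  (stages : stage_order rk) (vanish : vanishing_coefficients rk).
Local Notation c := (cim rk).

Lemma sum_Him (i : 'I_n.+1) (a : 'I_n.+1 -> R) :
  \sum_(j < n.+1 | (j <= i)%N) Him rk i j * a j = \sum_j Him rk i j * a j.
Proof.
rewrite [RHS](bigID (fun j : 'I_n.+1 => (j <= i)%N)) /= [X in _ + X]big1 ?addr0 //.
by move=> j; rewrite -ltnNge => /(Him_trig rk) ->; rewrite mul0r.
Qed.

Lemma sum_Hex (i : 'I_n.+1) (a : 'I_n.+1 -> R) :
  \sum_(j < n.+1 | (j < i)%N) Hex rk i j * a j = \sum_j Hex rk i j * a j.
Proof.
rewrite [RHS](bigID (fun j : 'I_n.+1 => (j < i)%N)) /= [X in _ + X]big1 ?addr0 //.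
by move=> j; rewrite -leqNgt => /(Hex_trig rk) ->; rewrite mul0r.
Qed.

Lemma row_Him i : \sum_j Him rk i j = c i.
Proof.
rewrite /cim; have := sum_Him i (fun=> 1).
under eq_bigr => j _ do rewrite mulr1.
by under [in RHS]eq_bigr => j _ do rewrite mulr1.
Qed.

Lemma row_Hex i : \sum_j Hex rk i j = c i.
Proof.
rewrite c_eq /cex; have := sum_Hex i (fun=> 1).
under eq_bigr => j _ do rewrite mulr1.
by under [in RHS]eq_bigr => j _ do rewrite mulr1.
Qed.

Lemma Him_row0 j : Him rk ord0 j = 0.
Proof.
have [h [Hhat [_ ->]]] := CK.
have -> : (ord0 : 'I_n.+1) = lshift n (0 : 'I_1) by apply/val_inj.
case: (@split_ordP 1 n j) => k ->.
  by apply: etrans (block_mxEul _ _ _ _ _ _) _; rewrite mxE.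
by apply: etrans (block_mxEur _ _ _ _ _ _) _; rewrite mxE.
Qed.

Lemma Hex_row0 j : Hex rk ord0 j = 0.
Proof. exact: Hex_trig. Qed.

Lemma c_ord0 : c ord0 = 0.
Proof. by rewrite -row_Hex big1 // => j _; apply: Hex_row0. Qed.

(** With at most two stages, the sum of the explicit weights times the abscissae is
    zero, as the first abscissa and the second weight vanish; it should be 1 / 2. *)
Lemma at_least_three_stages : (1 < n)%N.
Proof.
rewrite ltnNge; apply/negP => n1.
have := order2_ee ord2; rewrite /osum1 big1 => [/esym/eqP|i _].
  by rewrite invr_eq0 pnatr_eq0.
rewrite -c_eq; have [i0|i0] := eqVneq (i : nat) 0%N.
  have -> : i = ord0 by apply/val_inj.
  by rewrite c_ord0 mulr0.
have /(vanish.1 i) -> : nat_of_ord i = 1%N; last by rewrite mul0r.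
apply/eqP; rewrite eqn_leq lt0n i0 andbT.
by rewrite -ltnS (leq_trans (ltn_ord i)).
Qed.

Lemma stage_Hex (i : 'I_n.+1) : (1 < i)%N -> \sum_j Hex rk i j * c j = c i ^+ 2 / 2.
Proof. by move=> /stages[h _]; rewrite h sum_Hex. Qed.

Lemma stage_Him (i : 'I_n.+1) : (1 < i)%N -> \sum_j Him rk i j * c j = c i ^+ 2 / 2.
Proof. by move=> /stages[_ h]; rewrite h sum_Him. Qed.

Lemma c_last : c ord_max = 1.
Proof.
by rewrite -row_Him -(order1_im ord1); apply: eq_bigr => j _; rewrite isa.
Qed.

End Tableau.

(** * Reference stages and the error of one mode *)
Section Reference.
Variables (R : realType) (V : vectType R).

(** Vector identities are checked after applying an arbitrary linear functional,
    which turns them into identities between real numbers. *)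
Definition is_functional (phi : V -> R) : Type :=
  (forall x y : V, phi (x + y) = phi x + phi y) *
  (forall x : V, phi (- x) = - phi x) *
  (forall a (x : V), phi (a *: x) = a * phi x).

Lemma vect_ext (x y : V) :
  (forall phi : V -> R, is_functional phi -> phi x = phi y) -> x = y.
Proof.
move=> h; rewrite (coord_vbasis (memvf x)) (coord_vbasis (memvf y)).
apply: eq_bigr => i _; congr (_ *: _); apply: h; split=> [|a z]; last first.
  by rewrite linearZ.
by split=> [z w|z]; rewrite ?linearD ?linearN.
Qed.

Variables (f g : V -> V -> R).
Hypotheses (psdf : psd_form f) (psdg : psd_form g)
  (deff : forall x, f x x = 0 -> x = 0).
Variables (K Q Pi : {linear V -> V}) (lam CK CQ : R).
Hypotheses (lam0 : 0 < lam) (CK0 : 0 <= CK) (CQ0 : 0 <= CQ)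
  (skewK : forall x, f x (K x) = 0)
  (boundK : forall x, nrm f (K x) <= CK * nrm f x)
  (PiPi : forall x, Pi (Pi x) = Pi x) (QPi : forall x, Q (Pi x) = Q x)
  (PiQ : forall x, Pi (Q x) = Q x) (nrmPi : forall x, nrm f (Pi x) <= nrm f x)
  (boundQ : forall x, nrm f (Q x) <= CQ * nrm f x)
  (dissQ : forall x y, f x (Q y) = - g x y)
  (gPi : forall x, lam * f (Pi x) (Pi x) <= g x x).

Definition resolvent_op a (x : V) : V := x - a *: Q x.
Lemma resolvent_op_linear a : linear (resolvent_op a).
Proof.
move=> k x y; rewrite /resolvent_op (linearP Q) scalerDr scalerA (mulrC a) -scalerA.
by rewrite opprD addrACA -scalerBr.
Qed.
HB.instance Definition _ a := GRing.isLinear.Build R _ _ _ _ (resolvent_op_linear a).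

(** The form g being nonnegative, x - a Q x is at least as long as x, whatever the
    size of a: this inverts an implicit stage uniformly in eps. *)
Lemma resolvent a : 0 <= a -> exists Th : {linear V -> V},
  forall x, Th x = a *: Q (Th x) + x /\ nrm f (Th x) <= nrm f x.
Proof.
move=> a0.
have contr x : nrm f x <= nrm f (resolvent_op a x).
  have h : nrm f x ^+ 2 <= nrm f x * nrm f (resolvent_op a x).
    apply: le_trans (_ : _ <= f x (resolvent_op a x)) _; last first.
      exact: le_trans (ler_norm _) (form_le_nrm psdf _ _).
    rewrite /resolvent_op (formDr psdf) (formNr psdf) (formZr psdf) dissQ nrm_sqr //.
    by rewrite mulrN opprK lerDl mulr_ge0 // (form_ge0 psdg).
  have [->|nz] := eqVneq (nrm f x) 0; first exact: nrm_ge0.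
  by move: h; rewrite expr2 ler_pM2l // lt_def nz nrm_ge0.
have [x hx|G hG] := @linear_inverse _ _ (resolvent_op a).
  apply: deff; rewrite -(nrm_sqr psdf); apply/eqP; rewrite sqrf_eq0 eq_le nrm_ge0.
  by have := contr x; rewrite hx nrm0 // => ->.
exists G => x; split; last by rewrite -{2}(hG x).
by rewrite -{3}(hG x) /resolvent_op addrC subrK.
Qed.

Variables (n : nat) (rk : imex_tableau R n.+1).
Hypotheses (tCK : type_CK rk) (isa : ISA rk) (ord1 : order1 rk) (ord2 : order2 rk)
  (ord3 : order3 rk) (c_eq : forall i, cim rk i = cex rk i)
  (stages : stage_order rk) (vanish : vanishing_coefficients rk).
Local Notation c := (cim rk).
Local Notation He := (Hex rk).
Local Notation Hi := (Him rk).
Variables (M : 'M[R]_n.+1) (v : 'cV[R]_n.+1).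
Hypotheses (M1 : cond_M1 rk M) (M2 : cond_M2 M)
  (v0 : v != 0) (Hv : Hi *m v = 0) (vl : v ord_max 0 = 0).

Definition stage2 : 'I_n.+1 := inord 1.
Lemma stage2E : nat_of_ord stage2 = 1%N.
Proof. by rewrite inordK // ltnS ltnW // (at_least_three_stages ord2 c_eq vanish). Qed.

Lemma weighted_reference (a : 'I_n.+1 -> R) (u : 'I_n.+1 -> V) dt d0 d1 d2 eta th :
  (forall j, u j = d0 + (c j * dt) *: d1 + (c j ^+ 2 * dt ^+ 2 / 2) *: d2 + eta j
             + (j == stage2)%:R *: th) ->
  \sum_j a j *: u j = (\sum_j a j) *: d0 + ((\sum_j a j * c j) * dt) *: d1 +
    ((\sum_j a j * c j ^+ 2) * dt ^+ 2 / 2) *: d2 + \sum_j a j *: eta j + a stage2 *: th.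
Proof.
move=> hu.
have -> : a stage2 *: th = \sum_j (a j * (j == stage2)%:R) *: th.
  rewrite (bigD1 stage2) //= eqxx mulr1 big1 ?addr0 // => j ji.
  by rewrite (negbTE ji) mulr0 scale0r.
rewrite !mulr_suml !scaler_suml -!big_split /=; apply: eq_bigr => j _.
by rewrite hu !scalerDr !scalerA !mulrA.
Qed.

(** The moments of the rows of the tableau against the powers of the abscissae which
    enter the Taylor expansion of the stages. *)
Definition ex_moment1 i := \sum_j He i j * c j.
Definition im_moment1 i := \sum_j Hi i j * c j.
Definition ex_moment2 i := \sum_j He i j * c j ^+ 2.
Definition im_moment2 i := \sum_j Hi i j * c j ^+ 2.

(** What the quadratic Taylor polynomials leave in stage i when eps^-1 Q is
    eliminated by the differential equation: it contains no negative power of eps.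
    The coefficients of dt^2 are the two stage order conditions. *)
Definition stage_defect (kappa dt : R) i (d1 d2 d3 : V) : V :=
  (dt ^+ 2) *: (((ex_moment1 i - im_moment1 i) * kappa) *: K d1 + (im_moment1 i - c i ^+ 2 / 2) *: d2) +
  (dt ^+ 3 / 2) *: (((ex_moment2 i - im_moment2 i) * kappa) *: K d2 + im_moment2 i *: d3).

Lemma stage_defectB kappa dt i a1 a2 a3 b1 b2 b3 :
  stage_defect kappa dt i (a1 - b1) (a2 - b2) (a3 - b3) =
  stage_defect kappa dt i a1 a2 a3 - stage_defect kappa dt i b1 b2 b3.
Proof.
apply: vect_ext => phi phiE; rewrite /stage_defect.
by rewrite !(linearB K) !phiE; ring.
Qed.

Lemma defect_identity (eps kappa dt : R) i d0 d1 d2 d3 : eps != 0 ->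
  d1 = kappa *: K d0 + eps^-1 *: Q d0 -> d2 = kappa *: K d1 + eps^-1 *: Q d1 ->
  d3 = kappa *: K d2 + eps^-1 *: Q d2 ->
  d0 + (dt * kappa) *: K (c i *: d0 + (ex_moment1 i * dt) *: d1 + (ex_moment2 i * dt ^+ 2 / 2) *: d2)
     + (dt / eps) *: Q (c i *: d0 + (im_moment1 i * dt) *: d1 + (im_moment2 i * dt ^+ 2 / 2) *: d2) =
  d0 + (c i * dt) *: d1 + (c i ^+ 2 * dt ^+ 2 / 2) *: d2
     + stage_defect kappa dt i d1 d2 d3.
Proof.
move=> eps0 h1 h2 h3; apply: vect_ext => phi phiE; rewrite /stage_defect.
have q d d' : d' = kappa *: K d + eps^-1 *: Q d ->
    phi (Q d) = eps * (phi d' - kappa * phi (K d)).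
  by move=> ->; rewrite !phiE; field.
rewrite !(linearD K, linearZZ K, linearD Q, linearZZ Q) /=.
rewrite !phiE (q _ _ h1) (q _ _ h2) (q _ _ h3).
by field.
Qed.

Definition defect_coef2 i := `|ex_moment1 i - im_moment1 i| * CK + `|im_moment1 i - c i ^+ 2 / 2|.
Definition defect_coef3 i := `|ex_moment2 i - im_moment2 i| * CK + `|im_moment2 i|.

Lemma stage_defect_bound kappa dt G i d1 d2 d3 : 0 <= kappa -> 0 <= dt -> 0 <= G ->
  nrm f d1 <= G * (1 + kappa) -> nrm f d2 <= G * (1 + kappa) ^+ 2 ->
  nrm f d3 <= G * (1 + kappa) ^+ 3 ->
  nrm f (stage_defect kappa dt i d1 d2 d3) <=
    defect_coef2 i * (dt ^+ 2 * (G * (1 + kappa) ^+ 2)) + defect_coef3 i * (dt ^+ 3 * (G * (1 + kappa) ^+ 3)).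
Proof.
move=> kappa0 dt0 G0 h1 h2 h3; set k := 1 + kappa in h1 h2 h3 *.
have k0 : 0 <= k by rewrite addr_ge0.
have kk : kappa <= k by rewrite /k lerDr.
have Kb (a : R) d B : nrm f d <= B -> nrm f ((a * kappa) *: K d) <= `|a| * CK * (k * B).
  move=> hd; rewrite nrmZ // normrM (ger0_norm kappa0) -!mulrA ler_wpM2l //.
  rewrite mulrCA ler_pM ?nrm_ge0 //.
  by apply: le_trans (boundK _) _; rewrite ler_wpM2l.
rewrite /stage_defect; apply: le_trans (nrmD psdf _ _) _; apply: lerD.
  rewrite nrmZ // ger0_norm ?exprn_ge0 // [leRHS]mulrCA ler_wpM2l ?exprn_ge0 //.
  apply: le_trans (nrmD psdf _ _) _; rewrite /defect_coef2 [leRHS]mulrDl; apply: lerD.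
    apply: le_trans (Kb _ _ _ h1) _; rewrite le_eqVlt; apply/orP; left.
    by apply/eqP; ring.
  by rewrite nrmZ // ler_wpM2l.
rewrite nrmZ // ger0_norm ?divr_ge0 ?exprn_ge0 //.
have d30 : 0 <= dt ^+ 3 by rewrite exprn_ge0.
have d3h : dt ^+ 3 / 2 <= dt ^+ 3 by lra.
rewrite [leRHS]mulrCA ler_pM ?nrm_ge0 ?divr_ge0 //.
apply: le_trans (nrmD psdf _ _) _; rewrite /defect_coef3 [leRHS]mulrDl; apply: lerD.
  apply: le_trans (Kb _ _ _ h2) _; rewrite le_eqVlt; apply/orP; left.
  by apply/eqP; ring.
by rewrite nrmZ // ler_wpM2l.
Qed.

(** The reference stages u are the quadratic Taylor polynomials, corrected by eta in
    all stages and by th in the second one.  The arguments d1, d2, d3 are the first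
    three time derivatives at the beginning of the step; eta is additive in them so
    that its increment in time is governed by theirs.  The only defect left is the
    transport of eta, of order dt * k * dt^3. *)
Lemma step_reference (Cc : R) : 0 <= Cc -> exists2 C, 0 <= C &
  forall eps kappa dt : R, 0 < eps -> 0 <= kappa -> 0 < dt ->
  dt * (1 + kappa) ^+ 2 <= Cc ->
  exists (eta : V -> V -> V -> 'I_n.+1 -> V) (th : V -> V -> V -> V),
  [/\ forall a1 a2 a3 b1 b2 b3 i, eta (a1 - b1) (a2 - b2) (a3 - b3) i =
        eta a1 a2 a3 i - eta b1 b2 b3 i,
      forall G d1 d2 d3 i, 0 <= G -> nrm f d1 <= G * (1 + kappa) ->
        nrm f d2 <= G * (1 + kappa) ^+ 2 -> nrm f d3 <= G * (1 + kappa) ^+ 3 ->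
        nrm f (eta d1 d2 d3 i) <= C * (dt ^+ 3 * (G * (1 + kappa) ^+ 3)),
      forall d1 d2 d3, \sum_j bim rk j *: Q (eta d1 d2 d3 j) = 0 &
      forall d0 d1 d2 d3 (u : 'I_n.+1 -> V),
        d1 = kappa *: K d0 + eps^-1 *: Q d0 -> d2 = kappa *: K d1 + eps^-1 *: Q d1 ->
        d3 = kappa *: K d2 + eps^-1 *: Q d2 ->
        (forall i, u i = d0 + (c i * dt) *: d1 + (c i ^+ 2 * dt ^+ 2 / 2) *: d2
           + eta d1 d2 d3 i + (i == stage2)%:R *: th d1 d2 d3) ->
        forall i, u i = (d0 + eta d1 d2 d3 ord0) + (dt * kappa) *: K (mxcomb He u i)
          + (dt / eps) *: Q (mxcomb Hi u i)
          - (dt * kappa) *: K (mxcomb He (eta d1 d2 d3) i)].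
Proof.
move=> Cc0; have [pH rH] := M1.
have b1 := order1_im ord1.
have H0 := Him_row0 tCK.
have [C C0 hC] := corrector psdf psdg deff lam0 CQ0 PiPi QPi PiQ nrmPi boundQ dissQ
  gPi pH rH M2 v0 Hv vl isa b1 H0.
have coef2_ge0 i : 0 <= defect_coef2 i by rewrite addr_ge0 // mulr_ge0.
have coef3_ge0 i : 0 <= defect_coef3 i by rewrite addr_ge0 // mulr_ge0.
have [ss sE] : exists ss, ss = \sum_i defect_coef3 i by eexists.
pose C1 := ss + mxsize He * CK * (defect_coef2 stage2 + defect_coef3 stage2 * (1 + Cc)).
have ss0 : 0 <= ss by rewrite sE sumr_ge0.
have C10 : 0 <= C1.
  by rewrite addr_ge0 // !mulr_ge0 ?mxsize_ge0 // addr_ge0 // mulr_ge0 // addr_ge0.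
exists (C * (n.+1%:R * C1)); first by rewrite mulr_ge0 // mulr_ge0.
move=> eps kappa dt eps0 kappa0 dt0 dtk.
have z0 : 0 < dt / eps by rewrite divr_gt0.
have [S hS] := hC _ z0.
have a0 : 0 <= dt / eps * Hi stage2 stage2 by rewrite mulr_ge0 ?(ltW z0) ?Him_diag.
have [Th hTh] := resolvent a0.
pose th d1 d2 d3 := Th (stage_defect kappa dt stage2 d1 d2 d3).
(* The first stage is exact and the second one is solved by th; the later stages also
   see th through its transport. *)
pose rdef d1 d2 d3 : {ffun 'I_n.+1 -> V} :=
  [ffun i : 'I_n.+1 => if (i <= 1)%N then 0 else stage_defect kappa dt i d1 d2 d3 +
     (dt * kappa * He i stage2) *: K (th d1 d2 d3)].
have rdef0 d1 d2 d3 : rdef d1 d2 d3 ord0 = 0 by rewrite ffunE.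
exists (fun d1 d2 d3 => (S (rdef d1 d2 d3) : 'I_n.+1 -> V)), th; split.
- move=> a1 a2 a3 b1' b2' b3' i.
  have -> : rdef (a1 - b1') (a2 - b2') (a3 - b3') =
     rdef a1 a2 a3 - rdef b1' b2' b3'.
    apply/ffunP => j; rewrite !ffunE; case: ifP => _; first by rewrite subr0.
    by rewrite /th !stage_defectB (linearB Th) (linearB K) scalerBr [LHS]addrACA -opprD.
  by rewrite (linearB S) !ffunE.
- move=> G d1 d2 d3 i G0 h1 h2 h3; have [_ _ hb] := hS _ (rdef0 d1 d2 d3).
  apply: le_trans (hb i) _; rewrite -mulrA ler_wpM2l // -mulrA.
  set X3 := dt ^+ 3 * _.
  have k0 : 0 <= 1 + kappa by rewrite addr_ge0.
  have X30 : 0 <= X3 by rewrite !mulr_ge0 ?exprn_ge0 // ltW.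
  have sb := fun j => @stage_defect_bound kappa dt G j d1 d2 d3 kappa0 (ltW dt0) G0 h1 h2 h3.
  have dtk1 : dt * (1 + kappa) <= Cc.
    apply: le_trans dtk; rewrite expr2 ler_wpM2l ?(ltW dt0) // ler_peMl //.
    by rewrite lerDl.
  have thb : nrm f (th d1 d2 d3) <= (defect_coef2 stage2 + defect_coef3 stage2 * (1 + Cc)) *
       (dt ^+ 2 * (G * (1 + kappa) ^+ 2)).
    apply: le_trans (proj2 (hTh _)) _; apply: le_trans (sb stage2) _.
    rewrite [leRHS]mulrDl lerD2l -[leRHS]mulrA ler_wpM2l //.
    set w := dt ^+ 2 * _.
    have w0 : 0 <= w by rewrite !mulr_ge0 ?exprn_ge0 // ltW.
    have -> : dt ^+ 3 * (G * (1 + kappa) ^+ 3) = dt * (1 + kappa) * w.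
      by rewrite /w; ring.
    by rewrite ler_wpM2r //; apply: le_trans dtk1 _; rewrite lerDr.
  have rb j : nrm f (rdef d1 d2 d3 j) <= C1 * X3.
    rewrite ffunE; case: ltnP => j1; last by rewrite nrm0 // mulr_ge0.
    apply: le_trans (nrmD psdf _ _) _; rewrite [leRHS]mulrDl; apply: lerD.
      apply: le_trans (sb j) _.
      have -> : defect_coef2 j = 0.
        rewrite /defect_coef2 /ex_moment1 /im_moment1 (stage_Hex stages j1) (stage_Him stages j1) !subrr.
        by rewrite normr0 mul0r addr0.
      rewrite mul0r add0r ler_wpM2r // sE (bigD1 j) //= lerDl sumr_ge0 //.
    rewrite nrmZ // normrM normrM (ger0_norm kappa0) (gtr0_norm dt0).
    have heb : `|He j stage2| <= mxsize He.
      rewrite /mxsize (bigD1 j) //= (bigD1 stage2) //= -addrA lerDl.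
      by rewrite addr_ge0 // sumr_ge0 // => l _; rewrite sumr_ge0.
    apply: (@le_trans _ _ (dt * (1 + kappa) * mxsize He *
       (CK * ((defect_coef2 stage2 + defect_coef3 stage2 * (1 + Cc)) * (dt ^+ 2 * (G * (1 + kappa) ^+ 2)))))).
      apply: ler_pM; rewrite ?nrm_ge0 ?mulr_ge0 // ?(ltW dt0) //.
        apply: ler_pM => //; rewrite ?mulr_ge0 ?(ltW dt0) //.
        by rewrite ler_wpM2l ?(ltW dt0) // lerDr.
      by apply: le_trans (boundK _) _; rewrite ler_wpM2l.
    by rewrite /X3 le_eqVlt; apply/orP; left; apply/eqP; ring.
  apply: le_trans (ler_sum _ (fun j _ => rb j)) _.
  by rewrite sumr_const card_ord -[leLHS]mulr_natl.
- by move=> d1 d2 d3; have [_ h _] := hS _ (rdef0 d1 d2 d3).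
move=> d0 d1 d2 d3 u h1 h2 h3 hu i.
set eta := S (rdef d1 d2 d3) in hu *.
have [heta _ _] := hS _ (rdef0 d1 d2 d3); rewrite -/eta in heta.
have e0 : eps != 0 by rewrite gt_eqF.
have D := @defect_identity eps kappa dt i d0 d1 d2 d3 e0 h1 h2 h3.
have WE := weighted_reference (He i) hu; have WI := weighted_reference (Hi i) hu.
rewrite -/(mxcomb He u i) -/(mxcomb He eta i) (row_Hex c_eq) -/(ex_moment1 i) -/(ex_moment2 i) in WE.
rewrite -/(mxcomb Hi u i) -/(mxcomb Hi eta i) (row_Him rk) -/(im_moment1 i) -/(im_moment2 i) in WI.
have key : stage_defect kappa dt i d1 d2 d3 + (dt * kappa * He i stage2) *: K (th d1 d2 d3)
   + (dt / eps * Hi i stage2) *: Q (th d1 d2 d3) =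
   (i == stage2)%:R *: th d1 d2 d3 + rdef d1 d2 d3 i.
  rewrite ffunE; have [i_st2|i_st2] := eqVneq i stage2.
    rewrite i_st2 stage2E leqnn addr0 scale1r (Hex_trig rk) // mulr0 scale0r addr0.
    by rewrite [RHS](proj1 (hTh _)) addrC.
  have [i0|i0] := leqP i 1.
    have -> : i = ord0.
      apply/val_inj/eqP; rewrite -leqn0 -ltnS ltn_neqAle i0 andbT.
      by apply: contra i_st2 => /eqP h; apply/eqP/val_inj; rewrite /= h stage2E.
    rewrite (Hex_row0 rk) H0 !mulr0 !scale0r !addr0 /stage_defect.
    have -> : ex_moment1 ord0 = 0 by rewrite /ex_moment1 big1 // => j _; rewrite Hex_row0 mul0r.
    have -> : ex_moment2 ord0 = 0 by rewrite /ex_moment2 big1 // => j _; rewrite Hex_row0 mul0r.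
    have -> : im_moment1 ord0 = 0 by rewrite /im_moment1 big1 // => j _; rewrite H0 mul0r.
    have -> : im_moment2 ord0 = 0 by rewrite /im_moment2 big1 // => j _; rewrite H0 mul0r.
    rewrite (c_ord0 c_eq) expr0n mul0r subrr mul0r !scale0r !addr0.
    by rewrite !scaler0 addr0.
  by rewrite (vanish.2 i stage2 i0 stage2E) mulr0 !scale0r addr0 add0r.
rewrite WE WI {1}hu heta; move: D key.
set ka := c i *: d0 + _ + _; set b0 := c i *: d0 + _ + _.
set t := th d1 d2 d3; set q := mxcomb He eta i; set w := mxcomb Hi eta i.
clearbody ka b0 t q w; move=> D key.
rewrite !(linearD K) !(linearD Q) (linearZZ K) (linearZZ Q).
apply: vect_ext => phi phiE.
have := congr1 phi D; have := congr1 phi key; rewrite !phiE.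
lra.
Qed.

(** [D j l] is the j-th time derivative of the mode at the l-th time.  The stability
    estimate is applied to the difference between the stages and the reference
    stages.  The first stage of this difference is the error shifted by the corrector
    of the current step, so one step also has to replace that corrector by the next
    one, at the price of its time increment. *)
Lemma mode_error (Cc T : R) : 0 <= Cc -> 0 <= T -> exists c0 C : R,
  [/\ 0 < c0, 0 <= C & forall (eps kappa dt F : R) (D : nat -> nat -> V)
    (Y : nat -> V) (Ys : nat -> 'I_n.+1 -> V),
  0 < eps -> 0 <= kappa -> 0 < dt -> dt <= c0 -> dt * (1 + kappa) ^+ 2 <= Cc ->
  0 <= F ->
  (forall k j, D j.+1 k = kappa *: K (D j k) + eps^-1 *: Q (D j k)) ->
  (forall k j, (j <= 4)%N -> nrm f (D j k) <= F * (1 + kappa) ^+ j) ->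
  (forall k j, (j <= 3)%N ->
     nrm f (D j k - D j k.+1) <= dt * F * (1 + kappa) ^+ j.+1) ->
  (forall k, nrm f (D 0%N k + dt *: D 1%N k + (dt ^+ 2 / 2) *: D 2%N k
     + (dt ^+ 3 / 6) *: D 3%N k - D 0%N k.+1) <= dt ^+ 4 * (F * (1 + kappa) ^+ 4)) ->
  Y 0%N = D 0%N 0%N ->
  (forall k i, Ys k i = Y k + (dt * kappa) *: K (mxcomb He (Ys k) i)
      + (dt / eps) *: Q (mxcomb Hi (Ys k) i)) ->
  (forall k, Y k.+1 = Y k + (dt * kappa) *: K (\sum_j bex rk j *: Ys k j)
      + (dt / eps) *: Q (\sum_j bim rk j *: Ys k j)) ->
  forall k, k%:R * dt <= T ->
    nrm f (Y k - D 0%N k) <= C * (dt ^+ 3 * (F * (1 + kappa) ^+ 4))].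
Proof.
move=> Cc0 T0; have [Cr Cr0 hCr] := step_reference Cc0.
have [pH rH] := M1.
have gam0 : \sum_j (bex rk j - He ord_max j) = 0.
  by rewrite sumrB (order1_ex ord1) (row_Hex c_eq) (c_last isa ord1) subrr.
have [c0 [Cs [c0_gt0 Cs0 hCs]]] :=
  @stability_step R V f g psdf psdg K Q CK CK0 skewK boundK dissQ n M He Hi
    (fun j => bex rk j - He ord_max j) Cc pH M2 gam0 Cc0.
pose be := \sum_j `|bex rk j|.
have be0 : 0 <= be by apply: sumr_ge0.
pose Cn := n.+1%:R * Cr.
have Cn0 : 0 <= Cn by rewrite mulr_ge0.
(* Cp measures the local error in units of dt * X below: the Taylor remainder, the
   increment of the corrector, and its transport in the stages and in the update. *)
pose Cp := 1 + Cr + CK * (be + mxsize He) * Cn.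
have Cp0 : 0 <= Cp by rewrite !addr_ge0 // !mulr_ge0 // addr_ge0 // mxsize_ge0.
pose Cx := expR (Cs * T) * (Cr ^+ 2 + Cs * Cp ^+ 2 * T).
have Cx0 : 0 <= Cx.
  by rewrite mulr_ge0 ?expR_ge0 // addr_ge0 ?sqr_ge0 // !mulr_ge0 // sqr_ge0.
exists c0, (Num.sqrt Cx + Cr); split=> //; first by rewrite addr_ge0 // sqrtr_ge0.
move=> eps kappa dt F D Y Ys eps0 kappa0 dt0 dtc dtk F0 HD HF HdF HT HY0 HYs HY.
have k0 : 0 <= 1 + kappa by rewrite addr_ge0.
have k1 : 1 <= 1 + kappa by rewrite lerDl.
have [eta [th [etaB eta_b eta_Q eta_st]]] := hCr _ _ _ eps0 kappa0 dt0 dtk.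
pose et m := eta (D 1%N m) (D 2%N m) (D 3%N m).
pose X := dt ^+ 3 * (F * (1 + kappa) ^+ 4).
have X0 : 0 <= X by rewrite !mulr_ge0 ?exprn_ge0 // ltW.
have x34 : dt ^+ 3 * (F * (1 + kappa) ^+ 3) <= X.
  rewrite ler_wpM2l ?exprn_ge0 ?(ltW dt0) // ler_wpM2l // [leRHS]exprS.
  by rewrite ler_peMl ?exprn_ge0.
have et_b m i : nrm f (et m i) <= Cr * (dt ^+ 3 * (F * (1 + kappa) ^+ 3)).
  apply: eta_b => //; rewrite ?HF //; by have := HF m 1%N isT; rewrite expr1.
have et_bX m i : nrm f (et m i) <= Cr * X.
  by apply: le_trans (et_b m i) _; rewrite ler_wpM2l.
have et_d m i : nrm f (et m i - et m.+1 i) <= Cr * (dt * X).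
  rewrite -etaB; have G0 : 0 <= dt * F * (1 + kappa) by rewrite !mulr_ge0 // ltW.
  apply: le_trans (eta_b _ _ _ _ i G0 _ _ _) _.
  - by have := HdF m 1%N isT; rewrite expr2 mulrA.
  - by have := HdF m 2%N isT; rewrite exprS mulrA.
  - by have := HdF m 3%N isT; rewrite exprS mulrA.
  by rewrite /X le_eqVlt; apply/orP; left; apply/eqP; ring.
pose u m i := D 0%N m + (c i * dt) *: D 1%N m + (c i ^+ 2 * dt ^+ 2 / 2) *: D 2%N m
  + et m i + (i == stage2)%:R *: th (D 1%N m) (D 2%N m) (D 3%N m).
have hu m := eta_st _ _ _ _ (u m) (HD m 0%N) (HD m 1%N) (HD m 2%N) (fun i => erefl).
pose E m i := Ys m i - u m i.
pose En m := Y m - D 0%N m - et m ord0.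
have st2_0 : (ord0 == stage2 :> 'I_n.+1) = false.
  by apply/negbTE/eqP => /(congr1 val)/=; rewrite stage2E.
have u0 m : u m ord0 = D 0%N m + et m ord0.
  by rewrite /u (c_ord0 c_eq) st2_0 mul0r expr0n !mul0r !scale0r !addr0.
have Ys0 m : Ys m ord0 = Y m.
  rewrite HYs /mxcomb big1 => [|j _]; last by rewrite (Hex_row0 rk) scale0r.
  rewrite big1 => [|j _]; last by rewrite (Him_row0 tCK) scale0r.
  by rewrite (linear0 K) (linear0 Q) !scaler0 !addr0.
have E0 m : E m ord0 = En m by rewrite /E Ys0 u0 /En opprD addrA.
have Est m i : E m i = E m ord0 + (dt * kappa) *: K (mxcomb He (E m) i)
    + (dt / eps) *: Q (mxcomb Hi (E m) i)
    + (dt * kappa) *: K (mxcomb He (et m) i).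
  rewrite E0 {1}/E HYs (hu m i) -/(et m) !mxcombB !(linearB K) !(linearB Q) /En.
  by apply: vect_ext => phi phiE; rewrite !phiE; lra.
pose xx m := u m ord_max + (dt * kappa) *: K (\sum_j (bex rk j - He ord_max j) *: u m j)
   - D 0%N m.+1 - et m.+1 ord0.
have sgam (y : 'I_n.+1 -> V) : \sum_j (bex rk j - He ord_max j) *: y j =
    \sum_j bex rk j *: y j - mxcomb He y ord_max.
  by rewrite /mxcomb -sumrB; apply: eq_bigr => j _; rewrite scalerBl.
have sbim (y : 'I_n.+1 -> V) : mxcomb Hi y ord_max = \sum_j bim rk j *: y j.
  by apply: eq_bigr => j _; rewrite isa.
have En1 m : En m.+1 = E m ord_max +
    (dt * kappa) *: K (\sum_j (bex rk j - He ord_max j) *: E m j) + xx m.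
  have -> : \sum_j (bex rk j - He ord_max j) *: E m j =
    \sum_j (bex rk j - He ord_max j) *: Ys m j -
    \sum_j (bex rk j - He ord_max j) *: u m j.
    by rewrite -sumrB; apply: eq_bigr => j _; rewrite scalerBr.
  rewrite /En HY (sgam (Ys m)) /E (HYs m ord_max) sbim /xx.
  rewrite !(linearB K).
  by apply: vect_ext => phi phiE; rewrite !phiE; lra.
have bex1 : bex rk stage2 = 0 by apply: vanish.1; exact: stage2E.
have lm : (1 < (ord_max : 'I_n.+1))%N := at_least_three_stages ord2 c_eq vanish.
have bim1 : bim rk stage2 = 0 by rewrite -isa; apply: vanish.2 => //; exact: stage2E.
have sq3 b : osum2 b c c = \sum_j b j * c j ^+ 2.
  by apply: eq_bigr => j _; rewrite expr2 mulrA.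
(* The order conditions turn the update of the reference stages into the cubic Taylor
   polynomial; the second stage has zero weight in it, and the implicit weighted sum
   of the corrector vanishes. *)
have xE m : xx m = (D 0%N m + dt *: D 1%N m + (dt ^+ 2 / 2) *: D 2%N m
     + (dt ^+ 3 / 6) *: D 3%N m - D 0%N m.+1)
     + (dt * kappa) *: K (\sum_j bex rk j *: et m j)
     - (dt * kappa) *: K (mxcomb He (et m) ord_max) + (et m ord0 - et m.+1 ord0).
  have WE := weighted_reference (bex rk) (fun i => erefl (u m i)).
  have WI := weighted_reference (bim rk) (fun i => erefl (u m i)).
  rewrite (order1_ex ord1) bex1 scale0r addr0 -/(osum1 (bex rk) c) (order2_ei ord2)
    -sq3 (order3_eii ord3) scale1r in WE.
  rewrite (order1_im ord1) bim1 scale0r addr0 -/(osum1 (bim rk) c) (order2_ii ord2)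
    -sq3 (order3_iii ord3) scale1r in WI.
  rewrite /xx (hu m ord_max) sbim sgam (linearB K) WE WI !(linearD Q) !(linearD K).
  have eQ : Q (\sum_j bim rk j *: et m j) = 0.
    by rewrite linear_sum -[RHS](eta_Q (D 1%N m) (D 2%N m) (D 3%N m));
      apply: eq_bigr => j _; rewrite linearZ.
  rewrite eQ -/(et m) !(linearZZ K) !(linearZZ Q).
  apply: vect_ext => phi phiE.
  have q j : phi (Q (D j m)) = eps * (phi (D j.+1 m) - kappa * phi (K (D j m))).
    by rewrite HD !phiE; field; rewrite gt_eqF.
  have p0 : phi 0 = 0 by have := phiE.1.1 0 0; rewrite addr0 => h; lra.
  rewrite !phiE !q p0; field; by rewrite gt_eqF.
have dk0 : 0 <= dt * kappa by rewrite mulr_ge0 // ltW.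
have Set_b m : \sum_j nrm f (et m j) <= Cn * (dt ^+ 3 * (F * (1 + kappa) ^+ 3)).
  apply: le_trans (ler_sum _ (fun j _ => et_b m j)) _.
  by rewrite sumr_const card_ord -[leLHS]mulr_natl /Cn -!mulrA.
have Kb (y : V) w m : 0 <= w -> nrm f y <= w * \sum_j nrm f (et m j) ->
    nrm f ((dt * kappa) *: K y) <= CK * w * Cn * (dt * X).
  move=> w0 hy; rewrite nrmZ // ger0_norm //.
  have h1 : nrm f (K y) <= CK * (w * (Cn * (dt ^+ 3 * (F * (1 + kappa) ^+ 3)))).
    apply: le_trans (boundK _) _; rewrite ler_wpM2l //; apply: le_trans hy _.
    by rewrite ler_wpM2l.
  have h2 : dt * kappa <= dt * (1 + kappa) by rewrite ler_wpM2l ?(ltW dt0) // lerDr.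
  apply: le_trans (ler_pM dk0 (nrm_ge0 _ _) h2 h1) _.
  by rewrite /X le_eqVlt; apply/orP; left; apply/eqP; ring.
pose rho := Cp * (dt * X).
have dX0 : 0 <= dt * X by rewrite mulr_ge0 // ltW.
have eb m i : nrm f ((dt * kappa) *: K (mxcomb He (et m) i)) <= CK * mxsize He * Cn * (dt * X).
  by apply: (Kb _ _ m); [exact: mxsize_ge0|exact: nrm_mxcomb].
have bb m : nrm f ((dt * kappa) *: K (\sum_j bex rk j *: et m j)) <= CK * be * Cn * (dt * X).
  by apply: (Kb _ _ m) => //; exact: nrm_comb.
have eb_rho m i : nrm f ((dt * kappa) *: K (mxcomb He (et m) i)) <= rho.
  apply: le_trans (eb m i) _; rewrite /rho ler_wpM2r // /Cp.
  by have := mulr_ge0 (mulr_ge0 CK0 be0) Cn0; lra.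
have xb m : nrm f (xx m) <= rho.
  rewrite xE; apply: le_trans (nrmD psdf _ _) _.
  apply: le_trans (lerD (nrmB psdf _ _) (et_d m ord0)) _.
  apply: le_trans (lerD (lerD (nrmD psdf _ _) (eb m ord_max)) (lexx _)) _.
  apply: le_trans (lerD (lerD (lerD (HT m) (bb m)) (lexx _)) (lexx _)) _.
  have -> : dt ^+ 4 * (F * (1 + kappa) ^+ 4) = dt * X by rewrite /X; ring.
  by rewrite /rho /Cp le_eqVlt; apply/orP; left; apply/eqP; ring.
have tauc : (dt * kappa) ^+ 2 <= Cc * dt.
  rewrite exprMn expr2 -mulrA mulrC ler_wpM2r ?(ltW dt0) //.
  apply: le_trans dtk; rewrite ler_wpM2l ?(ltW dt0) // !expr2 ler_pM ?lerDr //.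
have rec m : f (En m.+1) (En m.+1) <= (1 + Cs * dt) * f (En m) (En m)
    + (Cs * (Cp * X) ^+ 2) * dt.
  have := hCs _ _ _ _ (E m) _ _ _ dk0 dt0 dtc tauc (ltW (divr_gt0 dt0 eps0))
    (eb_rho m) (xb m) (Est m) (En1 m).
  rewrite E0; congr (_ <= _ + _); rewrite /rho; field; by rewrite gt_eqF.
have fpos m : 0 <= f (En m) (En m) by apply: (form_ge0 psdf).
have B0 : 0 <= Cs * (Cp * X) ^+ 2 by rewrite mulr_ge0 // sqr_ge0.
have G := discrete_gronwall Cs0 B0 (ltW dt0) fpos rec.
move=> k kT; have f0 : f (En 0%N) (En 0%N) <= (Cr * X) ^+ 2.
  rewrite -(nrm_sqr psdf) /En HY0 subrr sub0r nrmN // !expr2.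
  by rewrite ler_pM ?nrm_ge0.
have kd0 : 0 <= k%:R * dt by rewrite mulr_ge0 // ltW.
have fk : f (En k) (En k) <= Cx * X ^+ 2.
  apply: le_trans (G k) _.
  apply: (@le_trans _ _ (expR (Cs * T) * ((Cr * X) ^+ 2 + Cs * (Cp * X) ^+ 2 * T))).
    apply: ler_pM; first exact: expR_ge0.
    - by apply: addr_ge0 => //; apply: mulr_ge0.
    - by rewrite ler_expR ler_wpM2l.
    - by apply: lerD => //; rewrite ler_wpM2l.
  by rewrite /Cx le_eqVlt; apply/orP; left; apply/eqP; ring.
have -> : Y k - D 0%N k = En k + et k ord0 by rewrite /En subrK.
apply: le_trans (nrmD psdf _ _) _; rewrite mulrDl lerD //.
rewrite /nrm; apply: le_trans (ler_wsqrtr fk) _.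
by rewrite sqrtrM // sqrtr_sqr ger0_norm.
Qed.

End Reference.

(** * Integrals over a period *)
Section PeriodIntegral.
Variable R : realType.
Local Notation mu := (@lebesgue_measure R).
Local Notation I := (@period_itv R).

Definition pint (f : R -> R) : R := \int[mu]_(x in I) f x.
Definition pintegrable (f : R -> R) : Prop := mu.-integrable I (EFin \o f).

Lemma Npi_lt_pi : - pi < pi :> R.
Proof. have := pi_gt0 R; lra. Qed.

Lemma measurable_period : measurable (I : set R).
Proof. exact: measurable_itv. Qed.
Hint Resolve measurable_period : core.

Lemma pintegrable_within f : {within I, continuous f} -> pintegrable f.
Proof. by move=> cf; apply: continuous_compact_integrable => //; exact: segment_compact. Qed.

Lemma pintegrable_continuous f : continuous f -> pintegrable f.
Proof. by move=> cf; apply: pintegrable_within; apply: continuous_subspaceT. Qed.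

Lemma pintegrableD f g : pintegrable f -> pintegrable g -> pintegrable (fun x => f x + g x).
Proof.
move=> hf hg; rewrite /pintegrable (_ : EFin \o _ = ((EFin \o f) \+ (EFin \o g))%E) //.
exact: integrableD.
Qed.

Lemma pintegrableZ a f : pintegrable f -> pintegrable (fun x => a * f x).
Proof.
move=> hf; rewrite /pintegrable (_ : EFin \o _ = (fun x => a%:E * (EFin \o f) x)%E) //.
exact: integrableZl.
Qed.

Lemma pintD f g : pintegrable f -> pintegrable g ->
  pint (fun x => f x + g x) = pint f + pint g.
Proof. by move=> hf hg; rewrite /pint RintegralD. Qed.

Lemma pintB f g : pintegrable f -> pintegrable g ->
  pint (fun x => f x - g x) = pint f - pint g.
Proof. by move=> hf hg; rewrite /pint RintegralB. Qed.

Lemma pintZ a f : pintegrable f -> pint (fun x => a * f x) = a * pint f.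
Proof. by move=> hf; rewrite /pint RintegralZl. Qed.

Lemma pint_cst a : pint (fun=> a) = a * (pi *+ 2).
Proof.
rewrite /pint Rintegral_cst //.
have e : mu I = (pi *+ 2)%:E.
  have := @lebesgue_measure_itv R `[- pi, pi].
  by rewrite /= lte_fin Npi_lt_pi -EFinD opprK mulr2n.
exact: (congr1 (fun z => a * fine z) e).
Qed.

Lemma eq_pint f g : (forall x, I x -> f x = g x) -> pint f = pint g.
Proof. by move=> fg; apply: eq_Rintegral => x /set_mem; apply: fg. Qed.

Lemma le_pint f g : pintegrable f -> pintegrable g -> (forall x, I x -> f x <= g x) ->
  pint f <= pint g.
Proof. by move=> hf hg fg; apply: le_Rintegral. Qed.

Lemma pint_ge0 f : (forall x, I x -> 0 <= f x) -> 0 <= pint f.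
Proof. by move=> h; apply: Rintegral_ge0. Qed.

Lemma pint_sum (T : Type) (s : seq T) (P : pred T) (f : T -> R -> R) :
  (forall i, P i -> pintegrable (f i)) ->
  pintegrable (fun x => \sum_(i <- s | P i) f i x) /\
  pint (fun x => \sum_(i <- s | P i) f i x) = \sum_(i <- s | P i) pint (f i).
Proof.
move=> hf; elim: s => [|i s [IH1 IH2]].
  have -> : (fun x => \sum_(i <- [::] | P i) f i x) = fun=> 0.
    by apply/funext => x; rewrite big_nil.
  split; first by apply: pintegrable_continuous => x; apply: cvg_cst.
  by rewrite big_nil pint_cst mul0r.
have E : (fun x => \sum_(j <- i :: s | P j) f j x) =
   fun x => (if P i then f i x else 0) + \sum_(j <- s | P j) f j x.
  by apply/funext => x; rewrite big_cons; case: ifP; rewrite ?add0r.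
case Pi : (P i) in E; rewrite E.
  split; first by apply: pintegrableD => //; apply: hf.
  by rewrite pintD ?big_cons ?Pi ?IH2 //; apply: hf.
rewrite (_ : (fun x => 0 + _) = fun x => \sum_(j <- s | P j) f j x); last first.
  by apply/funext => x; rewrite add0r.
by rewrite big_cons Pi.
Qed.

Lemma pint_derivative (F f : R -> R) : (forall x : R, is_derive x 1 F (f x)) ->
  continuous f -> pint f = F pi - F (- pi).
Proof.
move=> dF cf; rewrite /pint /Rintegral.
have dF1 (x : R) : derivable F x 1 by have [] := dF x.
have cF : continuous F.
  by move=> x; apply: differentiable_continuous; apply/derivable1_diffP.
have := @continuous_FTC2 R f F (- pi) pi Npi_lt_pi.
rewrite -/I => -> //.
- exact: continuous_subspaceT.
- split; first by move=> x _.
    by apply: cvg_at_right_filter; apply: cF.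
  by apply: cvg_at_left_filter; apply: cF.
- by move=> x _; rewrite derive1E; apply: derive_val.
Qed.

(** From a b <= a^2 + 1 for b in [0, 1]: it bounds Fourier coefficients by the L^2
    norm without Cauchy-Schwarz. *)
Lemma pint_sq_le (w h : R -> R) : pintegrable (fun x => w x * h x) ->
  pintegrable (fun x => w x ^+ 2) -> (forall x, `|h x| <= 1) ->
  `|pint (fun x => w x * h x)| <= pint (fun x => w x ^+ 2) + pi *+ 2.
Proof.
move=> iwh iw h1.
have b x : `|w x * h x| <= w x ^+ 2 + 1.
  rewrite normrM; have := h1 x; have := normr_ge0 (h x); have := normr_ge0 (w x).
  rewrite -[X in _ <= X + 1]real_normK ?num_real //.
  set p := `|w x|; set q := `|h x| => p0 q0 q1.
  have := sqr_ge0 (p - 1); nra.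
have i1 : pintegrable (fun x => w x ^+ 2 + 1).
  by apply: pintegrableD => //; apply: pintegrable_continuous => x; apply: cvg_cst.
have e : pint (fun x => w x ^+ 2 + 1) = pint (fun x => w x ^+ 2) + pi *+ 2.
  rewrite pintD // ?pint_cst ?mul1r //.
  by apply: pintegrable_continuous => x; apply: cvg_cst.
rewrite -e ler_norml; apply/andP; split.
  have -> : - pint (fun x => w x ^+ 2 + 1) = pint (fun x => -1 * (w x ^+ 2 + 1)).
    by rewrite pintZ // mulN1r.
  apply: le_pint => //; first exact: pintegrableZ.
  by move=> x _; have := b x; rewrite ler_norml mulN1r => /andP[].
by apply: le_pint => // x _; have := b x; rewrite ler_norml => /andP[].
Qed.

End PeriodIntegral.
#[global] Hint Resolve measurable_period : core.

Section Trig.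
Variable R : realType.
Local Notation I := (@period_itv R).

(** The integer multiple of pi is written as a difference m - n: the frequencies of
    products of trigonometric functions have this form, and may be negative. *)
Lemma periodic_half (F : R -> R) (m n : nat) (d : R) : periodic F (pi *+ 2) ->
  F ((m%:R - n%:R) * pi + d) = F ((m%:R - n%:R) * - pi + d).
Proof.
move=> pF; rewrite -[LHS](periodicn pF n) -[RHS](periodicn pF m).
by congr F; rewrite -(mulr_natr (pi *+ 2) n) -(mulr_natr (pi *+ 2) m); ring.
Qed.

Lemma cont_affine (c d : R) : continuous (fun x : R => c * x + d).
Proof.
move=> x; apply: cvgD; last exact: cvg_cst.
by apply: cvgM; [exact: cvg_cst|exact: cvg_id].
Qed.

Lemma is_derive_affine (c d x : R) : is_derive x 1 (fun y : R => c * y + d) c.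
Proof.
have -> : c = c *: (1 : R) + 0 by rewrite addr0 /GRing.scale /= mulr1.
have -> : (fun y : R => (c *: (1 : R) + 0) * y + d) = (c \*: id) + cst d.
  by apply/funext => y; rewrite /= !fctE addr0 /GRing.scale /= mulr1.
exact: is_deriveD.
Qed.

Lemma is_derive_sin_affine (c d x : R) :
  is_derive x 1 (fun y : R => sin (c * y + d)) (c * cos (c * x + d)).
Proof.
have := @is_derive1_comp R sin (fun y : R => c * y + d) x (cos (c * x + d)) c
  (is_derive_sin _) (is_derive_affine _ _ _).
by rewrite mulrC.
Qed.

Lemma is_derive_cos_affine (c d x : R) :
  is_derive x 1 (fun y : R => cos (c * y + d)) (- c * sin (c * x + d)).
Proof.
have := @is_derive1_comp R cos (fun y : R => c * y + d) x (- sin (c * x + d)) c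
  (is_derive_cos _) (is_derive_affine _ _ _).
by rewrite (_ : - sin (c * x + d) * c = - c * sin (c * x + d)) //; ring.
Qed.

Lemma cont_cos_affine (c d : R) : continuous (fun x : R => cos (c * x + d)).
Proof.
by move=> x; apply: continuous_comp; [exact: cont_affine|exact: continuous_cos].
Qed.

Lemma cont_sin_affine (c d : R) : continuous (fun x : R => sin (c * x + d)).
Proof.
by move=> x; apply: continuous_comp; [exact: cont_affine|exact: continuous_sin].
Qed.

Lemma pint_cos_affine (m n : nat) (d : R) : (m != n)%N ->
  pint (fun x => cos ((m%:R - n%:R) * x + d)) = 0.
Proof.
move=> mn; set c := m%:R - n%:R : R.
have c0 : c != 0 by rewrite subr_eq0 eqr_nat.
have h := pintZ c (pintegrable_continuous (@cont_cos_affine c d)).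
rewrite (pint_derivative (is_derive_sin_affine c d)) in h; last first.
  by move=> x; apply: cvgM; [exact: cvg_cst|exact: cont_cos_affine].
have e : sin (c * pi + d) = sin (c * - pi + d).
  exact: (periodic_half _ _ _ (@sinD2pi R)).
by move: h; rewrite e subrr => /esym/eqP; rewrite mulf_eq0 (negbTE c0) => /eqP.
Qed.

End Trig.

(** * Bessel's inequality for half-integer frequencies *)
Section Bessel.
Variable R : realType.
Local Notation I := (@period_itv R).
Variable x0 : R.

(** The numerators of the Dirichlet kernel centred at x0.  Any two of them have
    frequencies whose sum and difference are integers, hence they are orthogonal on
    the period although they are not periodic. *)
Definition half_sin (m : nat) (x : R) : R :=
  sin ((m%:R + 2^-1) * x + - ((m%:R + 2^-1) * x0)).

Lemma cont_half_sin m : continuous (half_sin m).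
Proof. exact: cont_sin_affine. Qed.

Lemma half_sin_mul m n (x : R) : half_sin m x * half_sin n x =
  2^-1 * cos ((m%:R - n%:R) * x + (m%:R - n%:R) * - x0) +
  (- 2^-1) * cos (((m + n).+1%:R - 0%:R) * x + ((m + n).+1%:R) * - x0).
Proof.
rewrite /half_sin; set a := _ * x + _; set b := _ * x + _.
have -> : (m%:R - n%:R) * x + (m%:R - n%:R) * - x0 = a - b.
  by rewrite /a /b; ring.
have -> : ((m + n).+1%:R - 0%:R) * x + ((m + n).+1%:R) * - x0 = a + b.
  by rewrite /a /b -natr1 natrD; field.
by clearbody a b; rewrite cosB cosD; field.
Qed.

Lemma pint_half_sin m n :
  pint (fun x => half_sin m x * half_sin n x) = (m == n)%:R * pi.
Proof.
have -> : (fun x => half_sin m x * half_sin n x) = (fun x =>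
    2^-1 * cos ((m%:R - n%:R) * x + (m%:R - n%:R) * - x0) +
    (- 2^-1) * cos (((m + n).+1%:R - 0%:R) * x + ((m + n).+1%:R) * - x0)).
  by apply/funext => x; rewrite half_sin_mul.
have i1 := pintegrable_continuous (@cont_cos_affine R (m%:R - n%:R) ((m%:R - n%:R) * - x0)).
have i2 := pintegrable_continuous (@cont_cos_affine R ((m + n).+1%:R - 0%:R) (((m + n).+1%:R) * - x0)).
rewrite pintD; [|exact: pintegrableZ|exact: pintegrableZ].
rewrite !pintZ // [X in _ + _ * X]pint_cos_affine // mulr0 addr0.
have [->|mn] := eqVneq m n; last by rewrite pint_cos_affine // mulr0 mul0r.
have -> : (fun x : R => cos ((n%:R - n%:R) * x + (n%:R - n%:R) * - x0)) = fun=> 1.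
  by apply/funext => x; rewrite subrr !mul0r addr0 cos0.
by rewrite pint_cst !mul1r mulr2n; field.
Qed.

Variable g : R -> R.
Hypothesis cg : {within I, continuous g}.

Definition hs_coef m := pint (fun x => g x * half_sin m x).
Definition residual M (x : R) := g x - \sum_(m < M) (hs_coef m / pi) * half_sin m x.

Lemma cont_residual M : {within I, continuous (residual M)}.
Proof.
elim: M => [|M IH].
  rewrite (_ : residual 0 = g) //; apply/funext => x.
  by rewrite /residual big_ord0 subr0.
rewrite (_ : residual M.+1 = fun x => residual M x - (hs_coef M / pi) * half_sin M x); last first.
  by apply/funext => x; rewrite /residual big_ord_recr /= opprD addrA.
move=> x; apply: cvgB; first exact: IH.
apply: cvgM; first exact: cvg_cst.
by have := @continuous_subspaceT _ _ I _ (@cont_half_sin M) x.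
Qed.

Lemma within_mul (u w : R -> R) : {within I, continuous u} ->
  {within I, continuous w} -> {within I, continuous (fun x => u x * w x)}.
Proof. by move=> hu hw x; apply: cvgM; [exact: hu|exact: hw]. Qed.

Lemma pint_residual M n : pint (fun x => residual M x * half_sin n x) =
  if (n < M)%N then 0 else hs_coef n.
Proof.
have ws m : {within I, continuous (half_sin m)}.
  by apply: continuous_subspaceT; apply: cont_half_sin.
elim: M => [|M IH].
  by congr pint; apply/funext => x; rewrite /residual big_ord0 subr0.
have -> : (fun x => residual M.+1 x * half_sin n x) = fun x =>
   residual M x * half_sin n x - (hs_coef M / pi) * (half_sin M x * half_sin n x).
  by apply/funext => x; rewrite /residual big_ord_recr /=; ring.
have i1 : pintegrable (fun x => half_sin M x * half_sin n x).
  by apply: pintegrable_within; apply: within_mul.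
have i2 : pintegrable (fun x => residual M x * half_sin n x).
  by apply: pintegrable_within; apply: within_mul => //; apply: cont_residual.
rewrite pintB //; last exact: pintegrableZ.
rewrite pintZ // IH pint_half_sin ltnS (leq_eqVlt n M) (eq_sym n M).
have [->|nM] := eqVneq M n; last by rewrite mul0r mulr0 subr0.
by rewrite ltnn mul1r divfK ?subrr // gt_eqF // pi_gt0.
Qed.

Lemma bessel_identity M : pint (fun x => residual M x ^+ 2) =
  pint (fun x => g x ^+ 2) - (\sum_(m < M) hs_coef m ^+ 2) / pi.
Proof.
elim: M => [|M IH].
  rewrite big_ord0 mul0r subr0; congr pint; apply/funext => x.
  by rewrite /residual big_ord0 subr0.
have ws m : {within I, continuous (half_sin m)}.
  by apply: continuous_subspaceT; apply: cont_half_sin.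
pose c := hs_coef M / pi.
have -> : (fun x => residual M.+1 x ^+ 2) = fun x =>
   (residual M x * residual M x + (- 2 * c) * (residual M x * half_sin M x))
   + c ^+ 2 * (half_sin M x * half_sin M x).
  by apply/funext => x; rewrite /residual big_ord_recr /= /c; ring.
have i1 : pintegrable (fun x => half_sin M x * half_sin M x).
  by apply: pintegrable_within; apply: within_mul.
have i2 : pintegrable (fun x => residual M x * half_sin M x).
  by apply: pintegrable_within; apply: within_mul => //; apply: cont_residual.
have i3 : pintegrable (fun x => residual M x * residual M x).
  by apply: pintegrable_within; apply: within_mul; apply: cont_residual.
rewrite pintD; [|by apply: pintegrableD => //; apply: pintegrableZ|exact: pintegrableZ].
rewrite pintD //; last exact: pintegrableZ.
rewrite !pintZ // pint_residual ltnn pint_half_sin eqxx mul1r.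
have -> : pint (fun x => residual M x * residual M x) = pint (fun x => residual M x ^+ 2).
  by congr pint; apply/funext => x; rewrite expr2.
have p0 : pi != 0 :> R by rewrite gt_eqF // pi_gt0.
by rewrite IH big_ord_recr /= /c; move: (@pi R) p0 => p p0; field.
Qed.

(** By the Bessel identity the squares of the coefficients have bounded partial
    sums, so the coefficients cannot all stay above delta.  Smallness of a single
    coefficient beyond N suffices below. *)
Lemma half_sin_coef_small (delta : R) N : 0 < delta ->
  exists2 m, (N <= m)%N & `|hs_coef m| < delta.
Proof.
move=> d0; apply: contrapT => h.
have big m : (N <= m)%N -> delta ^+ 2 <= hs_coef m ^+ 2.
  move=> Nm; rewrite -[leRHS]real_normK ?num_real // ler_pXn2r ?nnegrE ?(ltW d0) //.
  by rewrite leNgt; apply/negP => hm; apply: h; exists m.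
have bound M : \sum_(m < M) hs_coef m ^+ 2 <= pi * pint (fun x => g x ^+ 2).
  have : 0 <= pint (fun x => residual M x ^+ 2) by apply: pint_ge0 => x _; apply: sqr_ge0.
  rewrite bessel_identity subr_ge0 ler_pdivrMr ?pi_gt0 // mulrC //.
have low K : K%:R * delta ^+ 2 <= \sum_(m < N + K) hs_coef m ^+ 2.
  elim: K => [|K IH]; first by rewrite mul0r sumr_ge0 // => i _; apply: sqr_ge0.
  rewrite addnS big_ord_recr /= -natr1 mulrDl mul1r lerD // big //.
  exact: leq_addr.
set B := pi * _ in bound.
have d2 : 0 < delta ^+ 2 by rewrite exprn_gt0.
have := Num.Theory.truncnS_gt (B / delta ^+ 2); rewrite ltr_pdivrMr // => hB.
by have := lt_le_trans hB (le_trans (low _) (bound _)); rewrite ltxx.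
Qed.

End Bessel.

(** * Pointwise convergence of Fourier series *)
Section FourierPointwise.
Variable R : realType.
Local Notation I := (@period_itv R).

Definition slope (x0 : R) (F : R -> R) (x : R) : R :=
  if x == x0 then 'D_1 F x0 else (F x - F x0) / (x - x0).

Lemma cont_slope (x0 : R) (F : R -> R) :
  continuous F -> derivable F x0 1 -> continuous (slope x0 F).
Proof.
move=> cF dF x; have [->|xx0] := eqVneq x x0.
  apply/cvgrPdist_lt => e e0; rewrite /slope eqxx.
  have /cvgrPdist_lt/(_ e e0) : h^-1 *: (F (h *: (1 : R) + x0) - F x0) @[h --> 0^'] --> 'D_1 F x0.
    exact: dF.
  rewrite !near_simpl => -[d /= d0 hd]; exists d => //= y /= hy.
  have [_|yx0] := eqVneq y x0; first by rewrite subrr normr0.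
  have := hd (y - x0); rewrite /ball_ /= sub0r normrN distrC => /(_ hy).
  rewrite subr_eq0 => /(_ yx0).
  by rewrite /GRing.scale /= mulr1 subrK mulrC.
rewrite /continuous_at.
have -> : slope x0 F x = (F x - F x0) / (x - x0) by rewrite /slope (negbTE xx0).
apply: (@cvg_trans _ ((fun y => (F y - F x0) / (y - x0)) @ x)).
  apply: near_eq_cvg; exists `|x - x0| => /=; first by rewrite normr_gt0 subr_eq0.
  move=> y /= hy; rewrite /slope; case: eqVneq => // yx0.
  by move: hy; rewrite yx0 ltxx.
apply: (@cvgM R R (nbhs x) _ (fun y => F y - F x0) (fun y => (y - x0)^-1)).
  by apply: cvgB; [exact: cF|exact: cvg_cst].
apply: (@continuousV R R (fun y => y - x0) x); first by rewrite subr_eq0.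
by apply: cvgB; [exact: cvg_id|exact: cvg_cst].
Qed.

Lemma continuous_sum (T : topologicalType) (J : Type) (s : seq J) (F : J -> T -> R) :
  (forall j, continuous (F j)) -> continuous (fun x => \sum_(j <- s) F j x).
Proof.
move=> cF; elim: s => [|j s IH] x.
  rewrite (_ : (fun x => _) = fun=> 0); first exact: cvg_cst.
  by apply/funext => y; rewrite big_nil.
rewrite (_ : (fun x => _) = fun x => F j x + \sum_(i <- s) F i x).
  by apply: cvgD; [exact: cF|exact: IH].
by apply/funext => y; rewrite big_cons.
Qed.

(** The index in 'I_2 selects the cosine or the sine, so that the two coefficients of
    a function at frequency k form a row with two entries. *)
Definition trig (k : nat) (j : 'I_2) (x : R) : R :=
  if j == ord0 then cos (k%:R * x) else sin (k%:R * x).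

(** The constant function has squared norm 2 pi, the other trigonometric functions
    have squared norm pi. *)
Definition weight (k : nat) : R := if k == 0%N then 2^-1 else 1.

Definition fcoef (f : R -> R) k j : R := weight k / pi * pint (fun x => f x * trig k j x).

Definition fsum (f : R -> R) M (x : R) : R :=
  \sum_(k < M.+1) \sum_j fcoef f k j * trig k j x.

Lemma big_ord2 (V : zmodType) (F : 'I_2 -> V) : \sum_j F j = F ord0 + F ord_max.
Proof.
by rewrite !big_ord_recl big_ord0 addr0; congr (_ + F _); apply/val_inj.
Qed.

Lemma trigE k j : trig k j =
  if j == ord0 then fun x => cos (k%:R * x + 0) else fun x => sin (k%:R * x + 0).
Proof. by rewrite /trig; case: ifP => _; apply/funext => x; rewrite addr0. Qed.

Lemma cont_trig k j : continuous (trig k j).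
Proof.
rewrite trigE; case: ifP => _; [exact: cont_cos_affine|exact: cont_sin_affine].
Qed.

Lemma trig_le1 k j (x : R) : `|trig k j x| <= 1.
Proof. by rewrite /trig; case: ifP => _; [exact: cos_max|exact: sin_max]. Qed.

Section AtPoint.
Variable x0 : R.

Definition dirichlet M (x : R) : R :=
  \sum_(k < M.+1) (2 * weight k) * cos (k%:R * x + - (k%:R * x0)).

(** The closed form of the Dirichlet kernel, multiplied by its denominator, which is
    [half_sin x0 0]. *)
Lemma dirichlet_half_sin M x : dirichlet M x * half_sin x0 0 x = half_sin x0 M x.
Proof.
elim: M => [|M IH]; rewrite /dirichlet big_ord_recr /=.
  by rewrite big_ord0 add0r /weight eqxx mulfV // mul1r !mul0r subrr cos0 mul1r.
rewrite mulrDl -/(dirichlet M x) IH /weight /= mulr1 /half_sin.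
set a := (0%:R + 2^-1) * x + - ((0%:R + 2^-1) * x0).
have -> : (M%:R + 2^-1) * x + - ((M%:R + 2^-1) * x0) =
    (M.+1%:R * x + - (M.+1%:R * x0)) - a by rewrite /a -natr1; field.
have -> : (M.+1%:R + 2^-1) * x + - ((M.+1%:R + 2^-1) * x0) =
    (M.+1%:R * x + - (M.+1%:R * x0)) + a by rewrite /a -natr1; field.
by set b := M.+1%:R * x + _; clearbody a b; rewrite sinB sinD; ring.
Qed.

Lemma pintegrable_mul (f g : R -> R) : continuous f -> continuous g ->
  pintegrable (fun x => f x * g x).
Proof.
move=> cf cg; apply: pintegrable_continuous => x.
by apply: cvgM; [exact: cf|exact: cg].
Qed.

Lemma pint_mul_dirichlet (f : R -> R) M : continuous f ->
  pint (fun x => f x * dirichlet M x) = 2 * pi * fsum f M x0.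
Proof.
move=> cf.
have -> : (fun x => f x * dirichlet M x) = fun x => \sum_(k < M.+1)
    2 * weight k * (f x * cos (k%:R * x + - (k%:R * x0))).
  apply/funext => x; rewrite /dirichlet mulr_sumr; apply: eq_bigr => k _; ring.
have ic k : pintegrable (fun x => f x * cos (k%:R * x + - (k%:R * x0))).
  by apply: pintegrable_mul => //; apply: cont_cos_affine.
have [|_ ->] := @pint_sum R 'I_M.+1 (index_enum _) xpredT
   (fun k x => 2 * weight k * (f x * cos (k%:R * x + - (k%:R * x0)))).
  by move=> k _; apply: pintegrableZ.
rewrite /fsum mulr_sumr; apply: eq_bigr => k _; rewrite pintZ // big_ord2 /fcoef.
have it j : pintegrable (fun x => f x * trig k j x).
  by apply: pintegrable_mul => //; apply: cont_trig.
have -> : (fun x => f x * cos (k%:R * x + - (k%:R * x0))) = fun x =>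
   trig k ord0 x0 * (f x * trig k ord0 x) + trig k ord_max x0 * (f x * trig k ord_max x).
  by apply/funext => x; rewrite /trig /= cosB; ring.
rewrite pintD ?pintZ //; try exact: pintegrableZ.
have p0 : pi != 0 :> R by rewrite gt_eqF // pi_gt0.
by move: (@pi R) p0 => p p0; field.
Qed.

Lemma pint_dirichlet M : pint (dirichlet M) = 2 * pi.
Proof.
have ic k : pintegrable (fun x => cos (k%:R * x + - (k%:R * x0))).
  by apply: pintegrable_continuous; apply: cont_cos_affine.
have [|_ ->] := @pint_sum R 'I_M.+1 (index_enum _) xpredT
   (fun k x => 2 * weight k * (cos (k%:R * x + - (k%:R * x0)))).
  by move=> k _; apply: pintegrableZ.
rewrite big_ord_recl /= big1 => [|k _].
  rewrite pintZ // (_ : (fun x : R => cos _) = fun=> 1); last first.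
    by apply/funext => x; rewrite !mul0r subrr cos0.
  by rewrite pint_cst /weight eqxx mulfV // mulr2n; ring.
rewrite pintZ // (_ : (fun x : R => cos _) = fun x =>
   cos (((lift ord0 k : nat)%:R - 0%:R) * x + - ((lift ord0 k : nat)%:R * x0))); last first.
  by apply/funext => x; rewrite subr0.
by rewrite pint_cos_affine // mulr0.
Qed.

(** The denominator of the Dirichlet kernel has only a simple zero at x0 on the
    period, so dividing it by x - x0 leaves a continuous function without zeros. *)
Lemma slope_half_sin_neq0 x : - pi < x0 < pi -> I x -> slope x0 (half_sin x0 0) x != 0.
Proof.
move=> /andP[x01 x02] Ix; have : x \in `[- pi, pi] := Ix.
rewrite in_itv /= => /andP[x1 x2].
have ha (y : R) : half_sin x0 0 y = sin ((y - x0) / 2).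
  by rewrite /half_sin; congr sin; field.
have h0 : half_sin x0 0 x0 = 0 by rewrite ha subrr mul0r sin0.
have [->|xx0] := eqVneq x x0.
  have /(@derive_val _ _ _ _ _ _ _) h :=
    is_derive_sin_affine (0%:R + 2^-1) (- ((0%:R + 2^-1) * x0)) x0.
  rewrite /slope eqxx; apply/eqP => h1.
  have : (0%:R + 2^-1) * cos ((0%:R + 2^-1) * x0 + - ((0%:R + 2^-1) * x0)) = 0 :> R.
    by rewrite -[LHS]h; exact: h1.
  by rewrite subrr cos0 mulr1 add0r => /eqP; rewrite invr_eq0 pnatr_eq0.
rewrite /slope (negbTE xx0).
rewrite h0 subr0 mulf_neq0 ?invr_eq0 ?subr_eq0 // ha.
have [lt|lt|eq] := ltgtP x x0; last by rewrite eq eqxx in xx0.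
  have -> : (x - x0) / 2 = - ((x0 - x) / 2) by field.
  rewrite sinN oppr_eq0 gt_eqF // sin_gt0_pi //; apply/andP; split; lra.
rewrite gt_eqF // sin_gt0_pi //; apply/andP; split; lra.
Qed.

(** With D the Dirichlet kernel and w its numerator, (f - f x0) D is g w where g is the
    quotient of the slopes of f and of the denominator of D.  Differentiability at x0
    makes g continuous, and the integrals of g w become small.  Convergence along a
    subsequence of partial sums is all that is needed, because the tails are bounded
    separately. *)
Lemma fourier_pointwise (f : R -> R) N (delta : R) : continuous f -> derivable f x0 1 ->
  - pi < x0 < pi -> 0 < delta ->
  exists2 M, (N <= M)%N & `|fsum f M x0 - f x0| < delta.
Proof.
move=> cf df x0I d0.
pose g x := slope x0 f x / slope x0 (half_sin x0 0) x.
have csf := cont_slope cf df.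
have dh : derivable (half_sin x0 0) x0 1.
  by have [] := is_derive_sin_affine (0%:R + 2^-1) (- ((0%:R + 2^-1) * x0)) x0.
have csh := cont_slope (@cont_half_sin R x0 0) dh.
have cg : {within I, continuous g}.
  apply/subspace_continuousP => x Ix; apply: cvg_within_filter.
  apply: (@cvgM R R (nbhs x) _ (slope x0 f) (fun y => (slope x0 (half_sin x0 0) y)^-1)).
    exact: csf.
  apply: (@continuousV R R (slope x0 (half_sin x0 0)) x).
    exact: slope_half_sin_neq0.
  exact: csh.
have h0 : half_sin x0 0 x0 = 0 by rewrite /half_sin subrr sin0.
have fg x : I x -> f x - f x0 = g x * half_sin x0 0 x.
  move=> Ix; have [->|xx0] := eqVneq x x0; first by rewrite h0 subrr mulr0.
  have := slope_half_sin_neq0 x0I Ix; rewrite /g /slope (negbTE xx0).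
  rewrite h0 subr0 mulf_eq0 negb_or => /andP[n1 n2].
  have n3 : x - x0 != 0 by rewrite subr_eq0.
  by field; rewrite n3.
have dp : 0 < delta * (2 * pi) by rewrite !mulr_gt0 // pi_gt0.
have [M NM hM] := half_sin_coef_small x0 cg N dp.
exists M => //.
have cdir : continuous (dirichlet M).
  apply: continuous_sum => k x.
  by apply: cvgM; [exact: cvg_cst|exact: cont_cos_affine].
have e : hs_coef x0 g M = 2 * pi * (fsum f M x0 - f x0).
  have -> : hs_coef x0 g M = pint (fun x => f x * dirichlet M x - f x0 * dirichlet M x).
    apply: eq_pint => x Ix; rewrite -dirichlet_half_sin mulrCA -fg //; ring.
  rewrite pintB; [|exact: pintegrable_mul|by apply: pintegrableZ; apply: pintegrable_continuous].
  rewrite pint_mul_dirichlet // pintZ ?pint_dirichlet; first ring.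
  exact: pintegrable_continuous.
have tp : 0 < 2 * pi :> R by rewrite mulr_gt0 // pi_gt0.
move: hM; rewrite e normrM (gtr0_norm tp) [ltRHS]mulrC ltr_pM2l //.
Qed.

End AtPoint.
End FourierPointwise.

(** * Calculus of Fourier coefficients *)
Section CoefficientCalculus.
Variable R : realType.
Local Notation I := (@period_itv R).

Lemma fcoefD (f g : R -> R) k j : continuous f -> continuous g ->
  fcoef (fun x => f x + g x) k j = fcoef f k j + fcoef g k j.
Proof.
move=> cf cg; rewrite /fcoef -mulrDr -pintD.
- by congr (_ * pint _); apply/funext => x; rewrite mulrDl.
- by apply: pintegrable_mul => //; apply: cont_trig.
- by apply: pintegrable_mul => //; apply: cont_trig.
Qed.

Lemma fcoefZ (a : R) (f : R -> R) k j : continuous f ->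
  fcoef (fun x => a * f x) k j = a * fcoef f k j.
Proof.
move=> cf; rewrite /fcoef mulrCA -[a * pint _]pintZ.
  by congr (_ * pint _); apply/funext => x; rewrite mulrA.
by apply: pintegrable_mul => //; apply: cont_trig.
Qed.

Lemma fcoef_sum (T : Type) (s : seq T) (P : pred T) (f : T -> R -> R) k j :
  (forall i, continuous (f i)) ->
  fcoef (fun x => \sum_(i <- s | P i) f i x) k j = \sum_(i <- s | P i) fcoef (f i) k j.
Proof.
move=> cf; rewrite /fcoef -mulr_sumr; congr (_ * _).
rewrite -(proj2 (@pint_sum R T s P (fun i x => f i x * trig k j x) _)); last first.
  by move=> i _; apply: pintegrable_mul => //; apply: cont_trig.
by congr pint; apply/funext => x; rewrite mulr_suml.
Qed.

Lemma is_derive_trig k j (x : R) : is_derive x 1 (@trig R k j)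
  (if j == ord0 then - k%:R * trig k ord_max x else k%:R * trig k ord0 x).
Proof.
rewrite !trigE /=; case: ifP => _; first exact: is_derive_cos_affine.
exact: is_derive_sin_affine.
Qed.

Lemma trig_pi k j : trig k j pi = trig k j (- pi) :> R.
Proof.
rewrite trigE; case: ifP => _; rewrite -[k%:R]subr0.
  exact: (@periodic_half R cos k 0 0 (@cosD2pi R)).
exact: (@periodic_half R sin k 0 0 (@sinD2pi R)).
Qed.

(** Integration by parts, without boundary terms since F takes the same value at both
    ends of the period. *)
Lemma fcoef_derivative (F f : R -> R) k j : (forall x : R, is_derive x 1 F (f x)) ->
  continuous f -> F pi = F (- pi) ->
  fcoef f k j = if j == ord0 then k%:R * fcoef F k ord_max else - k%:R * fcoef F k ord0.
Proof.
move=> dF cf Fpi.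
have cF : continuous F.
  by move=> x; apply: differentiable_continuous; apply/derivable1_diffP; have [] := dF x.
have dP (x : R) : is_derive x 1 (fun x => F x * trig k j x)
  (f x * trig k j x + F x * (if j == ord0 then - k%:R * trig k ord_max x else k%:R * trig k ord0 x)).
  have h := is_deriveM (dF x) (is_derive_trig k j x).
  apply: is_derive_eq h _; rewrite /GRing.scale /= addrC; congr (_ + _).
  by rewrite mulrC.
have it i (g : R -> R) : continuous g -> pintegrable (fun x => g x * trig k i x).
  by move=> cg; apply: pintegrable_mul => //; apply: cont_trig.
pose l : 'I_2 := if j == ord0 then ord_max else ord0.
pose s : R := if j == ord0 then - k%:R else k%:R.
have e (x : R) : F x * (if j == ord0 then - k%:R * trig k ord_max x else k%:R * trig k ord0 x)
   = s * (F x * trig k l x).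
  by rewrite /s /l; case: ifP => _; rewrite mulrCA.
have := pint_derivative dP; rewrite Fpi trig_pi subrr.
rewrite (_ : (fun x => f x * trig k j x + _) = fun x => f x * trig k j x + s * (F x * trig k l x)); last first.
  by apply/funext => x; rewrite e.
move=> h; have {h} := h _.
rewrite pintD; [|exact: it|by apply: pintegrableZ; exact: it].
rewrite pintZ; last exact: it.
move=> h; have {}h : pint (fun x => f x * trig k j x) = - s * pint (fun x => F x * trig k l x).
  have := h _; rewrite mulNr => hh; apply/eqP; rewrite -addr_eq0 hh //.
  move=> x; apply: cvgD.
    by apply: cvgM; [exact: cf|exact: cont_trig].
  apply: cvgM; first exact: cvg_cst.
  by apply: cvgM; [exact: cF|exact: cont_trig].
rewrite /fcoef h /s /l; case: ifP => _; ring.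
Qed.

Lemma is_derive_bigsum (J : Type) (s : seq J) (F dF : J -> R -> R) (x : R) :
  (forall j (x : R), is_derive x 1 (F j) (dF j x)) ->
  is_derive x 1 (fun x => \sum_(j <- s) F j x) (\sum_(j <- s) dF j x).
Proof.
move=> hF; elim: s => [|j s IH].
  rewrite big_nil (_ : (fun x => _) = cst 0); first exact: is_derive_cst.
  by apply/funext => y; rewrite big_nil.
rewrite big_cons (_ : (fun x => _) = F j + (fun x => \sum_(i <- s) F i x)).
  exact: is_deriveD.
by apply/funext => y; rewrite big_cons.
Qed.

Lemma pint_sin_affine (m n : nat) (d : R) : (m != n)%N ->
  pint (fun x => sin ((m%:R - n%:R) * x + d)) = 0.
Proof.
move=> mn; rewrite (_ : (fun x => _) = fun x => cos ((m%:R - n%:R) * x + (d - pi / 2))).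
  exact: pint_cos_affine.
by apply/funext => x; rewrite addrA cosBpihalf.
Qed.

End CoefficientCalculus.

(** * Trigonometric polynomials *)
Section TrigPoly.
Variable R : realType.
Local Notation I := (@period_itv R).

(** The real part of the complex exponential sum, with the same indexing: l stands
    for the frequency l - N. *)
Definition real_trig N (al be : 'I_N.*2.+1 -> R) (x : R) : R :=
  \sum_l (al l * cos ((l%:R - N%:R) * x + 0) + be l * sin ((l%:R - N%:R) * x + 0)).

Lemma trig_poly_real N (f : R -> R) : trig_poly N f ->
  exists al be, f = @real_trig N al be.
Proof.
move=> [c hc]; exists (fun l => complex.Re (c l)), (fun l => - complex.Im (c l)).
apply/funext => x; have := congr1 (@complex.Re R) (hc x).
rewrite /= (raddf_sum (@complex.Re R)) => ->; apply: eq_bigr => l _.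
by rewrite addr0; case: (c l) => a b /=; rewrite mulNr.
Qed.

Lemma cosMcos (a b : R) : cos a * cos b = 2^-1 * cos (a - b) + 2^-1 * cos (a + b).
Proof. by rewrite cosB cosD; field. Qed.
Lemma sinMcos (a b : R) : sin a * cos b = 2^-1 * sin (a - b) + 2^-1 * sin (a + b).
Proof. by rewrite sinB sinD; field. Qed.
Lemma cosMsin (a b : R) : cos a * sin b = (- 2^-1) * sin (a - b) + 2^-1 * sin (a + b).
Proof. by rewrite sinB sinD; field. Qed.
Lemma sinMsin (a b : R) : sin a * sin b = 2^-1 * cos (a - b) + (- 2^-1) * cos (a + b).
Proof. by rewrite cosB cosD; field. Qed.

Section RealTrig.
Variables (N : nat) (al be : 'I_N.*2.+1 -> R).
Let f := real_trig al be.
Let f' := real_trig (fun l => be l * (l%:R - N%:R)) (fun l => - al l * (l%:R - N%:R)).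

Lemma is_derive_real_trig (x : R) : is_derive x 1 f (f' x).
Proof.
apply: (@is_derive_bigsum R 'I_N.*2.+1 _
  (fun l x => al l * cos ((l%:R - N%:R) * x + 0) + be l * sin ((l%:R - N%:R) * x + 0))
  (fun l x => be l * (l%:R - N%:R) * cos ((l%:R - N%:R) * x + 0) +
     - al l * (l%:R - N%:R) * sin ((l%:R - N%:R) * x + 0))) => l {}x.
have h := is_deriveD (is_deriveZ (al l) (is_derive_cos_affine (l%:R - N%:R) 0 x))
                     (is_deriveZ (be l) (is_derive_sin_affine (l%:R - N%:R) 0 x)).
by apply: is_derive_eq h _; rewrite /GRing.scale /=; ring.
Qed.

Lemma cont_real_trig : continuous f.
Proof.
apply: continuous_sum => l x; apply: cvgD; (apply: cvgM; first exact: cvg_cst).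
  exact: cont_cos_affine.
exact: cont_sin_affine.
Qed.

Lemma real_trig_pi : f pi = f (- pi).
Proof.
apply: eq_bigr => l _; congr (_ * _ + _ * _).
  exact: (@periodic_half R cos l N 0 (@cosD2pi R)).
exact: (@periodic_half R sin l N 0 (@sinD2pi R)).
Qed.

Lemma fcoef_real_trig k j : (N < k)%N -> fcoef f k j = 0.
Proof.
move=> Nk; rewrite /f /real_trig fcoef_sum; last first.
  move=> l x; apply: cvgD; (apply: cvgM; first exact: cvg_cst).
    exact: cont_cos_affine.
  exact: cont_sin_affine.
rewrite big1 // => l _.
have cc : continuous (fun x : R => cos ((l%:R - N%:R) * x + 0)) by apply: cont_cos_affine.
have cs : continuous (fun x : R => sin ((l%:R - N%:R) * x + 0)) by apply: cont_sin_affine.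
rewrite fcoefD; first last.
- by move=> x; apply: cvgM; [exact: cvg_cst|exact: cs].
- by move=> x; apply: cvgM; [exact: cvg_cst|exact: cc].
rewrite !fcoefZ // /fcoef.
have l1 : (l != N + k :> nat)%N.
  have h : (l <= N + N)%N by rewrite -ltnS addnn; apply: ltn_ord.
  apply/eqP => e.
  by move: h; rewrite e leq_add2l leqNgt Nk.
have l2 : (l + k != N :> nat)%N.
  by apply/eqP => e; move: Nk; rewrite -e ltnNge leq_addl.
have e1 (x : R) : (l%:R - (N + k)%:R) * x + 0 = ((l%:R - N%:R) * x + 0) - (k%:R * x + 0).
  by rewrite natrD; ring.
have e2 (x : R) : ((l + k)%:R - N%:R) * x + 0 = ((l%:R - N%:R) * x + 0) + (k%:R * x + 0).
  by rewrite natrD; ring.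
have ic1 : pintegrable (fun x : R => cos ((l%:R - (N + k)%:R) * x + 0)).
  by apply: pintegrable_continuous; apply: cont_cos_affine.
have ic2 : pintegrable (fun x : R => cos (((l + k)%:R - N%:R) * x + 0)).
  by apply: pintegrable_continuous; apply: cont_cos_affine.
have is1 : pintegrable (fun x : R => sin ((l%:R - (N + k)%:R) * x + 0)).
  by apply: pintegrable_continuous; apply: cont_sin_affine.
have is2 : pintegrable (fun x : R => sin (((l + k)%:R - N%:R) * x + 0)).
  by apply: pintegrable_continuous; apply: cont_sin_affine.
have Z (a b : R) (u w : R -> R) : pintegrable u -> pintegrable w -> pint u = 0 -> pint w = 0 ->
    pint (fun x => a * u x + b * w x) = 0.
  move=> iu iw u0 w0; rewrite pintD; [|exact: pintegrableZ|exact: pintegrableZ].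
  by rewrite !pintZ // u0 w0 !mulr0 addr0.
rewrite trigE; case: ifP => _.
  rewrite (_ : (fun x => cos _ * _) = fun x => 2^-1 * cos ((l%:R - (N + k)%:R) * x + 0) +
     2^-1 * cos (((l + k)%:R - N%:R) * x + 0)); last first.
    by apply/funext => x; rewrite e1 e2 cosMcos.
  rewrite (_ : (fun x => sin _ * _) = fun x => 2^-1 * sin ((l%:R - (N + k)%:R) * x + 0) +
     2^-1 * sin (((l + k)%:R - N%:R) * x + 0)); last first.
    by apply/funext => x; rewrite e1 e2 sinMcos.
  by rewrite !Z ?mulr0 ?addr0 //; (apply: pint_cos_affine || apply: pint_sin_affine).
rewrite (_ : (fun x => cos _ * _) = fun x => (- 2^-1) * sin ((l%:R - (N + k)%:R) * x + 0) +
     2^-1 * sin (((l + k)%:R - N%:R) * x + 0)); last first.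
  by apply/funext => x; rewrite e1 e2 cosMsin.
rewrite (_ : (fun x => sin _ * _) = fun x => 2^-1 * cos ((l%:R - (N + k)%:R) * x + 0) +
     (- 2^-1) * cos (((l + k)%:R - N%:R) * x + 0)); last first.
  by apply/funext => x; rewrite e1 e2 sinMsin.
by rewrite !Z ?mulr0 ?addr0 //; (apply: pint_cos_affine || apply: pint_sin_affine).
Qed.

End RealTrig.
End TrigPoly.

(** * Fourier coefficients depending on time *)
Section ParametricCoefficients.
Variable R : realType.
Local Notation I := (@period_itv R).

Lemma in_periodP (x : R) : I x <-> - pi <= x <= pi.
Proof. by have := @in_itv _ R x `[- pi, pi]; rewrite /period_itv /= => ->. Qed.

(** Compactness, used to dominate the integrands when passing to the limit and
    differentiating under the integral sign. *)
Lemma bounded_rectangle (h : R * R -> R) (a b : R) :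
  (forall t x, a <= t <= b -> I x -> {for (t, x), continuous h}) ->
  exists B, forall t x, a <= t <= b -> I x -> `|h (t, x)| <= B.
Proof.
move=> ch; pose P := [set` `[a, b]].
have cP : compact (P `*` (I : set R)).
  by apply: compact_setX; exact: segment_compact.
have cI : {within P `*` (I : set R), continuous h}.
  apply/subspace_continuousP => -[t x] [/= Pt Ix]; apply: cvg_within_filter.
  by apply: ch => //; move: Pt; rewrite /P /= in_itv.
have := compact_bounded (continuous_compact cI cP).
move=> [M [_ hM]]; exists (M + 1) => t x tab Ix; apply: (hM (M + 1)).
  by rewrite ltrDl.
by exists (t, x) => //; split => //=; rewrite in_itv.
Qed.

Lemma continuous_pairr (t x : R) : {for x, continuous (fun y : R => (t, y))}.
Proof.
have h1 : (fun=> t) @ nbhs x --> nbhs t by apply: cvg_cst.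
have h2 : id @ nbhs x --> nbhs x by apply: cvg_id.
exact: (cvg_pair h1 h2).
Qed.

Lemma continuous_pairl (t x : R) : {for t, continuous (fun y : R => (y, x))}.
Proof.
have h1 : (fun=> x) @ nbhs t --> nbhs x by apply: cvg_cst.
have h2 : id @ nbhs t --> nbhs t by apply: cvg_id.
exact: (cvg_pair h2 h1).
Qed.

Lemma continuous_slice (h : R * R -> R) (t : R) :
  (forall x, {for (t, x), continuous h}) -> continuous (fun x => h (t, x)).
Proof.
move=> ch x; apply: (@continuous_comp _ _ _ (fun y : R => (t, y)) h x); last exact: ch.
exact: continuous_pairr.
Qed.

Lemma continuous_slice1 (h : R * R -> R) (t x : R) :
  {for (t, x), continuous h} -> {for t, continuous (fun s => h (s, x))}.
Proof.
move=> ch; apply: (@continuous_comp _ _ _ (fun y : R => (y, x)) h t); last exact: ch.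
exact: continuous_pairl.
Qed.

Lemma continuous_fcoef (h : R * R -> R) k j : continuous h ->
  continuous (fun t => fcoef (fun x => h (t, x)) k j).
Proof.
move=> ch t; apply: cvgM; first exact: cvg_cst.
have [B hB] := @bounded_rectangle h (t - 1) (t + 1) (fun t x _ _ => ch (t, x)).
have it : t \in `]t - 1, t + 1[ by rewrite in_itv /=; apply/andP; split; lra.
have := @continuity_under_integral R _ _ (@lebesgue_measure R)
  (fun t x => h (t, x) * trig k j x) I (@measurable_period R) (t - 1) (t + 1) _ _ (fun=> B) _ _ t _.
apply=> //.
- move=> s _; apply: pintegrable_mul; last exact: cont_trig.
  by apply: continuous_slice => x; apply: ch.
- apply: aeW => x _ s _; apply: cvgM; last exact: cvg_cst.
  by apply: continuous_slice1; apply: ch.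
- by apply: pintegrable_continuous => x; apply: cvg_cst.
- move=> s /= hs; apply: aeW => x Ix.
  rewrite normrM; apply: le_trans (_ : `|h (s, x)| * 1 <= _).
    by rewrite ler_wpM2l // trig_le1.
  rewrite mulr1; apply: hB => //; move: hs; rewrite in_itv /= => /andP[s1 s2].
  by rewrite !ltW.
- by rewrite inE.
Qed.

Lemma is_derive_fcoef (H : R -> R -> R) k j (t : R) : 0 < t ->
  (forall s : R, 0 < s -> continuous (H s)) ->
  (forall s x : R, 0 < s -> derivable (H^~ x) s 1) ->
  (forall s x : R, 0 < s -> {for (s, x), continuous (fun z : R * R => derive1 (H^~ z.2) z.1)}) ->
  is_derive t 1 (fun s => fcoef (H s) k j) (fcoef (fun x => derive1 (H^~ x) t) k j).
Proof.
move=> t0 cH dH cdH.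
pose f s x := H s x * trig k j x.
have th0 : 0 < t / 2 by rewrite divr_gt0.
have [B hB] : exists B, forall s x, t / 2 <= s <= t + 1 -> I x -> `|derive1 (H^~ x) s| <= B.
  have [B hB] := @bounded_rectangle (fun z : R * R => derive1 (H^~ z.2) z.1) (t / 2) (t + 1)
    (fun s x hs _ => cdH s x (lt_le_trans th0 (proj1 (andP hs)))).
  by exists B.
have It : `]t / 2, t + 1[%classic t.
  by rewrite /= in_itv /=; apply/andP; split; lra.
have pos (s : R) : `]t / 2, t + 1[%classic s -> 0 < s.
  by rewrite /= in_itv /= => /andP[s1 _]; apply: lt_trans s1.
have df (s x : R) : 0 < s -> is_derive s 1 (f^~ x) (derive1 (H^~ x) s * trig k j x).
  move=> s0; have d := dH s x s0.
  have h := is_deriveM (derivableP d) (is_derive_cst (trig k j x) s (1 : R)).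
  apply: is_derive_eq h _; rewrite /GRing.scale /= mulr0 add0r mulrC derive1E //.
have d1 (s x : R) : 0 < s -> partial1of2 f s x = derive1 (H^~ x) s * trig k j x.
  by move=> s0; rewrite /partial1of2 derive1E; apply: (@derive_val _ _ _ _ _ _ _ (df s x s0)).
have intf (s : R) : `]t / 2, t + 1[%classic s -> (@lebesgue_measure R).-integrable I (EFin \o f s).
  by move=> /pos s0; apply: pintegrable_mul; [exact: cH|exact: cont_trig].
have derf (s x : R) : `]t / 2, t + 1[%classic s -> I x -> derivable (f^~ x) s 1.
  by move=> /pos s0 _; have [] := df s x s0.
have B0 : 0 <= B.
  apply: le_trans (normr_ge0 _) (hB t 0 _ _).
    by apply/andP; split; lra.
  by apply/in_periodP; have := pi_gt0 R => h; apply/andP; split; lra.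
have intG : (@lebesgue_measure R).-integrable I (EFin \o (fun=> B)).
  by apply: pintegrable_continuous => x; apply: cvg_cst.
have ub (s x : R) : `]t / 2, t + 1[%classic s -> I x -> `|partial1of2 f s x| <= (fun=> B) x.
  move=> hs Ix; rewrite d1 ?pos // normrM; apply: le_trans (_ : `|derive1 (H^~ x) s| * 1 <= _).
    by rewrite ler_wpM2l // trig_le1.
  rewrite mulr1; apply: hB => //; move: hs; rewrite /= in_itv /= => /andP[s1 s2].
  by rewrite !ltW.
have D1 := @derivable_under_integral R _ _ (@lebesgue_measure R) f I (@measurable_period R)
  t _ _ It intf derf (fun=> B) (fun=> B0) intG ub.
have D2 := @differentiation_under_integral R _ _ (@lebesgue_measure R) f I (@measurable_period R)
  t _ _ It intf derf (fun=> B) (fun=> B0) intG ub.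
have hD := derivableP D1.
have h := is_deriveZ (weight R k / pi) hD.
apply: is_derive_eq h _.
rewrite /fcoef -derive1E D2 /GRing.scale /=; congr (_ * _).
by apply: eq_Rintegral => x _; rewrite d1.
Qed.

End ParametricCoefficients.

(** * Vector-valued functions and the scheme in Fourier modes *)
Section VectorCoefficients.
Variables (R : realType) (m : nat).
Local Notation I := (@period_itv R).
Implicit Types (u w : R -> 'cV[R]_m).

Definition fmat k u : 'M[R]_(m, 2) := \matrix_(i, j) fcoef (component u i) k j.

Definition trigv k (x : R) : 'cV[R]_2 := \col_j trig k j x.

(** Differentiation exchanges cosine and sine up to a sign; on rows of coefficients
    this is multiplication by this matrix on the right. *)
Definition rotJ : 'M[R]_2 :=
  \matrix_(i, j) (if j == ord0 then (i == ord_max)%:R else - (i == ord0)%:R).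

Definition ccont u : Prop := forall i, continuous (component u i).

Lemma fmat_fsum u M x i :
  (\sum_(k < M.+1) fmat k u *m trigv k x) i 0 = fsum (component u i) M x.
Proof.
rewrite summxE; apply: eq_bigr => k _; rewrite mxE.
by apply: eq_bigr => j _; rewrite !mxE.
Qed.

Lemma fmatD k u w : ccont u -> ccont w ->
  fmat k (fun x => u x + w x) = fmat k u + fmat k w.
Proof.
move=> cu cw; apply/matrixP => i j; rewrite !mxE -fcoefD //.
by congr fcoef; apply/funext => x; rewrite /component mxE.
Qed.

Lemma fmatZ k a u : ccont u -> fmat k (fun x => a *: u x) = a *: fmat k u.
Proof.
move=> cu; apply/matrixP => i j; rewrite !mxE -fcoefZ //.
by congr fcoef; apply/funext => x; rewrite /component mxE.
Qed.

Lemma ccontD u w : ccont u -> ccont w -> ccont (fun x => u x + w x).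
Proof.
move=> cu cw i; rewrite (_ : component _ i = fun x => component u i x + component w i x).
  by move=> x; apply: cvgD; [exact: cu|exact: cw].
by apply/funext => x; rewrite /component mxE.
Qed.

Lemma ccontZ a u : ccont u -> ccont (fun x => a *: u x).
Proof.
move=> cu i; rewrite (_ : component _ i = fun x => a * component u i x).
  by move=> x; apply: cvgM; [exact: cvg_cst|exact: cu].
by apply/funext => x; rewrite /component mxE.
Qed.

Lemma ccont0 : ccont (fun=> 0).
Proof. by move=> i x; apply: cvg_cst. Qed.

Lemma ccont_sum (T : Type) (s : seq T) (P : pred T) (F : T -> R -> 'cV[R]_m) :
  (forall j, ccont (F j)) -> ccont (fun x => \sum_(j <- s | P j) F j x).
Proof.
move=> cF; elim: s => [|j s IH].
  by rewrite (_ : (fun x => _) = fun=> 0) => [|]; [exact: ccont0|apply/funext => x; rewrite big_nil].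
case Pj : (P j).
  rewrite (_ : (fun x => _) = fun x => F j x + \sum_(i <- s | P i) F i x); first exact: ccontD.
  by apply/funext => x; rewrite big_cons Pj.
by rewrite (_ : (fun x => _) = fun x => \sum_(i <- s | P i) F i x) //; apply/funext => x; rewrite big_cons Pj.
Qed.

Lemma fmat0 k : fmat k (fun=> 0) = 0.
Proof.
transitivity (fmat k (fun x => 0 *: (0 : 'cV[R]_m))).
  by congr fmat; apply/funext => x; rewrite scale0r.
by rewrite (@fmatZ k 0 (fun=> 0) ccont0) scale0r.
Qed.

Lemma fmat_sum (T : Type) (s : seq T) (P : pred T) (F : T -> R -> 'cV[R]_m) k :
  (forall j, ccont (F j)) ->
  fmat k (fun x => \sum_(j <- s | P j) F j x) = \sum_(j <- s | P j) fmat k (F j).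
Proof.
move=> cF; elim: s => [|j s IH].
  rewrite big_nil -(fmat0 k); congr fmat.
  by apply/funext => x; rewrite big_nil.
rewrite big_cons; case Pj : (P j).
  rewrite -IH -fmatD //; last exact: ccont_sum.
  by congr fmat; apply/funext => x; rewrite big_cons Pj.
by rewrite -IH; congr fmat; apply/funext => x; rewrite big_cons Pj.
Qed.

Lemma fmat_derivative k u w :
  (forall i (x : R), is_derive x 1 (component u i) (component w i x)) ->
  ccont w -> u pi = u (- pi) -> fmat k w = k%:R *: (fmat k u *m rotJ).
Proof.
move=> du cw upi; apply/matrixP => i j; rewrite !mxE.
rewrite (@fcoef_derivative R (component u i)) //; last by rewrite /component upi.
rewrite big_ord2 !mxE /=; case: eqVneq => _; ring.
Qed.

End VectorCoefficients.

Section VectorMul.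
Variables (R : realType) (m n : nat) (A : 'M[R]_(n, m)).

Lemma ccont_mul (u : R -> 'cV[R]_m) : ccont u -> ccont (fun x => A *m u x).
Proof.
move=> cu i; rewrite (_ : component _ i = fun x => \sum_l A i l * component u l x).
  by apply: continuous_sum => l x; apply: cvgM; [exact: cvg_cst|exact: cu].
by apply/funext => x; rewrite /component mxE.
Qed.

Lemma fmat_mul k (u : R -> 'cV[R]_m) : ccont u ->
  fmat k (fun x => A *m u x) = A *m fmat k u.
Proof.
move=> cu; apply/matrixP => i j; rewrite !mxE.
rewrite (_ : component _ i = fun x => \sum_l A i l * component u l x); last first.
  by apply/funext => x; rewrite /component mxE.
rewrite fcoef_sum => [|l x]; last by apply: cvgM; [exact: cvg_cst|exact: cu].
by apply: eq_bigr => l _; rewrite !mxE fcoefZ.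
Qed.
End VectorMul.

Section ModeOperators.
Variables (R : realType) (m : nat) (A : 'M[R]_m).
(** The operator - A d/dx on the coefficients of frequency 1; at frequency k it is
    multiplied by k. *)
Definition transport (y : 'M[R]_(m, 2)) : 'M[R]_(m, 2) := - (A *m y *m rotJ R).
Lemma transport_linear : linear transport.
Proof.
move=> a y z; rewrite /transport mulmxDr mulmxDl -scalemxAr -scalemxAl opprD.
by rewrite scalerN.
Qed.
HB.instance Definition _ :=
  GRing.isLinear.Build R _ _ _ transport transport_linear.
End ModeOperators.

Section TrigPolyVectors.
Variables (R : realType) (m N : nat).
Local Notation I := (@period_itv R).

Lemma in_PN_smooth (u : R -> 'cV[R]_m) : in_PN N u ->
  [/\ ccont u, ccont (vderiv 1 u), u pi = u (- pi),
      forall i (x : R), is_derive x 1 (component u i) (component (vderiv 1 u) i x) &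
      forall k, (N < k)%N -> fmat k u = 0].
Proof.
move=> hu; have h i : exists al be, component u i = @real_trig R N al be.
  exact: trig_poly_real.
have d i (x : R) : derivable (component u i) x 1.
  by have [al [be ->]] := h i; have [] := is_derive_real_trig al be x.
split.
- by move=> i; have [al [be ->]] := h i; apply: cont_real_trig.
- move=> i; rewrite (_ : component _ i = derive1 (component u i)); last first.
    by apply/funext => x; rewrite /component mxE.
  have [al [be ->]] := h i.
  rewrite (_ : derive1 _ = @real_trig R N (fun l => be l * (l%:R - N%:R))
     (fun l => - al l * (l%:R - N%:R))); first exact: cont_real_trig.
  apply/funext => x; rewrite derive1E.
  exact: (@derive_val _ _ _ _ _ _ _ (is_derive_real_trig al be x)).
- apply/colP => i; have [al [be e]] := h i.
  by have := real_trig_pi al be; rewrite -e.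
- move=> i x; rewrite {2}/component mxE /= derive1E; exact: derivableP.
- move=> k Nk; apply/matrixP => i j; rewrite !mxE.
  by have [al [be ->]] := h i; apply: fcoef_real_trig.
Qed.

Lemma fsum_tail (f : R -> R) M x : (N <= M)%N ->
  fsum f M x - fsum f N x = \sum_(N.+1 <= k < M.+1) \sum_j fcoef f k j * trig k j x.
Proof.
move=> NM; rewrite /fsum -!(big_mkord xpredT (fun k => \sum_j fcoef f k j * trig k j x)).
by rewrite (@big_cat_nat _ _ _ N.+1 0 M.+1) //= addrAC subrr add0r.
Qed.

Lemma fsum_tail_bound (f : R -> R) M x : (N <= M)%N ->
  `|fsum f M x - fsum f N x| <= \sum_(N.+1 <= k < M.+1) \sum_j `|fcoef f k j|.
Proof.
move=> NM; rewrite fsum_tail //; apply: le_trans (ler_norm_sum _ _ _) _.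
apply: ler_sum => k _; apply: le_trans (ler_norm_sum _ _ _) _.
by apply: ler_sum => j _; rewrite normrM ler_piMr // trig_le1.
Qed.

(** Pointwise convergence is available inside the period only; continuity takes care
    of its end points. *)
Lemma closed_period_bound (h : R -> R) B : continuous h ->
  (forall x, - pi < x < pi -> `|h x| <= B) -> forall x, I x -> `|h x| <= B.
Proof.
move=> ch hB x /in_periodP /andP[x1 x2].
have cn : continuous (fun y => `|h y|).
  by move=> y; apply: (@cvg_norm _ _ _ _ _ h); exact: ch.
apply/ler_addgt0Pr => e e0.
have /cvgrPdist_lt/(_ e e0) [d /= d0 hd] := cn x.
have Np := Npi_lt_pi R.
have [y [y1 y2 y3]] : exists y, [/\ - pi < y, y < pi & `|x - y| < d].
  have m0 : 0 < Num.min (d / 2) pi by rewrite lt_min divr_gt0 ?pi_gt0.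
  have md : Num.min (d / 2) pi < d.
    by rewrite gt_min; apply/orP; left; lra.
  have mp : Num.min (d / 2) pi <= pi by rewrite ge_min lexx orbT.
  set q := Num.min _ _ in m0 md mp.
  have [x0|x0] := lerP x 0.
    exists (x + q / 2); split; [lra|lra|].
    by rewrite opprD addNKr normrN gtr0_norm; lra.
  exists (x - q / 2); split; [lra|lra|].
  by rewrite opprB addrC subrK gtr0_norm; lra.
have := hd y y3; have := hB y; rewrite y1 y2 => /(_ isT) h1.
by rewrite ltr_distl => /andP[_ h2]; lra.
Qed.

(** Bounding the coefficients beyond N bounds the remainder at every point: the partial
    sums come arbitrarily close to f x, and differ from the N-th by the coefficients. *)
Lemma fourier_bound (f : R -> R) B : continuous f ->
  (forall x : R, - pi < x < pi -> derivable f x 1) ->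
  (forall M, (N <= M)%N -> \sum_(N.+1 <= k < M.+1) \sum_j `|fcoef f k j| <= B) ->
  forall x, I x -> `|f x - fsum f N x| <= B.
Proof.
move=> cf df hB; apply: closed_period_bound.
  move=> x; apply: cvgB; first exact: cf.
  apply: continuous_sum => k; apply: continuous_sum => j {}x.
  by apply: cvgM; [exact: cvg_cst|exact: cont_trig].
move=> x xI; apply/ler_addgt0Pr => e e0.
have [M NM hM] := fourier_pointwise N cf (df x xI) xI e0.
have -> : f x - fsum f N x = (fsum f M x - fsum f N x) - (fsum f M x - f x) by ring.
apply: le_trans (ler_normB _ _) _; apply: lerD; last exact: ltW.
exact: le_trans (fsum_tail_bound _ _ NM) (hB M NM).
Qed.

(** The coefficients of a trigonometric polynomial vanish beyond N, so its remainder is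
    bounded by 0. *)
Lemma PN_fourier (u : R -> 'cV[R]_m) x : in_PN N u -> I x ->
  u x = \sum_(k < N.+1) fmat k u *m trigv k x.
Proof.
move=> hu Ix; have [cu _ _ du h0] := in_PN_smooth hu.
apply/colP => i; rewrite fmat_fsum; apply/eqP; rewrite -subr_eq0 -normr_le0.
apply: (@fourier_bound (component u i) 0 (cu i) (fun y _ => @ex_derive _ _ _ _ _ _ _ (du i y))) => // M NM.
rewrite big_nat_cond big1 // => k /andP[/andP[Nk _] _].
rewrite big1 // => j _.
by have /matrixP/(_ i j) := h0 k Nk; rewrite !mxE => ->; rewrite normr0.
Qed.

Lemma trig_trig_poly k j : (k <= N)%N -> trig_poly N (@trig R k j).
Proof.
move=> kN; pose z1 : R[i] := if j == ord0 then Complex 2^-1 0 else Complex 0 (- 2^-1).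
pose z2 : R[i] := if j == ord0 then Complex 2^-1 0 else Complex 0 2^-1.
exists (fun l => (nat_of_ord l == N + k)%N%:R * z1 + (nat_of_ord l == N - k)%N%:R * z2) => x.
have l1 : (N + k < N.*2.+1)%N by rewrite ltnS -addnn leq_add2l.
have l2 : (N - k < N.*2.+1)%N.
  by rewrite ltnS (leq_trans (leq_subr _ _)) // -addnn leq_addl.
under eq_bigr => l _ do rewrite mulrDl.
rewrite big_split /= (bigD1 (Ordinal l1)) //= eqxx big1 ?addr0; last first.
  by move=> l /negbTE; rewrite -val_eqE /= => ->; rewrite !mul0r.
rewrite (bigD1 (Ordinal l2)) //= eqxx big1 ?addr0; last first.
  by move=> l /negbTE; rewrite -val_eqE /= => ->; rewrite !mul0r.
rewrite !mul1r.
have -> : (N + k)%N%:R - N%:R = k%:R :> R by rewrite natrD addrC addKr.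
have -> : (N - k)%N%:R - N%:R = - k%:R :> R by rewrite natrB // addrC addKr.
rewrite mulNr /expi /z1 /z2 /trig cosN sinN; case: ifP => _.
all: apply/eqP; rewrite eq_complex /=; apply/andP; split; apply/eqP; by field.
Qed.

(** The trigonometric functions of frequency at most N are admissible in the
    orthogonality condition. *)
Lemma PN_projection_fmat (u w : R -> 'cV[R]_m) k : ccont u -> PN_projection N u w ->
  (k <= N)%N -> fmat k w = fmat k u.
Proof.
move=> cu [hw orth] kN; have [cw _ _ _ _] := in_PN_smooth hw.
apply/matrixP => i j; rewrite !mxE; congr (_ * _).
have := orth i _ (trig_trig_poly j kN) => h.
apply/eqP; rewrite eq_sym -subr_eq0 -pintB.
- rewrite -[X in _ == X]h; apply/eqP; congr (Rintegral _ _ _).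
  by apply/funext => x; rewrite mulrBl.
- by apply: pintegrable_mul; [exact: cu|exact: cont_trig].
- by apply: pintegrable_mul; [exact: cw|exact: cont_trig].
Qed.

End TrigPolyVectors.

Section ModeScheme.
Variables (R : realType) (p r : nat) (A : 'M[R]_(p + r)) (S : 'M[R]_r).
Variables (s : nat) (rk : imex_tableau R s.+1) (eps dt : R) (N : nat).
Variables (Un : nat -> R -> 'cV[R]_(p + r)) (Us : nat -> 'I_s.+1 -> R -> 'cV[R]_(p + r)).
Hypothesis scheme : imex_scheme A (relaxmx p S) rk eps dt N Un Us.
Local Notation Q := (relaxmx p S).

Let cUn n : ccont (Un n).
Proof. by have [] := in_PN_smooth (scheme_Un_PN scheme n). Qed.
Let cUs n i : ccont (Us n i).
Proof. by have [] := in_PN_smooth (scheme_Us_PN scheme n i). Qed.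
Let cdUs n i : ccont (vderiv 1 (Us n i)).
Proof. by have [] := in_PN_smooth (scheme_Us_PN scheme n i). Qed.

Lemma fmat_transport k n i :
  fmat k (fun x => A *m vderiv 1 (Us n i) x) = - (k%:R *: transport A (fmat k (Us n i))).
Proof.
have [_ c2 c3 c4 _] := in_PN_smooth (scheme_Us_PN scheme n i).
rewrite fmat_mul // (@fmat_derivative _ _ k (Us n i)) // /transport.
by rewrite scalerN opprK -scalemxAr mulmxA.
Qed.

(** The common shape of a stage and of the update. *)
Lemma fmat_stage_sum (a b : 'I_s.+1 -> R) (P P' : pred 'I_s.+1) k n :
  (forall j, ~~ P j -> a j = 0) -> (forall j, ~~ P' j -> b j = 0) ->
  fmat k (fun x => Un n x - dt *: \sum_(j < s.+1 | P j) a j *: (A *m vderiv 1 (Us n j) x)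
      + (dt / eps) *: \sum_(j < s.+1 | P' j) b j *: (Q *m Us n j x)) =
  fmat k (Un n) + (dt * k%:R) *: transport A (\sum_j a j *: fmat k (Us n j))
      + (dt / eps) *: (Q *m \sum_j b j *: fmat k (Us n j)).
Proof.
move=> aP bP.
have full (c : 'I_s.+1 -> R) (P0 : pred 'I_s.+1) (F : 'I_s.+1 -> 'cV[R]_(p + r)) :
    (forall j, ~~ P0 j -> c j = 0) -> \sum_(j | P0 j) c j *: F j = \sum_j c j *: F j.
  move=> h; rewrite [RHS](bigID P0) /= [X in _ + X]big1 ?addr0 // => j /h ->.
  by rewrite scale0r.
have -> : (fun x => Un n x - dt *: \sum_(j < s.+1 | P j) a j *: (A *m vderiv 1 (Us n j) x)
      + (dt / eps) *: \sum_(j < s.+1 | P' j) b j *: (Q *m Us n j x)) =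
  (fun x => (Un n x + (- dt) *: \sum_j a j *: (A *m vderiv 1 (Us n j) x))
      + (dt / eps) *: \sum_j b j *: (Q *m Us n j x)).
  by apply/funext => x; rewrite (full a P) // (full b P') // scaleNr.
have c1 : ccont (fun x => \sum_j a j *: (A *m vderiv 1 (Us n j) x)).
  by apply: ccont_sum => j; apply: ccontZ; apply: ccont_mul; apply: cdUs.
have c2 : ccont (fun x => \sum_j b j *: (Q *m Us n j x)).
  by apply: ccont_sum => j; apply: ccontZ; apply: ccont_mul; apply: cUs.
rewrite fmatD; [|by apply: ccontD => //; apply: ccontZ|exact: ccontZ].
rewrite fmatD //; last exact: ccontZ.
rewrite !fmatZ // !fmat_sum; first last.
- by move=> j; apply: ccontZ; apply: ccont_mul; apply: cdUs.
- by move=> j; apply: ccontZ; apply: ccont_mul; apply: cUs.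
congr (_ + _ + _).
  rewrite (linear_sum (transport A)) !scaler_sumr; apply: eq_bigr => j _.
  rewrite fmatZ ?fmat_transport; last by apply: ccont_mul; apply: cdUs.
  rewrite (linearZZ (transport A)) !scalerN !scaleNr opprK !scalerA; congr (- (_ *: _)); ring.
rewrite mulmx_sumr; congr (_ *: _); apply: eq_bigr => j _.
rewrite fmatZ ?fmat_mul //; last by apply: ccont_mul; apply: cUs.
by rewrite scalemxAr.
Qed.

Lemma mode_stage k n i :
  fmat k (Us n i) = fmat k (Un n)
    + (dt * k%:R) *: transport A (mxcomb (Hex rk) (fun j => fmat k (Us n j)) i)
    + (dt / eps) *: (Q *m mxcomb (Him rk) (fun j => fmat k (Us n j)) i).
Proof.
rewrite /mxcomb -(@fmat_stage_sum (Hex rk i) (Him rk i) (fun j => j < i)%N (fun j => j <= i)%N).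
- by congr fmat; apply/funext => x; apply: scheme_stage scheme n i x.
- by move=> j; rewrite -leqNgt => /(Hex_trig rk).
- by move=> j; rewrite -ltnNge => /(Him_trig rk).
Qed.

Lemma mode_update k n :
  fmat k (Un n.+1) = fmat k (Un n)
    + (dt * k%:R) *: transport A (\sum_j bex rk j *: fmat k (Us n j))
    + (dt / eps) *: (Q *m \sum_j bim rk j *: fmat k (Us n j)).
Proof.
rewrite -(@fmat_stage_sum (bex rk) (bim rk) xpredT xpredT) //.
by congr fmat; apply/funext => x; apply: scheme_update scheme n x.
Qed.

End ModeScheme.

(** * Harmonics *)
Section MatrixFunctions.
Variable R : realType.

Lemma continuous_mx (T : topologicalType) m n (F : T -> 'M[R]_(m, n)) (z : T) :
  (forall i j, {for z, continuous (fun x => F x i j)}) -> {for z, continuous F}.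
Proof.
move=> cF A [P hP sPA]; apply: (@filterS _ (nbhs z) _ (fun x => forall i j, P i j (F x i j))).
  by move=> x h; apply: sPA.
apply: filter_forall => i; apply: filter_forall => j.
by apply: cF; apply: hP.
Qed.

Lemma continuous_entry (T : topologicalType) m n (F : T -> 'M[R]_(m, n)) (z : T) i j :
  {for z, continuous F} -> {for z, continuous (fun x => F x i j)}.
Proof.
move=> cF; apply: (@continuous_comp _ _ _ F (fun M : 'M[R]_(m, n) => M i j) z) => //.
exact: coord_continuous.
Qed.

Lemma linear_entry m n q l (L : {linear 'M[R]_(m, n) -> 'M[R]_(q, l)}) (M : 'M[R]_(m, n)) a b :
  L M a b = \sum_i \sum_j L (delta_mx i j) a b * M i j.
Proof.
rewrite {1}[M]matrix_sum_delta linear_sum summxE; apply: eq_bigr => i _.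
rewrite linear_sum summxE; apply: eq_bigr => j _.
by rewrite linearZ mxE mulrC.
Qed.

Lemma is_derive_bigsum_pt (J : Type) (s : seq J) (F : J -> R -> R) (dF : J -> R) (x : R) :
  (forall j, is_derive x 1 (F j) (dF j)) ->
  is_derive x 1 (fun x => \sum_(j <- s) F j x) (\sum_(j <- s) dF j).
Proof.
move=> hF; elim: s => [|j s IH].
  rewrite big_nil (_ : (fun x => _) = cst 0); first exact: is_derive_cst.
  by apply/funext => y; rewrite big_nil.
rewrite big_cons (_ : (fun x => _) = F j + (fun x => \sum_(i <- s) F i x)).
  exact: is_deriveD.
by apply/funext => y; rewrite big_cons.
Qed.

Lemma is_derive_linear m n q l (L : {linear 'M[R]_(m, n) -> 'M[R]_(q, l)})
    (F : R -> 'M[R]_(m, n)) (dF : 'M[R]_(m, n)) (t : R) :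
  (forall i j, is_derive t 1 (fun s => F s i j) (dF i j)) ->
  forall a b, is_derive t 1 (fun s => L (F s) a b) (L dF a b).
Proof.
move=> hF a b; rewrite linear_entry.
rewrite (_ : (fun s => _) = fun s => \sum_i \sum_j L (delta_mx i j) a b * F s i j); last first.
  by apply/funext => s; rewrite linear_entry.
by apply: is_derive_bigsum_pt => i; apply: is_derive_bigsum_pt => j.
Qed.

Lemma continuous_linear_entry (T : topologicalType) m n q l
    (L : {linear 'M[R]_(m, n) -> 'M[R]_(q, l)}) (F : T -> 'M[R]_(m, n)) :
  (forall i j, continuous (fun s => F s i j)) ->
  forall a b, continuous (fun s => L (F s) a b).
Proof.
move=> hF a b; rewrite (_ : (fun s => _) =
   fun s => \sum_i \sum_j L (delta_mx i j) a b * F s i j); last first.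
  by apply/funext => s; rewrite linear_entry.
apply: continuous_sum => i; apply: continuous_sum => j s.
by apply: cvgM; [exact: cvg_cst|exact: hF].
Qed.

Lemma trigv_period k (x : R) : trigv k (x + pi *+ 2) = trigv k x.
Proof.
have e : k%:R * (x + pi *+ 2) = k%:R * x + pi *+ 2 *+ k.
  by rewrite mulrDr -(mulr_natl (pi *+ 2) k).
apply/colP => j; rewrite !mxE /trig e (periodicn (@cosD2pi R)).
by rewrite (periodicn (@sinD2pi R)).
Qed.

Lemma is_derive_harmonic m k (z : 'M[R]_(m, 2)) i (x : R) :
  is_derive x 1 (fun x => (z *m trigv k x) i 0)
    (((k%:R *: (z *m rotJ R)) *m trigv k x) i 0).
Proof.
have e y : (z *m trigv k y) i 0 = z i ord0 * trig k ord0 y + z i ord_max * trig k ord_max y.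
  by rewrite mxE big_ord2 !mxE.
rewrite (_ : (fun x => _) = fun y => z i ord0 * trig k ord0 y + z i ord_max * trig k ord_max y); last first.
  by apply/funext => y; rewrite e.
have h := is_deriveD (is_deriveZ (z i ord0) (is_derive_trig k ord0 x))
                     (is_deriveZ (z i ord_max) (is_derive_trig k ord_max x)).
apply: is_derive_eq h _; rewrite mxE big_ord2 !mxE !big_ord2 !mxE /= /GRing.scale /=.
ring.
Qed.

Lemma cont_harmonic m k (z : 'M[R]_(m, 2)) i : continuous (fun x => (z *m trigv k x) i 0).
Proof.
rewrite (_ : (fun x => _) = fun x => \sum_j z i j * trig k j x).
  apply: continuous_sum => j x.
  by apply: cvgM; [exact: cvg_cst|exact: cont_trig].
by apply/funext => x; rewrite mxE; apply: eq_bigr => j _; rewrite !mxE.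
Qed.

Lemma derive1n_harmonic m k (z : 'M[R]_(m, 2)) i n :
  derive1n n (component (fun x => z *m trigv k x) i) =
  component (fun x => iter n (fun y => k%:R *: (y *m rotJ R)) z *m trigv k x) i.
Proof.
elim: n => [//|n IH]; rewrite derive1nS IH; apply/funext => x; rewrite derive1E.
exact: (@derive_val _ _ _ _ _ _ _ (is_derive_harmonic k _ i x)).
Qed.

Lemma smooth_harmonic m k (z : 'M[R]_(m, 2)) i :
  smooth (component (fun x => z *m trigv k x) i).
Proof.
move=> n x; rewrite derive1n_harmonic.
by have [] := is_derive_harmonic k (iter n (fun y => k%:R *: (y *m rotJ R)) z) i x.
Qed.

Lemma smooth_trig k j : smooth (@trig R k j).
Proof.
pose z : 'M[R]_(1, 2) := delta_mx 0 j.
have -> : trig k j = component (fun x => z *m trigv k x) 0 :> (R -> R).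
  by apply/funext => x; rewrite /component -rowE !mxE.
exact: smooth_harmonic.
Qed.

Lemma periodic_trig k j : periodic (@trig R k j) (pi *+ 2).
Proof. by move=> x; have /colP/(_ j) := trigv_period k x; rewrite !mxE. Qed.

End MatrixFunctions.

Lemma near_pos (R : realType) (t : R) : 0 < t -> \forall s \near t, 0 < s.
Proof.
move=> t0; exists t => //= s; rewrite /ball_ /= => h.
by have := ler_norm (t - s); lra.
Qed.

Lemma near_eq_continuous (T : topologicalType) (R : realType) (f g : T -> R) (z : T) :
  (\forall w \near z, f w = g w) -> {for z, continuous f} -> {for z, continuous g}.
Proof.
move=> fg; rewrite /prop_for /continuous_at (nbhs_singleton fg) => cf.
by apply: cvg_trans cf; exact: near_eq_cvg fg.
Qed.

(** * The exact solution in Fourier modes *)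
Section Modes.
Variables (R : realType) (p r : nat) (A : 'M[R]_(p + r)) (S : 'M[R]_r).
Local Notation m := (p + r)%N.
Local Notation Q := (relaxmx p S).
Local Notation I := (@period_itv R).

Definition mode_op (k : nat) (eps : R) (y : 'M[R]_(m, 2)) : 'M[R]_(m, 2) :=
  k%:R *: transport A y + eps^-1 *: (Q *m y).

Lemma mode_op_linear k eps : linear (mode_op k eps).
Proof.
move=> a y z; rewrite /mode_op linearP mulmxDr -scalemxAr !scalerDr !scalerA.
by rewrite (mulrC k%:R) (mulrC eps^-1) addrACA.
Qed.
HB.instance Definition _ k eps :=
  GRing.isLinear.Build R _ _ _ (mode_op k eps) (mode_op_linear k eps).

Variables (eps : R) (Uin : R -> 'cV[R]_m) (U : R -> R -> 'cV[R]_m).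
Hypothesis sol : exact_solution A S eps Uin U.

(** Composing with the absolute value of the time extends the solution continuously to
    negative times, so that continuity up to t = 0 becomes continuity everywhere. *)
Lemma solution_continuous i : continuous (fun z : R * R => U `|z.1| z.2 i 0).
Proof.
move=> z; apply: continuous_entry.
have /subspace_continuousP h := sol_cont sol.
have hz := h (`|z.1|, z.2) (normr_ge0 _).
have c : (fun w : R * R => (`|w.1|, w.2)) @ nbhs z -->
    within [set z : R * R | 0 <= z.1] (nbhs (`|z.1|, z.2)).
  move=> B hB.
  have c1 : (fun w : R * R => `|w.1|) @ nbhs z --> nbhs `|z.1|.
    by apply: (@cvg_norm _ _ _ _ _ (fun w : R * R => w.1)); exact: cvg_fst.
  have c2 : (fun w : R * R => w.2) @ nbhs z --> nbhs z.2 by exact: cvg_snd.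
  have hh := (cvg_pair c1 c2) _ hB.
  by apply: (@filterS _ (nbhs z) _ _ _ _ (hh _ _ _)) => w /= hw; apply: hw; exact: normr_ge0.
exact: (cvg_comp _ _ c hz).
Qed.

Lemma solution_ccont t : 0 <= t -> ccont (U t).
Proof.
move=> t0 i; have := @continuous_slice R _ t (fun x => @solution_continuous i (t, x)).
by rewrite /= ger0_norm.
Qed.

Lemma fmat_solution_continuous k i j : continuous (fun t : R => fmat k (U `|t|) i j).
Proof.
rewrite (_ : (fun t : R => _) = fun t : R => fcoef (fun x => U `|t| x i 0) k j); last first.
  by apply/funext => t; rewrite mxE.
exact: (@continuous_fcoef R (fun z => U `|z.1| z.2 i 0) k j (@solution_continuous i)).
Qed.

Lemma partial10E (t x : R) i : partial 1 0 U t x i 0 = derive1 (fun s => component (U s) i x) t.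
Proof.
rewrite mxE /=; congr (derive1 _ t); apply/funext => s.
by rewrite /component mxE.
Qed.

Lemma partial01E t : partial 0 1 U t = vderiv 1 (U t).
Proof. by apply/funext => x; apply/colP => i; rewrite mxE. Qed.

(** Differentiation under the integral sign in t, the equation, and integration by
    parts in x. *)
Lemma mode_ode k (t : R) i j : 0 < t ->
  is_derive t 1 (fun s => fmat k (U s) i j) (mode_op k eps (fmat k (U t)) i j).
Proof.
move=> t0.
have c10 : ccont (partial 1 0 U t).
  move=> l; apply: (@continuous_slice R (fun z => partial 1 0 U z.1 z.2 l 0) t) => x.
  exact: (@continuous_entry R _ _ _ (fun z : R * R => partial 1 0 U z.1 z.2) (t, x) l 0
    (proj1 (sol_C1 sol x t0))).
have c01 : ccont (vderiv 1 (U t)).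
  rewrite -partial01E => l.
  apply: (@continuous_slice R (fun z => partial 0 1 U z.1 z.2 l 0) t) => x.
  exact: (@continuous_entry R _ _ _ (fun z : R * R => partial 0 1 U z.1 z.2) (t, x) l 0
    (proj2 (sol_C1 sol x t0))).
have cU := solution_ccont (ltW t0).
have e : fmat k (partial 1 0 U t) = mode_op k eps (fmat k (U t)).
  rewrite (_ : partial 1 0 U t = fun x => (-1) *: (A *m vderiv 1 (U t) x) + eps^-1 *: (Q *m U t x)).
    have cA := @ccont_mul _ _ _ A _ c01; have cQ := @ccont_mul _ _ _ Q _ cU.
    rewrite fmatD; [|exact: ccontZ|exact: ccontZ].
    have dU l (x : R) : is_derive x 1 (component (U t) l) (component (vderiv 1 (U t)) l x).
      rewrite {2}/component mxE /= derive1E.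
      by apply: derivableP; have [] := sol_derivable sol x l t0.
    have Upi : U t pi = U t (- pi).
      have := sol_periodic sol (ltW t0) (- pi).
      by rewrite mulr2n addrA addNr add0r.
    rewrite !fmatZ // !fmat_mul // (fmat_derivative k dU c01 Upi).
    by rewrite /mode_op /transport scaleN1r scalerN -scalemxAr mulmxA.
  apply/funext => x; have := sol_pde sol x t0; rewrite partial01E => <-.
  by rewrite scaleN1r addrC addrK.
rewrite -e.
rewrite (_ : (fun s => _) = fun s => fcoef (component (U s) i) k j); last first.
  by apply/funext => s; rewrite mxE.
rewrite mxE (_ : component (partial 1 0 U t) i = fun x => derive1 (fun s => component (U s) i x) t); last first.
  by apply/funext => x; rewrite /component partial10E.
apply: (@is_derive_fcoef R (fun s => component (U s) i) k j t) => //.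
- by move=> s s0; apply: solution_ccont; apply: ltW.
- by move=> s x s0; have [] := sol_derivable sol x i s0.
- move=> s x s0.
  rewrite (_ : (fun z : R * R => _) = fun z => partial 1 0 U z.1 z.2 i 0).
    exact: (@continuous_entry R _ _ _ (fun z : R * R => partial 1 0 U z.1 z.2) (s, x) i 0
      (proj1 (sol_C1 sol x s0))).
  by apply/funext => z; rewrite partial10E.
Qed.

(** By the mode equation this is the j-th time derivative of the coefficients for
    t > 0.  The algebraic form makes sense at t = 0 as well, where it is the limit. *)
Definition modeD (k j : nat) (t : R) : 'M[R]_(m, 2) := iter j (mode_op k eps) (fmat k (U t)).

Lemma is_derive_modeD k n (t : R) i j : 0 < t ->
  is_derive t 1 (fun s => modeD k n s i j) (modeD k n.+1 t i j).
Proof.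
move=> t0; elim: n i j => [|n IH] i j; first exact: mode_ode.
exact: (is_derive_linear (mode_op k eps) IH).
Qed.

Lemma modeD_continuous k n i j : continuous (fun t : R => modeD k n `|t| i j).
Proof.
elim: n i j => [|n IH] i j; first exact: fmat_solution_continuous.
exact: (@continuous_linear_entry _ _ _ _ _ _ (mode_op k eps) (fun t : R => modeD k n `|t|) IH).
Qed.

(** The sine of frequency 0 is zero, so this column is not seen by the norm of a
    harmonic. *)
Lemma modeD_col0 n t i : modeD 0 n t i ord_max = 0.
Proof.
elim: n i => [|n IH] i.
  rewrite mxE /fcoef (_ : (fun x => _) = fun=> 0); first by rewrite pint_cst mul0r mulr0.
  by apply/funext => x; rewrite /trig /= mul0r sin0 mulr0.
rewrite /modeD /= -/(modeD 0 n t) /mode_op scale0r add0r !mxE big1 ?mulr0 // => l _.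
by rewrite IH mulr0.
Qed.

(** The part of frequency k of the solution, itself a solution by linearity.  Its
    initial value is smooth whatever the regularity of the data. *)
Definition harmonic k (t x : R) : 'cV[R]_m := fmat k (U `|t|) *m trigv k x.

Lemma mulmx_trigv_continuous k (F : R -> 'M[R]_(m, 2)) (z : R * R) i :
  (forall a b, {for z.1, continuous (fun t : R => F t a b)}) ->
  {for z, continuous (fun z : R * R => (F z.1 *m trigv k z.2) i 0)}.
Proof.
move=> cF; rewrite (_ : (fun w : R * R => _) = fun w => \sum_j F w.1 i j * trig k j w.2); last first.
  by apply/funext => w; rewrite mxE; apply: eq_bigr => j _; rewrite !mxE.
have c j : {for z, continuous (fun w : R * R => F w.1 i j * trig k j w.2)}.
  apply: cvgM.
    by apply: (@continuous_comp _ _ _ fst (fun t => F t i j) z); [exact: cvg_fst|exact: cF].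
  by apply: (@continuous_comp _ _ _ snd (@trig R k j) z); [exact: cvg_snd|exact: cont_trig].
rewrite (_ : (fun w : R * R => _) = fun w => F w.1 i ord0 * trig k ord0 w.2 + F w.1 i ord_max * trig k ord_max w.2).
  by apply: cvgD; apply: c.
by apply/funext => w; rewrite big_ord2.
Qed.

Lemma partial_harmonic_t k n (t x : R) : 0 < t ->
  partial n 0 (harmonic k) t x = modeD k n t *m trigv k x.
Proof.
move=> t0; apply/colP => i; rewrite mxE.
have -> : component (fun tau => vderiv 0 (harmonic k tau) x) i = fun s : R => (modeD k 0 `|s| *m trigv k x) i 0.
  by apply/funext => s; rewrite /component mxE.
elim: n t t0 => [|n IH] t t0; first by rewrite /= gtr0_norm.
rewrite derive1nS derive1E.
have d : is_derive t 1 (fun s => (modeD k n s *m trigv k x) i 0) ((modeD k n.+1 t *m trigv k x) i 0).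
  rewrite (_ : (fun s => _) = fun s => \sum_j (modeD k n s) i j * trig k j x); last first.
    by apply/funext => s; rewrite mxE; apply: eq_bigr => j _; rewrite !mxE.
  rewrite mxE (_ : \sum_j _ = \sum_j modeD k n.+1 t i j * trig k j x); last first.
    by apply: eq_bigr => j _; rewrite !mxE.
  apply: is_derive_bigsum_pt => j.
  have h := is_deriveM (is_derive_modeD k n i j t0) (is_derive_cst (trig k j x) t (1 : R)).
  by apply: is_derive_eq h _; rewrite /GRing.scale /= mulr0 add0r mulrC.
rewrite -(@derive_val _ _ _ _ _ _ _ d); apply: near_eq_derive.
near=> s; apply: IH; near: s; exact: near_pos.
Unshelve. all: by end_near. Qed.

Lemma partial_harmonic_x k (t x : R) :
  partial 0 1 (harmonic k) t x = (k%:R *: (fmat k (U `|t|) *m rotJ R)) *m trigv k x.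
Proof.
apply/colP => i; rewrite mxE /= /component mxE /= derive1E.
exact: (@derive_val _ _ _ _ _ _ _ (is_derive_harmonic k (fmat k (U `|t|)) i x)).
Qed.

Lemma harmonic_solution k : exact_solution A S eps (harmonic k 0) (harmonic k).
Proof.
split=> //.
- by move=> t _ x; rewrite /harmonic trigv_period.
- apply: continuous_subspaceT => z; apply: continuous_mx => i j.
  rewrite (ord1 j); apply: (@mulmx_trigv_continuous k (fun s : R => fmat k (U `|s|)) z i) => a b.
  exact: fmat_solution_continuous.
- move=> t x i t0; split; last by have [] := is_derive_harmonic k (fmat k (U `|t|)) i x.
  have d : is_derive t 1 (fun s => (modeD k 0 s *m trigv k x) i 0) ((modeD k 1 t *m trigv k x) i 0).
    rewrite (_ : (fun s => _) = fun s => \sum_j (modeD k 0 s) i j * trig k j x); last first.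
      by apply/funext => s; rewrite mxE; apply: eq_bigr => j _; rewrite !mxE.
    rewrite mxE (_ : \sum_j _ = \sum_j modeD k 1 t i j * trig k j x); last first.
      by apply: eq_bigr => j _; rewrite !mxE.
    apply: is_derive_bigsum_pt => j.
    have h := is_deriveM (is_derive_modeD k 0 i j t0) (is_derive_cst (trig k j x) t (1 : R)).
    by apply: is_derive_eq h _; rewrite /GRing.scale /= mulr0 add0r mulrC.
  have [dd _] := d; apply: near_eq_derivable dd.
  near=> s; rewrite /component /harmonic gtr0_norm //; near: s.
  exact: near_pos.
- move=> t x t0; split; apply: continuous_mx => i j; rewrite (ord1 j).
    have c : {for (t, x), continuous (fun z : R * R => (modeD k 1 `|z.1| *m trigv k z.2) i 0)}.
      apply: (@mulmx_trigv_continuous k (fun s : R => modeD k 1 `|s|)) => a b.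
      exact: modeD_continuous.
    apply: near_eq_continuous c; near=> z.
    have z1 : 0 < z.1.
      near: z; exists ([set s : R | 0 < s], setT) => /=; last by move=> [a b] [].
      by split; [exact: near_pos|exact: filterT].
    by rewrite (gtr0_norm z1) (partial_harmonic_t k 1 z.2 z1).
  rewrite (_ : (fun z : R * R => _) = fun z : R * R =>
    ((k%:R *: (fmat k (U `|z.1|) *m rotJ R)) *m trigv k z.2) i 0); last first.
    by apply/funext => z; rewrite partial_harmonic_x.
  apply: (@mulmx_trigv_continuous k (fun s : R => k%:R *: (fmat k (U `|s|) *m rotJ R))) => a b.
  rewrite (_ : (fun s => _) = fun s : R => k%:R * \sum_l fmat k (U `|s|) a l * rotJ R l b).
    move=> s; apply: cvgM; first exact: cvg_cst.
    apply: continuous_sum => l {}s; apply: cvgM; last exact: cvg_cst.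
    exact: fmat_solution_continuous.
  by apply/funext => s; rewrite !mxE.
- move=> t x t0; rewrite partial_harmonic_t // partial_harmonic_x gtr0_norm //.
  rewrite /modeD /= /mode_op /harmonic gtr0_norm // /transport mulmxDl -!scalemxAl.
  by rewrite mulNmx scalerN -scalemxAr !mulmxA addrC addrA subrr add0r.
Unshelve. all: by end_near. Qed.

End Modes.

(** * Norms of harmonics *)
Section SquareNorms.
Variables (R : realType) (m : nat).
Local Notation I := (@period_itv R).
Local Notation mu := (@lebesgue_measure R).
Implicit Types (u : R -> 'cV[R]_m) (z : 'M[R]_(m, 2)).

Definition sqsum u (x : R) : R := \sum_i component u i x ^+ 2.

Lemma continuous_sqsum u : ccont u -> continuous (sqsum u).
Proof.
move=> cu; apply: continuous_sum => i x.
rewrite (_ : (fun x => _) = fun x => component u i x * component u i x).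
  by apply: cvgM; exact: cu.
by apply/funext => y; rewrite expr2.
Qed.

Lemma L2sq_pint u : ccont u -> L2sq u = (pint (sqsum u))%:E.
Proof.
move=> cu; rewrite /L2sq /pint /Rintegral fineK //.
have := pintegrable_continuous (continuous_sqsum cu).
by move=> h; exact: (@integrable_fin_num _ _ R mu I (@measurable_period R) (EFin \o sqsum u) h).
Qed.

Lemma L2sq_le u B : ccont u -> (forall x, I x -> sqsum u x <= B) ->
  (L2sq u <= (B * (pi *+ 2))%:E)%E.
Proof.
move=> cu hB; rewrite L2sq_pint // lee_fin -pint_cst; apply: le_pint => //.
  exact: pintegrable_continuous (continuous_sqsum cu).
by apply: pintegrable_continuous => x; apply: cvg_cst.
Qed.

Lemma ccont_square_integrable u : ccont u -> square_integrable u.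
Proof.
move=> cu; split=> [i|]; last by rewrite L2sq_pint // ltry.
by have /integrableP[/measurable_EFinP] := pintegrable_continuous (cu i).
Qed.

Lemma ccont_harmonic k z : ccont (fun x => z *m trigv k x).
Proof. by move=> i; apply: cont_harmonic. Qed.

Lemma harmonic_entry_le k z x i : `|(z *m trigv k x) i 0| <= mxsize z.
Proof.
rewrite mxE; apply: le_trans (ler_norm_sum _ _ _) _.
apply: (@le_trans _ _ (\sum_j `|z i j|)).
  by apply: ler_sum => j _; rewrite normrM mxE ler_piMr // trig_le1.
by rewrite /mxsize [leRHS](bigD1 i) //= lerDl sumr_ge0 // => l _; apply: sumr_ge0.
Qed.

Lemma sqsum_harmonic_le k z x : sqsum (fun x => z *m trigv k x) x <= mxsize z ^+ 2.
Proof.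
rewrite expr2 {1}/mxsize mulr_suml; apply: ler_sum => i _.
rewrite /component -real_normK ?num_real // expr2.
apply: ler_pM => //; last exact: harmonic_entry_le.
rewrite mxE; apply: le_trans (ler_norm_sum _ _ _) _.
by apply: ler_sum => j _; rewrite normrM mxE ler_piMr // trig_le1.
Qed.

Definition harmonic_der k z : 'M[R]_(m, 2) := k%:R *: (z *m rotJ R).

Lemma mxsize_harmonic_der k z : mxsize (harmonic_der k z) = k%:R * mxsize z.
Proof.
rewrite /mxsize mulr_sumr; apply: eq_bigr => i _; rewrite mulr_sumr !big_ord2.
rewrite !mxE !big_ord2 !mxE /= !normrM ger0_norm //.
by rewrite !(mulr0, mulr1, mulrN1, mulrN, oppr0, add0r, addr0, normrN, mulrDr) addrC.
Qed.

Lemma mxsize_iter_harmonic_der k z n : mxsize (iter n (harmonic_der k) z) = k%:R ^+ n * mxsize z.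
Proof. by elim: n => [|n IH]; rewrite ?expr0 ?mul1r //= mxsize_harmonic_der IH exprS mulrA. Qed.

Lemma smooth_continuous (phi : R -> R) n : smooth phi -> continuous (derive1n n phi).
Proof. by move=> sp x; apply: differentiable_continuous; apply/derivable1_diffP. Qed.

Lemma weak_derivative_harmonic k z :
  weak_derivative (fun x => z *m trigv k x) (fun x => harmonic_der k z *m trigv k x).
Proof.
move=> phi sphi pphi i.
have dphi (x : R) : is_derive x 1 phi (derive1 phi x).
  by rewrite derive1E; apply: derivableP; apply: (sphi 0%N).
have cphi : continuous phi := @smooth_continuous phi 0 sphi.
have cphi' : continuous (derive1 phi) := @smooth_continuous phi 1 sphi.
have cw := @ccont_harmonic k z i; have cw' := @ccont_harmonic k (harmonic_der k z) i.
pose w := component (fun x => z *m trigv k x) i.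
pose w' := component (fun x => harmonic_der k z *m trigv k x) i.
have dP (x : R) : is_derive x 1 (fun x => w x * phi x) (w' x * phi x + w x * derive1 phi x).
  have h := is_deriveM (is_derive_harmonic k z i x) (dphi x).
  apply: is_derive_eq h _; rewrite /GRing.scale /= addrC; congr (_ + _).
  by rewrite mulrC.
have i1 : pintegrable (fun x => w' x * phi x) by apply: pintegrable_mul.
have i2 : pintegrable (fun x => w x * derive1 phi x) by apply: pintegrable_mul.
have e := pint_derivative dP.
have w_pi : w pi = w (- pi).
  rewrite /w /component -(trigv_period k (- pi)); congr ((_ *m trigv k _) i 0).
  by rewrite mulr2n addrA addNr add0r.
have phi_pi : phi pi = phi (- pi).
  by rewrite -(pphi (- pi)); congr phi; rewrite mulr2n addrA addNr add0r.
rewrite pintD // w_pi phi_pi subrr in e.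
have {}e := e _; rewrite -/(pint (fun x => w x * derive1 phi x)) -/(pint (fun x => w' x * phi x)).
apply/eqP; rewrite -addr_eq0 addrC e // => x.
by apply: cvgD; apply: cvgM; [exact: cw'|exact: cphi|exact: cw|exact: cphi'].
Qed.

(** The infimum defining the norm is tested with the classical derivatives. *)
Lemma Hnormsq_harmonic q k z :
  (Hnormsq q (fun x => z *m trigv k x) <=
   (q.+1%:R * (pi *+ 2) * ((1 + k%:R) ^+ q * mxsize z) ^+ 2)%:E)%E.
Proof.
pose w n x := iter n (harmonic_der k) z *m trigv k x.
apply: (@le_trans _ _ (\sum_(j < q.+1) L2sq (w j))%E).
  apply: ereal_inf_lbound; exists w; split=> //.
  - by move=> j _; apply: ccont_square_integrable; apply: ccont_harmonic.
  - by move=> j _; apply: weak_derivative_harmonic.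
set B := (1 + k%:R) ^+ q * mxsize z.
have B0 : 0 <= B by rewrite mulr_ge0 ?mxsize_ge0 // exprn_ge0 // addr_ge0.
have wj (j : 'I_q.+1) : (L2sq (w j) <= (B ^+ 2 * (pi *+ 2))%:E)%E.
  apply: L2sq_le => [|x _]; first exact: ccont_harmonic.
  apply: le_trans (sqsum_harmonic_le _ _ _) _; rewrite mxsize_iter_harmonic_der.
  rewrite ler_pXn2r ?nnegrE ?mulr_ge0 ?mxsize_ge0 ?exprn_ge0 //.
  rewrite ler_wpM2r ?mxsize_ge0 //.
  apply: (@le_trans _ _ ((1 + k%:R) ^+ j)).
    by rewrite lerXn2r ?nnegrE ?addr_ge0 // lerDr.
  by apply: ler_weXn2l; [rewrite lerDl|rewrite -ltnS].
apply: le_trans (lee_sum _ (fun j _ => wj j)) _.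
rewrite sumEFin lee_fin sumr_const card_ord -[leLHS]mulr_natl le_eqVlt.
by apply/orP; left; apply/eqP; move: (@pi R *+ 2) => c; ring.
Qed.

Lemma pint_trig_mul k i j : pint (fun x => trig k i x * trig k j x) =
  if k == 0%N then (if (i == ord0) && (j == ord0) then pi *+ 2 else 0)
  else (if i == j then pi else 0) :> R.
Proof.
have ic : pintegrable (fun x : R => cos (((k + k)%:R - 0%:R) * x + 0)).
  by apply: pintegrable_continuous; apply: cont_cos_affine.
have is_ : pintegrable (fun x : R => sin (((k + k)%:R - 0%:R) * x + 0)).
  by apply: pintegrable_continuous; apply: cont_sin_affine.
have i1 (a : R) : pintegrable (fun=> a) by apply: pintegrable_continuous => x; apply: cvg_cst.
have e (x : R) : ((k + k)%:R - 0%:R) * x + 0 = (k%:R * x + 0) + (k%:R * x + 0).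
  by rewrite natrD; ring.
have [k0|k0] := eqVneq k 0%N.
  have t0 l (x : R) : trig k l x = if l == ord0 then 1 else 0.
    by rewrite /trig k0 mul0r cos0 sin0.
  rewrite (_ : (fun x => _) = fun=> (if (i == ord0) && (j == ord0) then 1 else 0)).
    by rewrite pint_cst; case: ifP => _; rewrite ?mul1r ?mul0r.
  by apply/funext => x; rewrite !t0; case: eqP => _; case: eqP => _; rewrite ?mulr1 ?mulr0.
have kk : (k + k != 0)%N by rewrite addnn double_eq0.
have zc : pint (fun x : R => cos (((k + k)%:R - 0%:R) * x + 0)) = 0 by apply: pint_cos_affine.
have zs : pint (fun x : R => sin (((k + k)%:R - 0%:R) * x + 0)) = 0 by apply: pint_sin_affine.
have lin (a b : R) (h : R -> R) : pintegrable h -> pint h = 0 ->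
    pint (fun x => a + b * h x) = a * (pi *+ 2).
  by move=> ih h0; rewrite pintD ?pintZ ?h0 ?mulr0 ?addr0 ?pint_cst //; exact: pintegrableZ.
rewrite !trigE.
have [->|->] : i = ord0 \/ i = ord_max by case: i => -[|[|//]] h; [left|right]; apply/val_inj.
all: have [->|->] : j = ord0 \/ j = ord_max by case: j => -[|[|//]] h; [left|right]; apply/val_inj.
- rewrite /= (_ : (fun x => _) = fun x : R => 2^-1 + 2^-1 * cos (((k + k)%:R - 0%:R) * x + 0)).
    by rewrite lin // -(mulr_natl pi) mulrA mulVf // mul1r.
  by apply/funext => x; rewrite e cosMcos subrr cos0 mulr1.
- rewrite /= (_ : (fun x => _) = fun x : R => 0 + 2^-1 * sin (((k + k)%:R - 0%:R) * x + 0)).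
    by rewrite lin // mul0r.
  by apply/funext => x; rewrite e cosMsin subrr sin0 mulr0.
- rewrite /= (_ : (fun x => _) = fun x : R => 0 + 2^-1 * sin (((k + k)%:R - 0%:R) * x + 0)).
    by rewrite lin // mul0r.
  by apply/funext => x; rewrite e sinMcos subrr sin0 mulr0.
- rewrite /= (_ : (fun x => _) = fun x : R => 2^-1 + (- 2^-1) * cos (((k + k)%:R - 0%:R) * x + 0)).
    by rewrite lin // -(mulr_natl pi) mulrA mulVf // mul1r.
  by apply/funext => x; rewrite e sinMsin subrr cos0 mulr1.
Qed.

Lemma L2sq_harmonic_ge k z : (k = 0%N -> forall i, z i ord_max = 0) ->
  ((pi * \sum_i \sum_j z i j ^+ 2)%:E <= L2sq (fun x => (z *m trigv k x)%R))%E.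
Proof.
move=> z0; rewrite L2sq_pint ?lee_fin; last exact: ccont_harmonic.
rewrite /sqsum.
have ic i : pintegrable (fun x => component (fun x => z *m trigv k x) i x ^+ 2).
  apply: pintegrable_continuous => x.
  rewrite (_ : (fun x => _) = fun x => component (fun x => z *m trigv k x) i x * component (fun x => z *m trigv k x) i x).
    by apply: cvgM; exact: ccont_harmonic.
  by apply/funext => y; rewrite expr2.
rewrite (proj2 (@pint_sum R _ _ xpredT _ (fun i _ => ic i))) mulr_sumr.
apply: ler_sum => i _.
have it a b : pintegrable (fun x => @trig R k a x * trig k b x).
  by apply: pintegrable_mul; exact: cont_trig.
rewrite (_ : (fun x => _) = fun x =>
  (z i ord0 ^+ 2 * (trig k ord0 x * trig k ord0 x) +
   2 * z i ord0 * z i ord_max * (trig k ord0 x * trig k ord_max x)) +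
   z i ord_max ^+ 2 * (trig k ord_max x * trig k ord_max x)); last first.
  by apply/funext => x; rewrite /component mxE big_ord2 !mxE; ring.
rewrite pintD; [|by apply: pintegrableD; exact: pintegrableZ|exact: pintegrableZ].
rewrite pintD; [|exact: pintegrableZ|exact: pintegrableZ].
rewrite !pintZ // !pint_trig_mul /= big_ord2.
have p0 := pi_gt0 R; have := sqr_ge0 (z i ord0).
case: eqP => k0.
  rewrite (z0 k0) !expr0n /= !mulr0 !addr0 mulr2n => h; move: (@pi R) p0 => q; nra.
rewrite !mulr0 !addr0 => h; rewrite le_eqVlt; apply/orP; left; apply/eqP.
by move: (@pi R) => q; ring.
Qed.

Lemma mxsize_sq_le z : mxsize z ^+ 2 <= (m.+1%:R * 2) ^+ 2 * \sum_i \sum_j z i j ^+ 2.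
Proof.
set T := \sum_i _; have T0 : 0 <= T by apply: sumr_ge0 => i _; apply: sumr_ge0 => j _; apply: sqr_ge0.
have b i j : `|z i j| <= Num.sqrt T.
  rewrite -sqrtr_sqr ler_wsqrtr // /T (bigD1 i) //= (bigD1 j) //= -addrA lerDl.
  by rewrite addr_ge0 ?sumr_ge0 // => l _; rewrite ?sumr_ge0 ?sqr_ge0 // => l' _; rewrite sqr_ge0.
have h : mxsize z <= m.+1%:R * 2 * Num.sqrt T.
  apply: (@le_trans _ _ (\sum_(i < m) (Num.sqrt T *+ 2))).
    by apply: ler_sum => i _; rewrite big_ord2 mulr2n lerD.
  rewrite sumr_const card_ord -[Num.sqrt T *+ 2]mulr_natl -[leLHS]mulr_natl.
  rewrite mulrA ler_wpM2r ?sqrtr_ge0 // ler_wpM2r // ler_nat //.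
have s0 : 0 <= mxsize z := mxsize_ge0 z.
by have := ler_pM s0 s0 h h; rewrite -!expr2 exprMn sqr_sqrtr.
Qed.

End SquareNorms.

(** * Regularity of the modes *)
Section Decay.
Variables (R : realType) (m : nat).
Local Notation I := (@period_itv R).
Local Notation mu := (@lebesgue_measure R).
Implicit Types (u w : R -> 'cV[R]_m).

Lemma L2sq_ge0 u : (0 <= L2sq u)%E.
Proof.
by apply: integral_ge0 => x _; rewrite lee_fin sumr_ge0 // => i _; exact: sqr_ge0.
Qed.

Lemma component_sq_bound w B i : square_integrable w -> (L2sq w <= B%:E)%E ->
  pintegrable (fun x => component w i x ^+ 2) /\ pint (fun x => component w i x ^+ 2) <= B.
Proof.
move=> [mw _] hB.
have ms l : measurable_fun I (fun x => component w l x ^+ 2) by apply: measurable_funX.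
have le : (\int[mu]_(x in I) (component w i x ^+ 2)%:E <= L2sq w)%E.
  apply: ge0_le_integral => //.
  - exact: measurable_period.
  - by move=> x _; rewrite lee_fin sqr_ge0.
  - by apply/measurable_EFinP; exact: ms.
  - by apply/measurable_EFinP; apply: measurable_sum => l; exact: ms.
  - move=> x _; rewrite lee_fin (bigD1 i) //= lerDl sumr_ge0 // => l _; exact: sqr_ge0.
have ii : pintegrable (fun x => component w i x ^+ 2).
  apply/integrableP; split; first by apply/measurable_EFinP; exact: ms.
  under eq_integral => x _ do rewrite /= ger0_norm ?sqr_ge0 //.
  exact: le_lt_trans (le_trans le hB) (ltry _).
split=> //; rewrite -lee_fin /pint /Rintegral fineK; first exact: le_trans le hB.
exact: (@integrable_fin_num _ _ R mu I (@measurable_period R) _ ii).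
Qed.

Lemma pintegrable_bounded_mul (f h : R -> R) : measurable_fun I f ->
  pintegrable (fun x => f x ^+ 2) -> continuous h -> (forall x, `|h x| <= 1) ->
  pintegrable (fun x => f x * h x).
Proof.
move=> mf if2 ch h1.
have i1 : pintegrable (fun x => f x ^+ 2 + 1).
  apply: pintegrableD => //.
  by apply: pintegrable_continuous => x; apply: cvg_cst.
apply: (@le_integrable _ _ R mu I (@measurable_period R) (EFin \o (fun x => f x * h x)) (EFin \o (fun x => f x ^+ 2 + 1)) _ _ i1).
  apply/measurable_EFinP; apply: measurable_funM => //.
  by have /integrableP[/measurable_EFinP] := pintegrable_continuous ch.
move=> x _ /=; rewrite lee_fin normrM.
have := h1 x; have := normr_ge0 (h x); have := normr_ge0 (f x).
rewrite -[f x ^+ 2]real_normK ?num_real // (ger0_norm (_ : 0 <= `|f x| ^+ 2 + 1)); last first.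
  by rewrite addr_ge0 // sqr_ge0.
move=> ? ? ?; nra.
Qed.

(** Testing the weak derivatives with the trigonometric functions of frequency k shows
    that each of them multiplies the size of the coefficients by k; those of the last
    one are bounded by its L^2 norm.  The factor 2^q passes from k^q to (1 + k)^q. *)
Lemma Hnormsq_decay q u K k : ccont u -> (Hnormsq q u <= K%:E)%E ->
  (1 + k%:R) ^+ q * mxsize (fmat k u) <= m%:R * (2 ^+ q * (2 * (`|K| + 1 + pi *+ 2))).
Proof.
move=> cu hK; set B := `|K| + 1.
have K1 : (Hnormsq q u < B%:E)%E.
  by apply: le_lt_trans hK _; rewrite lte_fin /B; have := ler_norm K; lra.
have [a [w [w0 sw ww aE]] aB] := ereal_inf_lt K1.
have wB j : (j <= q)%N -> (L2sq (w j) <= B%:E)%E.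
  move=> jq; apply: le_trans (ltW aB); rewrite aE.
  rewrite (bigD1 (Ordinal (jq : (j < q.+1)%N))) //= leeDl // sume_ge0 // => l _.
  exact: L2sq_ge0.
pose d j i l := pint (fun x => component (w j) i x * trig k l x).
have ct l : continuous (@trig R k l) by exact: cont_trig.
have t1 l x : `|@trig R k l x| <= 1 by exact: trig_le1.
have iw j i l : (j <= q)%N -> pintegrable (fun x => component (w j) i x * trig k l x).
  move=> jq; apply: pintegrable_bounded_mul => //; first by have [h _] := sw j jq; exact: h.
  by have [] := component_sq_bound i (sw j jq) (wB j jq).
have dq i l : `|d q i l| <= B + pi *+ 2.
  have [i2 b2] := component_sq_bound i (sw q (leqnn q)) (wB q (leqnn q)).
  apply: le_trans (pint_sq_le (iw q i l (leqnn q)) i2 (t1 l)) _.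
  by rewrite lerD2r.
have step j i : (j < q)%N -> k%:R * (`|d j i ord0| + `|d j i ord_max|) =
    `|d j.+1 i ord0| + `|d j.+1 i ord_max|.
  move=> jq; have jq' := ltnW jq.
  have dt l x : derive1 (@trig R k l) x =
      (if l == ord0 then - k%:R * trig k ord_max x else k%:R * trig k ord0 x).
    by rewrite derive1E (@derive_val _ _ _ _ _ _ _ (is_derive_trig k l x)).
  have h l := ww j jq (trig k l) (@smooth_trig R k l) (@periodic_trig R k l) i.
  have h0 : - k%:R * d j i ord_max = - d j.+1 i ord0.
    rewrite -(h ord0) /d -pintZ; last exact: iw.
    apply: (congr1 (@pint R)); apply/funext => x.
    by rewrite dt /= mulrCA.
  have h1 : k%:R * d j i ord0 = - d j.+1 i ord_max.
    rewrite -(h ord_max) /d -pintZ; last exact: iw.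
    apply: (congr1 (@pint R)); apply/funext => x.
    by rewrite dt /= mulrCA.
  rewrite mulrDr addrC -[X in X * _ + X * _](@ger0_norm _ k%:R) //.
  by rewrite -!normrM -[`|_ * d j i ord_max|]normrN -mulNr h0 h1 !normrN.
have iterd i j : (j <= q)%N -> k%:R ^+ j * (`|d 0%N i ord0| + `|d 0%N i ord_max|) =
    `|d j i ord0| + `|d j i ord_max|.
  elim: j => [|j IH] jq; first by rewrite expr0 mul1r.
  by rewrite exprS -mulrA IH ?step // ltnW.
have d0b i : (1 + k%:R) ^+ q * (`|d 0%N i ord0| + `|d 0%N i ord_max|) <=
    2 ^+ q * (2 * (B + pi *+ 2)).
  have bq : (`|d q i ord0| + `|d q i ord_max|) <= 2 * (B + pi *+ 2).
    by have := dq i ord0; have := dq i ord_max; move: (B + _) => c; lra.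
  have [k0|k0] := eqVneq k 0%N; last first.
    apply: le_trans (_ : 2 ^+ q * (k%:R ^+ q * (`|d 0%N i ord0| + `|d 0%N i ord_max|)) <= _).
      rewrite mulrA -exprMn ler_wpM2r ?addr_ge0 //.
      rewrite lerXn2r ?nnegrE ?addr_ge0 ?mulr_ge0 //.
      have : 1 <= k%:R :> R by rewrite ler1n lt0n.
      by lra.
    by rewrite iterd // ler_wpM2l ?exprn_ge0 // bq.
  have [i2 b2] := component_sq_bound i (sw 0%N (leq0n q)) (wB 0%N (leq0n q)).
  have d0 l : `|d 0%N i l| <= B + pi *+ 2.
    apply: le_trans (pint_sq_le (iw 0%N i l (leq0n q)) i2 (t1 l)) _.
    by rewrite lerD2r.
  rewrite k0 addr0 expr1n mul1r.
  have B0 : 0 <= B + pi *+ 2 by apply: le_trans (d0 ord0).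
  apply: (@le_trans _ _ (2 * (B + pi *+ 2))).
    by have := d0 ord0; have := d0 ord_max; move: (B + _) => c; lra.
  by rewrite ler_peMl ?mulr_ge0 // exprn_ege1 // ler1n.
rewrite /mxsize mulr_sumr -[X in X%:R * _]card_ord mulr_natl -sumr_const.
apply: ler_sum => i _; apply: le_trans (d0b i).
rewrite ler_wpM2l ?exprn_ge0 ?addr_ge0 // big_ord2.
have wl l : `|fmat k u i l| <= `|d 0%N i l|.
  rewrite mxE /fcoef normrM /d w0 ler_piMl //.
  have p1 := pi_ge2 R; rewrite ger0_norm ?divr_ge0 ?(ltW (pi_gt0 R)) //; last first.
    by rewrite /weight; case: ifP.
  rewrite ler_pdivrMr ?pi_gt0 // mul1r /weight; case: ifP => _; lra.
by rewrite lerD.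
Qed.

End Decay.

Section Regularity.
Variable R : realType.

Lemma right_limit_le (h : R -> R) B : continuous h ->
  (forall t, 0 < t -> h t <= B) -> h 0 <= B.
Proof.
move=> ch hB; apply/ler_addgt0Pr => e e0.
have /cvgrPdist_lt/(_ e e0) [d /= d0 hd] := ch 0.
have d2 : 0 < d / 2 by rewrite divr_gt0.
have h1 := hB _ d2; have := hd (d / 2).
rewrite /ball_ /= sub0r normrN gtr0_norm // => h2.
have := h2 (ltac:(lra)); rewrite ltr_distl => /andP[_ h3]; lra.
Qed.

(** The logarithm is negative for eps > 1, so that the threshold need not increase
    with j. *)
Lemma initial_layer_le (delta eps T0 : R) (j q : nat) : (j <= q)%N -> 0 <= T0 ->
  2%:R * delta^-1 * q%:R * eps * ln (1 / eps) <= T0 ->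
  2%:R * delta^-1 * j%:R * eps * ln (1 / eps) <= T0.
Proof.
move=> jq T00.
have e (n : nat) : 2%:R * delta^-1 * n%:R * eps * ln (1 / eps) =
  n%:R * (2%:R * delta^-1 * eps * ln (1 / eps)) by ring.
rewrite !e; set L := 2%:R * _ * _ * _ => h.
have [L0|L0] := lerP L 0.
  by apply: le_trans T00; apply: mulr_ge0_le0.
by apply: le_trans h; rewrite ler_wpM2r ?(ltW L0) // ler_nat.
Qed.

Variables (p r : nat) (A : 'M[R]_(p + r)) (S : 'M[R]_r) (delta0 : R).
Hypothesis regular : regularity_constant A S delta0.
Local Notation m := (p + r)%N.

(** The regularity estimate of order n applied to a harmonic, whose H^n norm costs
    (1 + k)^n.  It is available for t > 0 only, so t = 0 is reached as a limit. *)
Lemma mode_regular n : exists2 C : R, 0 <= C & forall eps Uin U k t,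
  0 < eps -> exact_solution A S eps Uin U -> 0 <= t ->
  2%:R * delta0^-1 * n%:R * eps * ln (1 / eps) <= t ->
  mxsize (modeD A S eps U k n t) <= C * ((1 + k%:R) ^+ n * mxsize (fmat k (U 0))).
Proof.
have [_ /(_ n) [C C0 hC]] := regular.
pose C2 := (m.+1%:R * 2) ^+ 2 * (C * (n.+1%:R * 2)).
have C20 : 0 <= C2 by rewrite mulr_ge0 ?sqr_ge0 // mulr_ge0 ?(ltW C0) // mulr_ge0.
exists (1 + C2); first by rewrite addr_ge0.
move=> eps Uin U k t eps0 sol t0 thr.
set z := fmat k (U 0); set X := (1 + k%:R) ^+ n * mxsize z.
have X0 : 0 <= X by rewrite mulr_ge0 ?mxsize_ge0 // exprn_ge0 // addr_ge0.
have main s : 0 < s -> 2%:R * delta0^-1 * n%:R * eps * ln (1 / eps) <= s ->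
    mxsize (modeD A S eps U k n s) <= (1 + C2) * X.
  move=> s0 hs; have hsol := harmonic_solution sol k.
  have hE : harmonic U k 0 = (fun x => z *m trigv k x) by apply/funext => x; rewrite /harmonic normr0.
  rewrite hE in hsol.
  have sm i : smooth (component (fun x => z *m trigv k x) i) by apply: smooth_harmonic.
  have pz : periodic (fun x => z *m trigv k x) (pi *+ 2) by move=> x; rewrite trigv_period.
  have [_ /(_ s s0 hs) [/(_ n 0%N) h _]] := hC eps _ _ eps0 sm pz hsol.
  have {h} := h ltac:(by rewrite addn0).
  rewrite (_ : partial n 0 (harmonic U k) s = (fun x => modeD A S eps U k n s *m trigv k x)); last first.
    by apply/funext => x; exact: (partial_harmonic_t sol k n x s0).
  set Y := modeD A S eps U k n s => h.
  have h1 : (Hnormsq n (fun x => z *m trigv k x) <= (n.+1%:R * (pi *+ 2) * X ^+ 2)%:E)%E.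
    exact: Hnormsq_harmonic.
  have h2 : (C%:E * Hnormsq n (fun x => (z *m trigv k x)%R) <= (C * (n.+1%:R * (pi *+ 2) * X ^+ 2))%:E)%E.
    by rewrite EFinM lee_pmul2l // lte_fin.
  have Y0 : k = 0%N -> forall i, Y i ord_max = 0 by rewrite /Y => -> i; apply: modeD_col0.
  have := le_trans (L2sq_harmonic_ge Y0) (le_trans h h2).
  rewrite lee_fin => h3; have h4 := mxsize_sq_le Y.
  set W := \sum_i _ in h3 h4.
  have h5 : W <= C * (n.+1%:R * 2) * X ^+ 2.
    rewrite -(ler_pM2l (pi_gt0 R)); apply: le_trans h3 _.
    by rewrite le_eqVlt; apply/orP; left; apply/eqP; move: (@pi R) => q; ring.
  have h6 : mxsize Y ^+ 2 <= C2 * X ^+ 2.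
    by apply: le_trans h4 _; rewrite /C2 -[leRHS]mulrA ler_wpM2l // sqr_ge0.
  have Z0 : 0 <= (1 + C2) * X by rewrite mulr_ge0 // addr_ge0.
  rewrite -(ler_pXn2r (n := 2)) ?nnegrE ?mxsize_ge0 //.
  by apply: le_trans h6 _; rewrite [((1 + C2) * X) ^+ 2]exprMn ler_wpM2r ?sqr_ge0 //; nra.
have [t_eq0|t_neq0] := eqVneq t 0; last by apply: main => //; rewrite lt_def t_neq0.
have hlim : continuous (fun s : R => mxsize (modeD A S eps U k n `|s|)).
  apply: continuous_sum => i; apply: continuous_sum => j s.
  by apply: cvg_norm; exact: (modeD_continuous sol).
have := right_limit_le (B := (1 + C2) * X) hlim; rewrite normr0 t_eq0; apply => s s0.
rewrite gtr0_norm //; apply: main => //; apply: le_trans thr _.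
by rewrite t_eq0 ltW.
Qed.

End Regularity.

Section MeanValue.
Variable R : realType.

Lemma mean_value_bound (g dg : R -> R) a b G : 0 <= a -> a <= b -> continuous g ->
  (forall t : R, 0 < t -> is_derive t 1 g (dg t)) ->
  (forall t : R, a < t < b -> `|dg t| <= G) -> `|g b - g a| <= (b - a) * G.
Proof.
move=> a0 ab cg hg hG; have [->|ab'] := eqVneq a b; first by rewrite !subrr normr0 mul0r.
have {ab ab'} ab : a < b by rewrite lt_def eq_sym ab' ab.
have dg' (t : R) : t \in `]a, b[ -> is_derive t 1 g (dg t).
  by rewrite in_itv /= => /andP[at_ _]; apply: hg; exact: le_lt_trans at_.
have [c hc ->] := @MVT R g dg a b ab dg' (continuous_subspaceT cg).
rewrite normrM mulrC (gtr0_norm (_ : 0 < b - a)) ?subr_gt0 //.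
by rewrite ler_wpM2l ?subr_ge0 ?(ltW ab) // hG //; move: hc; rewrite in_itv.
Qed.

(** The Taylor polynomial at s evaluated at b is differentiated in s: its derivative
    is (b - s)^3 / 6 times the fourth derivative.  Derivatives are needed for positive
    times only, which allows a = 0. *)
Lemma taylor3_bound (h : nat -> R -> R) a b G : 0 <= a -> a <= b ->
  (forall n, continuous (h n)) ->
  (forall n (t : R), 0 < t -> is_derive t 1 (h n) (h n.+1 t)) ->
  (forall t : R, a < t < b -> `|h 4%N t| <= G) ->
  `|h 0%N a + (b - a) * h 1%N a + (b - a) ^+ 2 / 2 * h 2%N a
     + (b - a) ^+ 3 / 6 * h 3%N a - h 0%N b| <= (b - a) ^+ 4 * G.
Proof.
move=> a0 ab ch dh hG.
have [eab|nab] := eqVneq a b.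
  by rewrite eab subrr !expr0n /= !mul0r !addr0 subrr normr0.
have {ab nab} ab : a < b by rewrite lt_def eq_sym nab ab.
pose g s := ((h 0%N s + (b - s) * h 1%N s) + (b - s) ^+ 2 / 2 * h 2%N s) + (b - s) ^+ 3 / 6 * h 3%N s.
pose dg s := (b - s) ^+ 3 / 6 * h 4%N s.
have dw (t : R) : is_derive t 1 (fun s : R => b - s) (-1).
  have := is_deriveB (is_derive_cst b t 1) (is_derive_id t 1).
  by move=> h1; apply: is_derive_eq h1 _; rewrite sub0r.
have cw : continuous (fun s : R => b - s).
  by move=> t; apply: cvgB; [exact: cvg_cst|exact: cvg_id].
have cwn n : continuous (fun s : R => (b - s) ^+ n).
  elim: n => [|n IH] t.
    by rewrite (_ : (fun s => _) = fun=> 1); [exact: cvg_cst|apply/funext => s; rewrite expr0].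
  rewrite (_ : (fun s => _) = fun s => (b - s) * (b - s) ^+ n).
    by apply: cvgM; [exact: cw|exact: IH].
  by apply/funext => s; rewrite exprS.
have cterm n c l : continuous (fun s : R => (b - s) ^+ n / c * h l s).
  by move=> t; apply: cvgM; [apply: cvgM; [exact: cwn|exact: cvg_cst]|exact: ch].
have cg : continuous g.
  move=> t; apply: cvgD; [apply: cvgD; [apply: cvgD; [exact: ch|]|]|exact: cterm]; last exact: cterm.
  by apply: cvgM; [exact: cw|exact: ch].
have dwn n (t : R) : is_derive t 1 (fun s : R => (b - s) ^+ n.+1) (- n.+1%:R * (b - t) ^+ n).
  elim: n => [|n IH].
    apply: (@is_derive_eq _ _ _ _ _ _ _ _ (dw t)); by rewrite expr0 mulr1.
  rewrite (_ : (fun s : R => (b - s) ^+ n.+2) = fun s => (b - s) * (b - s) ^+ n.+1); last first.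
    by apply/funext => s; rewrite exprS.
  have h1 := is_deriveM (dw t) IH; apply: is_derive_eq h1 _.
  by rewrite /GRing.scale /= !exprS -!natr1; ring.
have dterm n c l (t : R) : 0 < t -> is_derive t 1 (fun s : R => (b - s) ^+ n.+1 / c * h l s)
    (- n.+1%:R * (b - t) ^+ n / c * h l t + (b - t) ^+ n.+1 / c * h l.+1 t).
  move=> t0; have h1 := is_deriveM (is_deriveM (dwn n t) (is_derive_cst c^-1 t (1 : R))) (dh l t t0).
  apply: is_derive_eq h1 _; rewrite /GRing.scale /=.
  rewrite -[X in X * h l.+1 t + _]/((b - t) ^+ n.+1 * c^-1); ring.
have dgE (t : R) : 0 < t -> is_derive t 1 g (dg t).
  move=> t0; have h1 := is_deriveD (is_deriveD (is_deriveD (dh 0%N t t0)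
     (is_deriveM (dw t) (dh 1%N t t0))) (dterm 1%N 2 2%N t t0)) (dterm 2%N 6 3%N t t0).
  apply: is_derive_eq h1 _; by rewrite /dg /GRing.scale /=; field.

have hG' (s : R) : a < s < b -> `|dg s| <= (b - a) ^+ 3 * G.
  move=> /andP[h1 h2]; have sb : 0 <= b - s by rewrite subr_ge0 ltW.
  rewrite /dg normrM; apply: ler_pM => //; last by apply: hG; rewrite h1 h2.
  rewrite ger0_norm ?divr_ge0 ?exprn_ge0 //.
  apply: (@le_trans _ _ ((b - s) ^+ 3)).
    by have := exprn_ge0 3 sb; move: ((b - s) ^+ 3) => q; lra.
  by apply: lerXn2r; rewrite ?nnegrE //; lra.
have gb : g b = h 0%N b by rewrite /g subrr !expr0n /= !mul0r !addr0.
have := mean_value_bound a0 (ltW ab) cg dgE hG'; rewrite gb distrC => h1.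
by rewrite [(b - a) ^+ 4]exprS -[leRHS]mulrA.
Qed.

End MeanValue.

Section SolutionModes.
Variables (R : realType) (p r : nat) (A : 'M[R]_(p + r)) (S : 'M[R]_r) (delta0 : R).
Local Notation m := (p + r)%N.

Lemma is_derive_modeD_norm eps Uin U k n (t : R) i j : exact_solution A S eps Uin U -> 0 < t ->
  is_derive t 1 (fun s => modeD A S eps U k n `|s| i j) (modeD A S eps U k n.+1 `|t| i j).
Proof.
move=> sol t0; have d := is_derive_modeD sol k n i j t0.
have e : \forall s \near t, modeD A S eps U k n s i j = modeD A S eps U k n `|s| i j.
  near=> s; rewrite gtr0_norm //; near: s; exact: near_pos.
rewrite [X in modeD _ _ _ _ _ _ X]gtr0_norm //.
exact: near_eq_is_derive e d.
Unshelve. all: by end_near. Qed.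

Lemma mxsize_entry_le (z : 'M[R]_(m, 2)) a : (forall i j, `|z i j| <= a) ->
  mxsize z <= (m * 2)%:R * a.
Proof.
move=> h; apply: (@le_trans _ _ (\sum_(i < m) \sum_(j < 2) a)).
  by apply: ler_sum => i _; apply: ler_sum => j _; apply: h.
by rewrite !sumr_const !card_ord -mulrnA mulr_natl mulnC.
Qed.

Lemma entry_le_mxsize (z : 'M[R]_(m, 2)) i j : `|z i j| <= mxsize z.
Proof.
rewrite /mxsize (bigD1 i) //= (bigD1 j) //= -addrA lerDl addr_ge0 //.
  by rewrite sumr_ge0.
by apply: sumr_ge0 => l _; apply: sumr_ge0.
Qed.

Hypothesis regular : regularity_constant A S delta0.
Variables (Uin : R -> R -> 'cV[R]_m) (T0 : R -> R).
Hypothesis consistent : consistent_data 8 delta0 Uin T0.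

(** The growth (1 + k)^j of the time derivatives is balanced by the decay (1 + k)^-8
    of the initial coefficients. *)
Lemma solution_modes : exists2 G : R, 0 <= G & forall eps U k j t,
  0 < eps -> exact_solution A S eps (Uin eps) U -> (j <= 4)%N -> T0 eps <= t ->
  mxsize (modeD A S eps U k j t) <= (1 + k%:R) ^+ j * (G / (1 + k%:R) ^+ 8).
Proof.
have [[K hK] hT] := consistent.
pose B : R := m%:R * (2 ^+ 8 * (2 * (`|K| + 1 + pi *+ 2))).
have B0 : 0 <= B.
  have p0 : 0 <= pi *+ 2 :> R by rewrite mulrn_wge0 // pi_ge0.
  by rewrite /B; rewrite mulr_ge0 // mulr_ge0 ?exprn_ge0 // mulr_ge0 // addr_ge0 // addr_ge0.
have [C0 C00 h0] := mode_regular regular 0.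
have [C1 C10 h1] := mode_regular regular 1.
have [C2 C20 h2] := mode_regular regular 2.
have [C3 C30 h3] := mode_regular regular 3.
have [C4 C40 h4] := mode_regular regular 4.
pose C := C0 + C1 + C2 + C3 + C4.
exists (C * B); first by rewrite mulr_ge0 // !addr_ge0.
move=> eps U k j t eps0 sol j4 t0; have [T00 hT0] := hT eps eps0.
have tt : 0 <= t by apply: le_trans t0.
have k1 : 0 < 1 + k%:R :> R by rewrite ltr_wpDr.
have dec : mxsize (fmat k (U 0)) <= B / (1 + k%:R) ^+ 8.
  rewrite ler_pdivlMr ?exprn_gt0 // mulrC; apply: Hnormsq_decay.
    by have := solution_ccont sol (lexx 0).
  by rewrite (sol_init sol); apply: hK.
have main (Cj : R) : 0 <= Cj -> Cj <= C ->
   mxsize (modeD A S eps U k j t) <= Cj * ((1 + k%:R) ^+ j * mxsize (fmat k (U 0))) ->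
   mxsize (modeD A S eps U k j t) <= (1 + k%:R) ^+ j * (C * B / (1 + k%:R) ^+ 8).
  move=> Cj0 CjC h; apply: le_trans h _.
  rewrite mulrCA ler_wpM2l ?exprn_ge0 ?(ltW k1) // -mulrA.
  by apply: ler_pM => //; exact: mxsize_ge0.
have thr l : (l <= 8)%N -> 2%:R * delta0^-1 * l%:R * eps * ln (1 / eps) <= t.
  by move=> l8; apply: le_trans (initial_layer_le l8 T00 hT0) t0.
case: j j4 main => [|[|[|[|[|//]]]]] _ main.
- by apply: main (h0 _ _ _ _ _ eps0 sol tt (thr _ _)) => //; rewrite /C; lra.
- by apply: main (h1 _ _ _ _ _ eps0 sol tt (thr _ _)) => //; rewrite /C; lra.
- by apply: main (h2 _ _ _ _ _ eps0 sol tt (thr _ _)) => //; rewrite /C; lra.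
- by apply: main (h3 _ _ _ _ _ eps0 sol tt (thr _ _)) => //; rewrite /C; lra.
- by apply: main (h4 _ _ _ _ _ eps0 sol tt (thr _ _)) => //; rewrite /C; lra.
Qed.

(** The mean value and Taylor estimates, entry by entry. *)
Lemma solution_mode_increments eps U k G a dt : exact_solution A S eps (Uin eps) U ->
  0 <= a -> 0 <= dt ->
  (forall j t, (j <= 4)%N -> a <= t -> mxsize (modeD A S eps U k j t) <= (1 + k%:R) ^+ j * G) ->
  (forall j, (j <= 3)%N -> mxsize (modeD A S eps U k j a - modeD A S eps U k j (a + dt))
     <= (m * 2)%:R * (dt * ((1 + k%:R) ^+ j.+1 * G))) /\
  mxsize (modeD A S eps U k 0 a + dt *: modeD A S eps U k 1 a
     + (dt ^+ 2 / 2) *: modeD A S eps U k 2 a + (dt ^+ 3 / 6) *: modeD A S eps U k 3 a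
     - modeD A S eps U k 0 (a + dt)) <= (m * 2)%:R * (dt ^+ 4 * ((1 + k%:R) ^+ 4 * G)).
Proof.
move=> sol a0 dt0 hG.
have ab : a <= a + dt by rewrite lerDl.
have b0 : 0 <= a + dt by apply: le_trans ab.
have e : a + dt - a = dt by rewrite addrC addKr.
pose h i l n (s : R) := modeD A S eps U k n `|s| i l.
have hE i l n s : 0 <= s -> h i l n s = modeD A S eps U k n s i l by move=> s0; rewrite /h ger0_norm.
have ch i l n : continuous (h i l n) by exact: (modeD_continuous sol).
have dh i l n (t : R) : 0 < t -> is_derive t 1 (h i l n) (h i l n.+1 t).
  by move=> t0; apply: is_derive_modeD_norm sol t0.
have bh i l n t : (n <= 4)%N -> a < t < a + dt -> `|h i l n t| <= (1 + k%:R) ^+ n * G.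
  move=> n4 /andP[at_ _]; rewrite hE ?(le_trans a0 (ltW at_)) //.
  by apply: le_trans (entry_le_mxsize _ i l) _; apply: hG => //; exact: ltW.
split=> [j j3|]; apply: mxsize_entry_le => i l.
  have := mean_value_bound a0 ab (ch i l j) (dh i l j) (fun t => bh i l j.+1 t j3).
  by rewrite e !hE // distrC !mxE.
have := taylor3_bound a0 ab (ch i l) (dh i l) (fun t => bh i l 4%N t (leqnn 4)).
by rewrite e !hE // !mxE.
Qed.

End SolutionModes.

(** * The inner product of the system *)
Section TraceForm.
Variables (R : realType) (m n : nat).
Implicit Types (G : 'M[R]_m) (x y : 'M[R]_(m, n)).

(** The sum over the columns of x and y of the form given by G. *)
Definition trform G x y : R := \tr (x^T *m G *m y).


Lemma trform_col G x : trform G x x = \sum_j ((col j x)^T *m G *m col j x) 0 0.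
Proof.
apply: eq_bigr => j _; rewrite tr_col -!row_mul !mxE; apply: eq_bigr => i _.
by rewrite !mxE.
Qed.

Lemma trform_psd G : psdmx G -> psd_form (trform G).
Proof.
move=> [sG pG]; split.
- by move=> x y; rewrite /trform -mxtrace_tr !trmx_mul trmxK sG mulmxA.
- move=> a x y z; rewrite /trform linearP !mulmxDl -!scalemxAl.
  by rewrite mxtraceD mxtraceZ.
- by move=> x; rewrite trform_col sumr_ge0.
Qed.

Lemma spd_psd G : spdmx G -> psdmx G.
Proof.
move=> [sG pG]; split=> // v; have [->|v0] := eqVneq v 0; last exact/ltW/pG.
by rewrite mulmx0 mxE.
Qed.

Lemma trform_spd_eq0 G x : spdmx G -> trform G x x = 0 -> x = 0.
Proof.
move=> spd; have [_ pG] := spd; have [_ p0] := spd_psd spd.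
rewrite trform_col => /eqP; rewrite psumr_eq0 // => /allP h.
apply/matrixP => i j; have := h j (mem_index_enum j).
have [/colP/(_ i) e _|c0] := eqVneq (col j x) 0; first by move: e; rewrite !mxE.
by rewrite /= gt_eqF // pG.
Qed.

Lemma trform_addl G G' x y : trform (G + G') x y = trform G x y + trform G' x y.
Proof. by rewrite /trform mulmxDr mulmxDl linearD. Qed.
Lemma trform_oppl G x y : trform (- G) x y = - trform G x y.
Proof. by rewrite /trform mulmxN mulNmx linearN. Qed.

(** A left inverse of the Cholesky factor recovers the entries. *)
Lemma entry_le_trform G : spdmx G -> exists2 c : R, 0 <= c & forall x i j,
  `|x i j| <= c * nrm (trform G) x.
Proof.
move=> spd; have psd := spd_psd spd; have [sG pG] := psd.
have [L GE] := psd_factor sG pG.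
have inj (w : 'cV[R]_m) : L *m w = 0 -> w = 0.
  move=> Lw; apply/eqP/negP => /negP w0; have [_ /(_ w w0)] := spd.
  by rewrite GE mulmxA -mulmxA Lw mulmx0 mxE ltxx.
have [X XL] := left_inverse inj.
exists (mxsize X); first exact: mxsize_ge0.
move=> x i j.
have Lx l : `|(L *m x) l j| <= nrm (trform G) x.
  rewrite -(ler_pXn2r (n := 2)) ?nnegrE ?nrm_ge0 // (nrm_sqr (trform_psd psd)).
  have -> : trform G x x = \sum_j \sum_l (L *m x) l j ^+ 2.
    rewrite /trform GE mulmxA -trmx_mul -mulmxA; apply: eq_bigr => a _; rewrite mxE.
    by apply: eq_bigr => b _; rewrite mxE expr2.
  rewrite real_normK ?num_real // (bigD1 j) //= (bigD1 l) //= -addrA lerDl.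
  rewrite addr_ge0 //; first by apply: sumr_ge0 => a _; apply: sqr_ge0.
  by apply: sumr_ge0 => b _; apply: sumr_ge0 => a _; apply: sqr_ge0.
rewrite -{1}[x]mul1mx -XL -mulmxA mxE; apply: le_trans (ler_norm_sum _ _ _) _.
apply: (@le_trans _ _ (\sum_l `|X i l| * nrm (trform G) x)).
  by apply: ler_sum => l _; rewrite normrM ler_wpM2l.
rewrite -mulr_suml ler_wpM2r ?nrm_ge0 // /mxsize [leRHS](bigD1 i) //= lerDl.
by apply: sumr_ge0 => a _; apply: sumr_ge0.
Qed.

(** Operators on a finite dimensional space are bounded; the bound is computed on the
    elementary matrices. *)
Lemma nrm_linear_le_mxsize (f : 'M[R]_(m, n) -> 'M[R]_(m, n) -> R)
    (L : {linear 'M[R]_(m, n) -> 'M[R]_(m, n)}) : psd_form f ->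
  exists2 c : R, 0 <= c & forall x, nrm f (L x) <= c * mxsize x.
Proof.
move=> psdf; pose c := \sum_i \sum_j nrm f (L (delta_mx i j)).
have c0 : 0 <= c by apply: sumr_ge0 => i _; apply: sumr_ge0 => j _; apply: nrm_ge0.
have dc i j : nrm f (L (delta_mx i j)) <= c.
  rewrite /c (bigD1 i) //= (bigD1 j) //= -addrA lerDl addr_ge0 //.
    by apply: sumr_ge0 => a _; apply: nrm_ge0.
  by apply: sumr_ge0 => b _; apply: sumr_ge0 => a _; apply: nrm_ge0.
exists c => // x; rewrite {1}[x]matrix_sum_delta (linear_sum L).
apply: le_trans (nrm_sum psdf _ _ _) _; rewrite mulr_sumr; apply: ler_sum => i _.
rewrite (linear_sum L).
apply: le_trans (nrm_sum psdf _ _ _) _; rewrite mulr_sumr; apply: ler_sum => j _.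
by rewrite (linearZZ L) (nrmZ psdf) mulrC ler_wpM2r.
Qed.

Lemma mxsize_le_trform G : spdmx G -> exists2 c : R, 0 <= c & forall x,
  mxsize x <= c * nrm (trform G) x.
Proof.
move=> spd; have [c c0 hc] := entry_le_trform spd.
exists ((m * n)%:R * c) => [|x]; first by rewrite mulr_ge0.
apply: (@le_trans _ _ (\sum_(i < m) \sum_(j < n) c * nrm (trform G) x)).
  by apply: ler_sum => i _; apply: ler_sum => j _; apply: hc.
by rewrite !sumr_const !card_ord -mulrnA mulnC -[leLHS]mulr_natl mulrA.
Qed.

Lemma nrm_linear_le G (L : {linear 'M[R]_(m, n) -> 'M[R]_(m, n)}) : spdmx G ->
  exists2 c : R, 0 <= c & forall x, nrm (trform G) (L x) <= c * nrm (trform G) x.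
Proof.
move=> spd; have psdf := trform_psd (spd_psd spd).
have [a a0 ha] := nrm_linear_le_mxsize L psdf.
have [b b0 hb] := mxsize_le_trform spd.
exists (a * b) => [|x]; first by rewrite mulr_ge0.
by apply: le_trans (ha x) _; rewrite -mulrA ler_wpM2l.
Qed.

End TraceForm.

Section SystemForm.
Variables (R : realType) (p r : nat) (A : 'M[R]_(p + r)) (S : 'M[R]_r)
  (A01 : 'M[R]_p) (A02 : 'M[R]_r).
Hypothesis stable : structurally_stable A S A01 A02.
Local Notation A0 := (block_mx A01 0 0 A02).
Local Notation Q := (relaxmx p S).
Local Notation V := 'M[R]_(p + r, 2).

Definition relaxed_proj : 'M[R]_(p + r) := block_mx 0 0 0 1%:M.
Local Notation P := relaxed_proj.

Lemma proj_idem : P *m P = P.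
Proof. by rewrite mulmx_block !(mul0mx, mulmx0, mulmx1, addr0, add0r). Qed.
Lemma relax_proj : Q *m P = Q.
Proof. by rewrite mulmx_block !(mul0mx, mulmx0, mulmx1, addr0, add0r). Qed.
Lemma proj_relax : P *m Q = Q.
Proof. by rewrite mulmx_block !(mul0mx, mulmx0, mul1mx, addr0, add0r). Qed.
Lemma proj_sym : P^T *m A0 = A0 *m P.
Proof.
by rewrite tr_block_mx !mulmx_block !trmx0 trmx1 !(mul0mx, mulmx0, mul1mx, mulmx1, addr0, add0r).
Qed.

Local Notation f := (trform A0 : V -> V -> R).
Local Notation g := (trform (- (A0 *m Q)) : V -> V -> R).

Lemma energy_psd : psd_form f.
Proof. exact: trform_psd (spd_psd (stable_spd stable)). Qed.

Lemma dissipation_block : - (A0 *m Q) = block_mx 0 0 0 (- (A02 *m S)).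
Proof. by rewrite mulmx_block !(mul0mx, mulmx0, addr0, add0r) opp_block_mx !oppr0. Qed.

Lemma dissipation_psd : psd_form g.
Proof.
apply: trform_psd; rewrite dissipation_block; have [sS pS] := spd_psd (stable_negdef stable).
split=> [|v]; first by rewrite tr_block_mx !trmx0 sS.
rewrite -[v]vsubmxK tr_col_mx mul_row_block !mulmx0 !addr0 add0r mul_row_col mul0mx add0r.
exact: pS.
Qed.

Lemma relax_dissipates (x y : V) : f x (mulmx Q y) = - g x y.
Proof. by rewrite /trform mulmxN mulNmx linearN opprK !mulmxA. Qed.

(** The trace of a symmetric matrix, here x^T A_0 A x, times a skew one, here rotJ,
    is zero. *)
Lemma transport_skew (x : V) : f x (transport A x) = 0.
Proof.
have J : (rotJ R)^T = - rotJ R.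
  apply/matrixP => -[[|[|//]] hi] -[[|[|//]] hj].
  by rewrite !mxE -?val_eqE /= ?opprK ?oppr0.
  by rewrite !mxE -?val_eqE /= ?opprK ?oppr0.
  by rewrite !mxE -?val_eqE /= ?opprK ?oppr0.
  by rewrite !mxE -?val_eqE /= ?opprK ?oppr0.
have [sA _] := stable_spd stable.
pose B := x^T *m (A0 *m A) *m x.
have sB : B^T = B.
  by rewrite /B !trmx_mul trmxK sA -(stable_sym stable) !mulmxA.
have e : f x (transport A x) = - \tr (B *m rotJ R).
  by rewrite /trform /transport mulmxN linearN /B !mulmxA.
have t : \tr (B *m rotJ R) = - \tr (B *m rotJ R).
  by rewrite -{1}mxtrace_tr trmx_mul sB J mulNmx linearN mxtrace_mulC.
by rewrite e; move: t; lra.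
Qed.

(** A_0 is block diagonal, so the projection is orthogonal for it. *)
Lemma nrm_proj (x : V) : nrm f (mulmx P x) <= nrm f x.
Proof.
rewrite -(ler_pXn2r (n := 2)) ?nnegrE ?nrm_ge0 // !(nrm_sqr energy_psd).
have sp a b : f (mulmx P a) b = f a (mulmx P b).
  by rewrite /trform trmx_mul -(mulmxA a^T) proj_sym !mulmxA.
have -> : f x x = f (P *m x) (P *m x) + f (x - P *m x) (x - P *m x).
  have o : f (P *m x) (x - P *m x) = 0.
    by rewrite sp mulmxBr mulmxA proj_idem subrr /trform mulmx0 linear0.
  have pyth (a b : V) : f a b = 0 -> f (a + b) (a + b) = f a a + f b b.
    by move=> ab; rewrite (formDl energy_psd) !(formDr energy_psd) (formC energy_psd b) ab addr0 add0r.
  by rewrite -(pyth _ _ o) addrC subrK.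
by rewrite lerDl (form_ge0 energy_psd).
Qed.

(** The dissipation inequality bounds the sum of the squares of the relaxed entries by
    twice the form g, and all norms are equivalent. *)
Lemma relax_coercive : exists2 lam : R, 0 < lam &
  forall x : V, lam * f (mulmx P x) (mulmx P x) <= g x x.
Proof.
have [c c0 hc] := nrm_linear_le_mxsize (@idfun V : {linear V -> V}) energy_psd.
pose d := c ^+ 2 * ((p + r).+1%:R * 2) ^+ 2.
have d0 : 0 <= d by rewrite mulr_ge0 ?sqr_ge0.
exists (2 * (1 + d))^-1; first by rewrite invr_gt0 mulr_gt0 // ltr_wpDr.
move=> x; rewrite mulrC ler_pdivrMr ?mulr_gt0 ?ltr_wpDr //.
set w := P *m x; set W := \sum_i \sum_j w i j ^+ 2.
have W0 : 0 <= W by apply: sumr_ge0 => i _; apply: sumr_ge0 => j _; apply: sqr_ge0.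
have h1 : f w w <= d * W.
  rewrite -(nrm_sqr energy_psd); apply: (@le_trans _ _ ((c * mxsize w) ^+ 2)).
    by rewrite ler_pXn2r ?nnegrE ?nrm_ge0 ?mulr_ge0 ?mxsize_ge0 //; exact: hc.
  by rewrite exprMn /d -mulrA ler_wpM2l ?sqr_ge0 //; exact: mxsize_sq_le.
have h2 : W <= 2 * g x x.
  have [_ pd] := stable_diss stable.
  have pdx : psd_form (trform (- block_mx 0 0 0 1%:M - (A0 *m Q + Q^T *m A0)) : V -> V -> R).
    exact: trform_psd (stable_diss stable).
  have := form_ge0 pdx x.
  have [sA _] := stable_spd stable.
  have e1 : trform (- block_mx 0 0 0 1%:M - (A0 *m Q + Q^T *m A0)) x x = 2 * g x x - \tr (w^T *m w).
    have e2 : trform (Q^T *m A0) x x = trform (A0 *m Q) x x.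
      by rewrite /trform -mxtrace_tr !trmx_mul !trmxK sA !mulmxA.
    have e3 : trform (block_mx 0 0 0 1%:M) x x = \tr (w^T *m w).
      rewrite /w trmx_mul mulmxA -(mulmxA x^T) [P^T]tr_block_mx !trmx0 trmx1.
      by rewrite -/P proj_idem.
    by rewrite trform_addl !trform_oppl trform_addl e2 e3; ring.
  rewrite e1 subr_ge0; apply: le_trans; rewrite le_eqVlt; apply/orP; left; apply/eqP.
  rewrite /mxtrace /W exchange_big; apply: eq_bigr => j _; rewrite [RHS]mxE.
  by apply: eq_bigr => i _; rewrite [w^T j i]mxE expr2.
have := ler_wpM2l d0 h2; nra.
Qed.

End SystemForm.

(** * Summation over the frequencies *)
Section Sums.
Variable R : realType.

(** Telescoping, since (k + 1)^-2 <= k^-1 - (k + 1)^-1. *)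
Lemma sum_inv_sqr_le N M : (N <= M)%N ->
  \sum_(N.+1 <= k < M.+1) ((1 + k%:R) ^+ 2)^-1 <= (1 + N%:R)^-1 - (1 + M%:R)^-1 :> R.
Proof.
elim: M => [|M IH].
  by rewrite leqn0 => /eqP ->; rewrite big_geq // subrr.
rewrite leq_eqVlt ltnS => /orP[/eqP <-|NM]; first by rewrite big_geq // subrr.
rewrite big_nat_recr //=; have := IH NM.
set s := \sum_(_ <= _ < _) _; set a := (1 + N%:R)^-1; move=> h.
have q0 : 0 <= M%:R :> R by [].
suff : ((1 + M.+1%:R) ^+ 2)^-1 <= (1 + M%:R)^-1 - (1 + M.+1%:R)^-1 :> R by move: h; lra.
rewrite -[M.+1%:R]natr1; move: (M%:R : R) q0 => q q0.
have q1 : 0 < 1 + q by lra.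
have q2 : 0 < 1 + (q + 1) by lra.
have -> : (1 + q)^-1 - (1 + (q + 1))^-1 = ((1 + q) * (1 + (q + 1)))^-1.
  by field; rewrite !gt_eqF.
by rewrite lef_pV2 ?posrE ?mulr_gt0 ?exprn_gt0 // expr2 ler_wpM2r ?ltW //; lra.
Qed.

Lemma sum_inv_pow8_le N M : (0 < N)%N -> (N <= M)%N ->
  \sum_(N.+1 <= k < M.+1) ((1 + k%:R) ^+ 8)^-1 <= (N%:R ^+ 6)^-1 :> R.
Proof.
move=> N0 NM; have n0 : 0 < N%:R :> R by rewrite ltr0n.
apply: (@le_trans _ _ (\sum_(N.+1 <= k < M.+1) (N%:R ^+ 6)^-1 * ((1 + k%:R) ^+ 2)^-1 :> R)).
  apply: ler_sum_nat => k /andP[Nk _].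
  have k0 : 0 < 1 + k%:R :> R by rewrite ltr_wpDr.
  rewrite -invfM lef_pV2 ?posrE ?mulr_gt0 ?exprn_gt0 // (exprD _ 6 2) ler_wpM2r ?exprn_ge0 ?(ltW k0) //.
  apply: lerXn2r; rewrite ?nnegrE ?(ltW k0) //.
  have : N%:R <= k%:R :> R by rewrite ler_nat ltnW.
  by lra.
rewrite -mulr_sumr ler_piMr ?invr_ge0 ?exprn_ge0 //.
apply: le_trans (sum_inv_sqr_le NM) _.
have h1 : (1 + N%:R)^-1 <= 1 :> R by rewrite invf_le1 ?lerDl // ltr_wpDr.
have h2 : 0 <= (1 + M%:R)^-1 :> R by rewrite invr_ge0 addr_ge0.
by lra.
Qed.

Lemma sum_inv_pow4_le N : \sum_(k < N.+1) ((1 + k%:R) ^+ 4)^-1 <= 2 :> R.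
Proof.
rewrite -(big_mkord xpredT (fun k => ((1 + k%:R) ^+ 4)^-1)) big_ltn // addr0 expr1n invr1.
have h : \sum_(1 <= k < N.+1) ((1 + k%:R) ^+ 4)^-1 <= \sum_(1 <= k < N.+1) ((1 + k%:R) ^+ 2)^-1 :> R.
  apply: ler_sum_nat => k _; have k1 : 1 <= 1 + k%:R :> R by rewrite lerDl.
  have k0 : 0 < 1 + k%:R :> R by apply: lt_le_trans k1.
  by rewrite lef_pV2 ?posrE ?exprn_gt0 //; apply: ler_weXn2l.
have := sum_inv_sqr_le (leq0n N); rewrite addr0 invr1.
have : 0 <= (1 + N%:R)^-1 :> R by rewrite invr_ge0 addr_ge0.
by move: h; lra.
Qed.

End Sums.

(** * Convergence *)
Section Convergence.
Variables (R : realType) (p r : nat) (A : 'M[R]_(p + r)) (S : 'M[R]_r)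
  (A01 : 'M[R]_p) (A02 : 'M[R]_r).
Hypothesis stable : structurally_stable A S A01 A02.
Variables (delta0 : R) (Uin : R -> R -> 'cV[R]_(p + r)) (T0 : R -> R).
Hypotheses (regular : regularity_constant A S delta0)
  (consistent : consistent_data 8 delta0 Uin T0).
Local Notation m := (p + r)%N.
Local Notation I := (@period_itv R).

(** The coefficients are of size (1 + k)^-8, hence their sum beyond N is at most of size N^-6.
    The solution is differentiable in x for t > 0 only, so t = 0 is reached as a
    limit. *)
Lemma solution_tail : exists2 G : R, 0 <= G & forall eps U N t i x,
  0 < eps -> exact_solution A S eps (Uin eps) U -> (0 < N)%N -> T0 eps <= t -> I x ->
  `|U t x i 0 - fsum (component (U t) i) N x| <= G / N%:R ^+ 6.
Proof.
have [G G0 hG] := solution_modes regular consistent.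
exists G => // eps U N t i x eps0 sol N0 Tt Ix.
have T00 : 0 <= T0 eps by have [_ /(_ eps eps0) []] := consistent.
have pos s : T0 eps <= s -> 0 < s ->
    `|U s x i 0 - fsum (component (U s) i) N x| <= G / N%:R ^+ 6.
  move=> Ts s0; apply: fourier_bound Ix.
  - exact: (solution_ccont sol (ltW s0)).
  - by move=> y _; have [] := sol_derivable sol y i s0.
  - move=> M NM; apply: le_trans (_ : G * \sum_(N.+1 <= k < M.+1) ((1 + k%:R) ^+ 8)^-1 <= _).
      rewrite mulr_sumr; apply: ler_sum => k _.
      have := hG eps U k 0%N s eps0 sol isT Ts; rewrite expr0 mul1r; apply: le_trans.
      rewrite /modeD /= /mxsize [leRHS](bigD1 i) //= -[leLHS]addr0 lerD //.
        by apply: ler_sum => j _; rewrite mxE.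
      by apply: sumr_ge0 => l _; apply: sumr_ge0.
    by rewrite ler_wpM2l // sum_inv_pow8_le.
have [t0|t0] := eqVneq t 0; last by apply: pos => //; rewrite lt_def t0 (le_trans T00).
pose h (s : R) := `|U `|s| x i 0 - \sum_(k < N.+1) \sum_j fmat k (U `|s|) i j * trig k j x|.
have hE s : 0 <= s -> h s = `|U s x i 0 - fsum (component (U s) i) N x|.
  move=> s0; rewrite /h (ger0_norm s0); congr (`|_ - _|); apply: eq_bigr => k _.
  by apply: eq_bigr => j _; rewrite mxE.
have ch : continuous h.
  move=> s; apply: (@cvg_norm _ _ _ _ _ (fun s : R => U `|s| x i 0 - \sum_(k < N.+1) \sum_j fmat k (U `|s|) i j * trig k j x)).
  have c1 : {for s, continuous (fun s : R => U `|s| x i 0)}.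
    apply: (@continuous_slice1 R (fun z => U `|z.1| z.2 i 0) (s : R) x).
    exact: (solution_continuous sol).
  apply: cvgB; first exact: c1.
  apply: continuous_sum => k; apply: continuous_sum => j s1.
  by apply: cvgM; [exact: (fmat_solution_continuous sol)|exact: cvg_cst].
rewrite t0 -hE //; apply: right_limit_le ch _ => s s0.
by rewrite hE ?(ltW s0) //; apply: pos => //; rewrite (le_trans Tt) // t0 ltW.
Qed.

Variables (s' : nat) (rk : imex_tableau R s'.+1).
Hypotheses (CK : type_CK rk) (isa : ISA rk)
  (ord1 : order1 rk) (ord2 : order2 rk) (ord3 : order3 rk)
  (c_eq : forall i, cim rk i = cex rk i)
  (stages : stage_order rk) (vanish : vanishing_coefficients rk).
Variables (M : 'M[R]_s'.+1) (v : 'cV[R]_s'.+1).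
Hypotheses (M1 : cond_M1 rk M) (M2 : cond_M2 M)
  (v_gen : null_generator (Him rk) v) (v_last : v ord_max 0 = 0).

(** The derivatives of order at most 4 are bounded by F (1 + k)^j with F of size
    (1 + k)^-8, so the error dt^3 F (1 + k)^4 decays like (1 + k)^-4.  The condition
    dt (1 + k)^2 <= 4 C_CFL follows from 1 + k <= 2 N. *)
Lemma mode_error_solution (C_CFL T : R) : 0 < C_CFL -> 0 < T ->
  exists c0 C : R, [/\ 0 < c0, 0 <= C & forall eps U N dt Un Us,
    0 < eps -> exact_solution A S eps (Uin eps) U -> (0 < N)%N -> 0 < dt ->
    imex_scheme A (relaxmx p S) rk eps dt N Un Us ->
    PN_projection N (U (T0 eps)) (Un 0%N) ->
    dt <= C_CFL / N%:R ^+ 2 -> dt <= c0 ->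
    forall k n, (k <= N)%N -> n%:R * dt <= T ->
    mxsize (fmat k (Un n) - fmat k (U (T0 eps + n%:R * dt)))
      <= C * dt ^+ 3 * ((1 + k%:R) ^+ 4)^-1].
Proof.
move=> CFL0 T_gt0; have spd := stable_spd stable.
pose f := trform (block_mx A01 0 0 A02) : 'M[R]_(m, 2) -> 'M[R]_(m, 2) -> R.
have psdf : psd_form f := energy_psd stable.
have [lam lam0 gPi] := relax_coercive stable.
have [CKt CKt0 boundK] := @nrm_linear_le R m 2 _ (transport A) spd.
have [CQ CQ0 boundQ] := @nrm_linear_le R m 2 _ (mulmx (relaxmx p S)) spd.
have [a a0 ha] := nrm_linear_le_mxsize (@idfun 'M[R]_(m, 2) : {linear 'M[R]_(m, 2) -> 'M[R]_(m, 2)}) psdf.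
have [b b0 hb] := @mxsize_le_trform R m 2 _ spd.
have [G G0 hG] := solution_modes regular consistent.
have [v0 Hv _] := v_gen.
have Cc0 : 0 <= 4 * C_CFL by rewrite mulr_ge0 // ltW.
have [c0 [C1 [c0_gt0 C10 hC]]] := @mode_error R 'M[R]_(m, 2) f
   (trform (- (block_mx A01 0 0 A02 *m relaxmx p S))) psdf (dissipation_psd stable)
   (fun x => @trform_spd_eq0 R m 2 _ x spd)
   (transport A) (mulmx (relaxmx p S)) (mulmx (relaxed_proj R p r)) lam CKt CQ lam0 CKt0 CQ0
   (transport_skew stable) boundK
   (fun x => etrans (mulmxA _ _ _) (congr1 (mulmx^~ x) (proj_idem R p r)))
   (fun x => etrans (mulmxA _ _ _) (congr1 (mulmx^~ x) (relax_proj p S)))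
   (fun x => etrans (mulmxA _ _ _) (congr1 (mulmx^~ x) (proj_relax p S)))
   (nrm_proj stable) boundQ (@relax_dissipates R p r S A01 A02) gPi
   s' rk CK isa ord1 ord2 ord3 c_eq stages vanish M v M1 M2 v0 Hv v_last
   (4 * C_CFL) T Cc0 (ltW T_gt0).
(* Increments in time are bounded entry by entry, which costs the number m * 2 of
   entries; the successor makes the factor at least 1. *)
pose F0 := a * ((m * 2).+1%:R * G).
have F00 : 0 <= F0 by rewrite mulr_ge0 // mulr_ge0.
exists c0, (b * C1 * F0); split=> //; first by rewrite !mulr_ge0.
move=> eps U N dt Un Us eps0 sol N0 dt0 scheme proj dtN dtc k n kN nT.
have T00 : 0 <= T0 eps by have [_ /(_ eps eps0) []] := consistent.
have k0 : 0 < 1 + k%:R :> R by rewrite ltr_wpDr.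
set w := (1 + k%:R : R) in k0 *.
have n0 : 0 < N%:R :> R by rewrite ltr0n.
pose F := F0 / w ^+ 8.
have FE c : F * c = a * ((m * 2).+1%:R * (c * (G / w ^+ 8))) by rewrite /F /F0; ring.
pose t j := T0 eps + j%:R * dt.
have Tt j : T0 eps <= t j by rewrite lerDl mulr_ge0 // ltW.
have tS j : t j.+1 = t j + dt by rewrite /t -addrA -natr1 mulrDl mul1r.
pose D j l := modeD A S eps U k j (t l).
have bD j s : (j <= 4)%N -> T0 eps <= s -> mxsize (modeD A S eps U k j s) <= w ^+ j * (G / w ^+ 8).
  by move=> j4 Ts; apply: hG.
have incr l := @solution_mode_increments _ _ _ A S Uin eps U k (G / w ^+ 8) (t l) dt sol
  (le_trans T00 (Tt l)) (ltW dt0) (fun j s j4 ls => bD j s j4 (le_trans (Tt l) ls)).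
have m1 : 1 <= (m * 2).+1%:R :> R by rewrite ler1n.
have mS : (m * 2)%:R <= (m * 2).+1%:R :> R by rewrite ler_nat.
have Gw : 0 <= G / w ^+ 8 by rewrite divr_ge0 // exprn_ge0 // ltW.
have CFL : dt * w ^+ 2 <= 4 * C_CFL.
  have h1 : w ^+ 2 <= 4 * N%:R ^+ 2.
    have -> : 4 * N%:R ^+ 2 = (2 * N%:R) ^+ 2 :> R by rewrite exprMn; ring.
    apply: lerXn2r; rewrite ?nnegrE ?(ltW k0) ?mulr_ge0 // /w.
    have : k%:R <= N%:R :> R by rewrite ler_nat.
    have : 1 <= N%:R :> R by rewrite ler1n.
    by lra.
  apply: le_trans (ler_wpM2l (ltW dt0) h1) _.
  by rewrite mulrCA ler_wpM2l // -ler_pdivlMr // exprn_gt0.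
have main := hC eps k%:R dt F D (fun l => fmat k (Un l)) (fun l i => fmat k (Us l i))
  eps0 (ler0n _ _) dt0 dtc CFL _ (fun l j => erefl) _ _ _ _
  (fun l i => mode_stage scheme k l i) (fun l => mode_update scheme k l) n nT.
apply: le_trans (hb _) _.
have -> : b * C1 * F0 * dt ^+ 3 * (w ^+ 4)^-1 = b * (C1 * (dt ^+ 3 * (F * w ^+ 4))).
  by rewrite /F; field; rewrite gt_eqF.
rewrite ler_wpM2l //; apply: main.
- by rewrite divr_ge0 // exprn_ge0 // ltW.
- move=> l j j4; apply: le_trans (ha (D j l)) _; rewrite FE ler_wpM2l //.
  apply: le_trans (bD j _ j4 (Tt l)) _.
  by rewrite ler_peMl // mulr_ge0 // exprn_ge0 // ltW.
- move=> l j j3; apply: le_trans (ha (D j l - D j l.+1)) _.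
  have [/(_ j j3) h _] := incr l; rewrite -/w -tS -/(D j l) -/(D j l.+1) in h.
  rewrite -mulrA -/w FE mulrCA ler_wpM2l //; apply: le_trans h _.
  rewrite mulrCA ler_wpM2l ?(ltW dt0) // ler_wpM2r //.
  by rewrite mulr_ge0 // exprn_ge0 // ltW.
- move=> l; apply: le_trans (ha _) _.
  have [_ h] := incr l; rewrite -/w -tS in h.
  rewrite -/w FE mulrCA ler_wpM2l //; apply: le_trans h _.
  rewrite mulrCA ler_wpM2l ?exprn_ge0 ?(ltW dt0) // ler_wpM2r //.
  by rewrite mulr_ge0 // exprn_ge0 // ltW.
- rewrite /D /modeD /= /t mul0r addr0.
  exact: PN_projection_fmat (solution_ccont sol T00) proj kN.
Qed.

(** Since every mode of the error is bounded in the maximum norm, so is the error, and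
    its square is integrated over the period. *)
Lemma convergence (C_CFL T : R) : 0 < C_CFL -> 0 < T ->
  exists c0 C : R, [/\ 0 < c0, 0 < C & forall eps U N dt Un Us,
    0 < eps -> exact_solution A S eps (Uin eps) U -> (0 < N)%N -> 0 < dt ->
    imex_scheme A (relaxmx p S) rk eps dt N Un Us ->
    PN_projection N (U (T0 eps)) (Un 0%N) ->
    dt <= Num.min (C_CFL / N%:R ^+ 2) c0 ->
    forall n, n%:R * dt <= T ->
    (L2sq (fun x => (Un n x - U (T0 eps + n%:R * dt) x)%R)
      <= (C * (dt ^+ 6 + 1 / N%:R ^+ 12))%:E)%E].
Proof.
move=> CFL0 T_gt0.
have [c0 [C [c0_gt0 C0 hC]]] := mode_error_solution CFL0 T_gt0.
have [G G0 hG] := solution_tail.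
pose C' := m%:R * (8 * C ^+ 2 + 2 * G ^+ 2) * (pi *+ 2).
have C'0 : 0 <= C'.
  have p0 : 0 <= pi *+ 2 :> R by rewrite mulrn_wge0 // pi_ge0.
  by rewrite mulr_ge0 // mulr_ge0 // addr_ge0 // mulr_ge0 // sqr_ge0.
exists c0, (1 + C'); split=> //; first by rewrite ltr_wpDr.
move=> eps U N dt Un Us eps0 sol N0 dt0 scheme proj; rewrite le_min => /andP[dtN dtc] n nT.
have T00 : 0 <= T0 eps by have [_ /(_ eps eps0) []] := consistent.
set t := T0 eps + n%:R * dt.
have Tt : T0 eps <= t by rewrite lerDl mulr_ge0 // ltW.
have n0 : 0 < N%:R :> R by rewrite ltr0n.
have hPN := scheme_Un_PN scheme n.
have [cUn _ _ _ _] := in_PN_smooth hPN.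
have cU : ccont (U t) by apply: (solution_ccont sol); exact: le_trans Tt.
have cd : ccont (fun x => Un n x - U t x).
  have := ccontD cUn (@ccontZ R m (-1) (U t) cU).
  by rewrite (_ : (fun x => _) = fun x => Un n x - U t x) //; apply/funext => x; rewrite scaleN1r.
pose E := 2 * C * dt ^+ 3 + G / N%:R ^+ 6.
have E0 : 0 <= E by rewrite addr_ge0 ?divr_ge0 ?mulr_ge0 ?exprn_ge0 // ltW.
have bE x i : I x -> `|(Un n x - U t x) i 0| <= E.
  move=> Ix.
  have -> : (Un n x - U t x) i 0 =
      \sum_(k < N.+1) (((fmat k (Un n) - fmat k (U t)) *m trigv k x) i 0)
      - (U t x i 0 - fsum (component (U t) i) N x).
    have -> : \sum_(k < N.+1) (((fmat k (Un n) - fmat k (U t)) *m trigv k x) i 0) =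
        Un n x i 0 - fsum (component (U t) i) N x.
      rewrite (PN_fourier hPN Ix) -fmat_fsum !summxE -sumrB; apply: eq_bigr => k _.
      by rewrite mulmxBl [LHS]mxE [X in _ + X = _]mxE.
    by rewrite mxE [X in _ + X = _]mxE; ring.
  apply: le_trans (ler_normB _ _) _; apply: lerD; last exact: (hG eps U N t i x eps0 sol N0 Tt Ix).
  apply: le_trans (ler_norm_sum _ _ _) _.
  apply: (@le_trans _ _ (\sum_(k < N.+1) C * dt ^+ 3 * ((1 + k%:R) ^+ 4)^-1)).
    apply: ler_sum => k _; apply: le_trans (harmonic_entry_le _ _ _ _) _.
    by apply: (hC eps U N dt Un Us) => //; rewrite -ltnS.
  rewrite -mulr_sumr (_ : 2 * C * dt ^+ 3 = C * dt ^+ 3 * 2); last by ring.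
  by rewrite ler_wpM2l ?sum_inv_pow4_le // mulr_ge0 // exprn_ge0 // ltW.
have sq x : I x -> sqsum (fun x => Un n x - U t x) x <= m%:R * E ^+ 2.
  move=> Ix; apply: le_trans (_ : \sum_(i < m) E ^+ 2 <= _).
    apply: ler_sum => i _; rewrite -real_normK ?num_real //.
    by apply: lerXn2r; rewrite ?nnegrE //; exact: bE.
  by rewrite sumr_const card_ord mulr_natl.
apply: le_trans (L2sq_le cd sq) _; rewrite lee_fin.
have e12 : 1 / N%:R ^+ 12 = (N%:R ^+ 6)^-1 ^+ 2 :> R.
  by rewrite div1r exprVn -exprM.
have e6 : dt ^+ 6 = (dt ^+ 3) ^+ 2 by rewrite -exprM.
rewrite e12 e6 /E; have x0 : 0 <= dt ^+ 3 by rewrite exprn_ge0 // ltW.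
have y0 : 0 <= (N%:R ^+ 6)^-1 :> R by rewrite invr_ge0 exprn_ge0.
move: (dt ^+ 3) ((N%:R ^+ 6)^-1) x0 y0 => x y x0 y0.
have h : (2 * C * x + G * y) ^+ 2 <= (8 * C ^+ 2 + 2 * G ^+ 2) * (x ^+ 2 + y ^+ 2).
  have := sqr_ge0 (2 * C * x - G * y).
  have := mulr_ge0 (sqr_ge0 (2 * C)) (sqr_ge0 y).
  have := mulr_ge0 (sqr_ge0 G) (sqr_ge0 x).
  by rewrite !expr2; move=> *; nra.
have pi0 : 0 <= pi *+ 2 :> R by rewrite mulrn_wge0 // pi_ge0.
apply: (@le_trans _ _ (C' * (x ^+ 2 + y ^+ 2))).
  have -> : C' * (x ^+ 2 + y ^+ 2) =
      m%:R * ((8 * C ^+ 2 + 2 * G ^+ 2) * (x ^+ 2 + y ^+ 2)) * (pi *+ 2).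
    by rewrite /C'; move: (pi *+ 2 : R) => q; ring.
  by rewrite ler_wpM2r // ler_wpM2l.
by rewrite ler_wpM2r ?addr_ge0 ?sqr_ge0 // lerDr.
Qed.

End Convergence.

Theorem theorem5p1 (R : realType) (p r : nat) (r_gt0 : (0 < r)%N)
  (A : 'M[R]_(p + r)) (S : 'M[R]_r) (A01 : 'M[R]_p) (A02 : 'M[R]_r)
  (stable : structurally_stable A S A01 A02)
  (delta0 : R) (regular : regularity_constant A S delta0)
  (s' : nat) (rk : imex_tableau R s'.+1)
  (CK : type_CK rk) (isa : ISA rk)
  (existsM : exists M : 'M[R]_s'.+1, cond_M1 rk M /\ cond_M2 M)
  (ord1 : order1 rk) (ord2 : order2 rk) (ord3 : order3 rk)
  (c_eq : forall i, cim rk i = cex rk i)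
  (v : 'cV[R]_s'.+1) (v_gen : null_generator (Him rk) v)
  (v_last : v ord_max 0 = 0)
  (stages : stage_order rk) (vanish : vanishing_coefficients rk)
  (Uin : R -> R -> 'cV[R]_(p + r)) (T0 : R -> R)
  (consistent : consistent_data 8 delta0 Uin T0)
  (C_CFL : R) (C_CFL_gt0 : 0 < C_CFL) (T : R) (T_gt0 : 0 < T) :
  exists c0 C : R, [/\ 0 < c0, 0 < C &
    forall (eps : R) (U : R -> R -> 'cV[R]_(p + r)) (N : nat) (dt : R)
      (Un : nat -> R -> 'cV[R]_(p + r))
      (Us : nat -> 'I_s'.+1 -> R -> 'cV[R]_(p + r)),
    0 < eps -> exact_solution A S eps (Uin eps) U ->
    (0 < N)%N -> 0 < dt ->
    imex_scheme A (relaxmx p S) rk eps dt N Un Us ->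
    PN_projection N (U (T0 eps)) (Un 0%N) ->
    dt <= Num.min (C_CFL / N%:R ^+ 2) c0 ->
    forall n : nat, n%:R * dt <= T ->
    (L2sq (fun x => (Un n x - U (T0 eps + n%:R * dt) x)%R)
      <= (C * (dt ^+ 6 + 1 / N%:R ^+ 12))%:E)%E].
Proof.
have [M [M1 M2]] := existsM.
have [c0 [C [c0_gt0 C_gt0 hC]]] := convergence stable regular consistent CK isa
  ord1 ord2 ord3 c_eq stages vanish M1 M2 v_gen v_last C_CFL_gt0 T_gt0.
by exists c0, C.
Qed.
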